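(* There exists a (nonzero) family of linear operators $\mathcal{R}_1=\mathcal{R}_1(u_1|v_1,v_2,v_3)$ on $\mathbb{C}[x_1,y_1,z_1,x_2,y_2,z_2]$, depending only on $u_1,v_1,v_2,v_3$ (not on $u_2,u_3$) and satisfying $$\mathcal{R}_1(u_1|v_1,v_2,v_3)=\mathcal{R}_1(u_1+\lambda|v_1+\lambda,v_2+\lambda,v_3+\lambda)\quad\text{for all }\lambda\in\mathbb{C},$$ which solves, for all generic parameters, the defining equations $$\mathcal{R}_{1}\,\mathrm{L}_{1}(u_1,u_2,u_3)\,\mathrm{L}_{2}(v_1,v_2,v_3)=\mathrm{L}_{1}(v_1,u_2,u_3)\,\mathrm{L}_{2}(u_1,v_2,v_3)\,\mathcal{R}_{1}.$$ These requirements fix $\mathcal{R}_1$ up to an overall normalization constant (a scalar, which may depend on the parameters): up to such a factor, $$\mathcal{R}_1\sim S_1^{-1}\cdot\frac{\Gamma(x\partial_x+u_1-v_2+1)}{\Gamma(x\partial_x+1)}\cdot e^{-\frac{y}{x}\partial_z}\cdot\frac{\Gamma(y\partial_y+u_1-v_3+1)}{\Gamma(y\partial_y+v_1-v_3+1)}\cdot e^{\frac{y}{x}\partial_z}\cdot\frac{\Gamma(x\partial_x+1)}{\Gamma(x\partial_x+v_1-v_2+1)}\cdot S_1,$$ where $$S_1=e^{(y_1-z_1x_2)\partial_{y_2}}\cdot e^{z_1\partial_{z_2}}\cdot e^{x_1\partial_{x_2}},$$ $$x=x_2,\quad y=y_2+x_2z_2,\quad z=z_2,\qquad \partial_x=\partial_{x_2}-z_2\partial_{y_2},\quad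 \partial_y=\partial_{y_2},\quad \partial_z=\partial_{z_2}-x_2\partial_{y_2}.$$
   Context: For complex parameters $a_1,a_2,a_3$ and $k\in\{1,2\}$ the $s\ell(3)$ Lax operator is the $3\times3$ matrix of differential operators $$\mathrm{L}_k(a_1,a_2,a_3)=\begin{pmatrix}1&0&0\\ -x_k&1&0\\ -y_k&-z_k&1\end{pmatrix}\begin{pmatrix}a_1&\partial_{x_k}-z_k\partial_{y_k}&\partial_{y_k}\\ 0&a_2&\partial_{z_k}\\ 0&0&a_3\end{pmatrix}\begin{pmatrix}1&0&0\\ x_k&1&0\\ y_k+x_kz_k&z_k&1\end{pmatrix}$$ acting on $\mathbb{C}[x_1,y_1,z_1,x_2,y_2,z_2]$, where products are matrix products with (noncommuting) operator entries. An operator placed to the left or right of a matrix composes with each entry from that side. Parameters are complex and generic: no pairwise difference of $u_1,u_2,u_3,v_1,v_2,v_3$ is an integer. Conventions for the explicit formula: exponentials act by their (locally finite) power series, so $S_1$ is an invertible operator on the polynomial ring. In the variables $x,y,z$ (with $x_1,y_1,z_1$ as spectators), $f(x\partial_x)$ and $f(y\partial_y)$ act on a monomial $x^py^qz^r$ by multiplication by $f(p)$ and $f(q)$. The factors involving $y/x$ take values in polynomials with negative powers of $x$ allowed; $1/\Gamma$ is taken to be $0$ at the nonpositive integers, so the leftmost factor $\Gamma(x\partial_x+u_1-v_2+1)/\Gamma(x\partial_x+1)$ annihilates monomials with negative powers of $x$. *)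

(* Defs.v *)
(* The complex numbers are R[i] for R : realType. *)
From HB Require Import structures.
From mathcomp Require Import all_boot all_order all_algebra.
From mathcomp.real_closed Require Export complex.
(* monalg and mpoly share names and notations: the ones of mpoly must win.  Both
   must be imported before MathComp-Analysis (notation levels). *)
From mathcomp.multinomials Require Export monalg.
From mathcomp.multinomials Require Export mpoly.
From mathcomp Require Import finmap all_classical all_reals all_analysis.

Set Implicit Arguments.
Unset Strict Implicit.
Unset Printing Implicit Defensive.

Import Order.TTheory GRing.Theory Num.Theory numFieldNormedType.Exports.

Local Open Scope classical_set_scope.
Local Open Scope ring_scope.

(* m ^ z = exp (z * ln m), for m > 0 *)
Definition natpowC (R : realType) (m : nat) (z : R[i]) : R[i] :=
  let t := ln (m%:R : R) in
  (expR (complex.Re z * t))%:C%C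
    * (cos (complex.Im z * t) +i* sin (complex.Im z * t))%C.

(* Gauss' product for the entire function 1 / Gamma:
   1 / Gamma(z) = lim_m z (z + 1) ... (z + m) / (m! m ^ z).
   It vanishes at the nonpositive integers.  R[i] gets its topology from its
   norm, as a numFieldType. *)
Definition rGamma (R : realType) (z : R[i]) : R[i] :=
  lim ((fun m : nat =>
    (\prod_(k < m.+1) (z + k%:R)) / (m`!%:R * natpowC m z))
      @ \oo : set_system ((R[i] : numFieldType)^o)).

(* At the poles of Gamma, this is 0 because of 0^-1 = 0. *)
Definition Gamma (R : realType) (z : R[i]) : R[i] := (rGamma z)^-1.

(* exp A = sum_n A^n / n!.  The sum has finite support at v when A is locally
   nilpotent (it is 0 by convention if the support is infinite). *)
Definition expop (R : realType) (V : lmodType R[i]) (A : V -> V) (v : V) : V :=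
  \sum_(n \in [set: nat]) (n`!%:R : R[i])^-1 *: iter n A v.

Definition generic (R : realType) (s : seq R[i]) : Prop :=
  forall i j : nat, (i < j < size s)%N ->
  forall m : int, s`_i - s`_j <> m%:~R.

Definition ix1 : 'I_6 := @Ordinal 6 0 isT.
Definition iy1 : 'I_6 := @Ordinal 6 1 isT.
Definition iz1 : 'I_6 := @Ordinal 6 2 isT.
Definition ix2 : 'I_6 := @Ordinal 6 3 isT.
Definition iy2 : 'I_6 := @Ordinal 6 4 isT.
Definition iz2 : 'I_6 := @Ordinal 6 5 isT.

(* C[x1, y1, z1, x2, y2, z2] *)
Notation Pol R := {mpoly R[i][6]}.

Definition opmx (R : realType) := 'M[Pol R -> Pol R]_3.

Definition opmul (R : realType) (A B : opmx R) : opmx R :=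
  \matrix_(i, k) (fun p => \sum_j A i j (B j k p)).

Definition opmx_rows (R : realType) (rows : seq (seq (Pol R -> Pol R)))
    : opmx R :=
  \matrix_(i, j) nth (fun=> 0) (nth [::] rows i) j.

(* Composition with each entry of T on the left, resp. on the right. *)
Definition opmx_compl (R : realType) (T : Pol R -> Pol R) (A : opmx R) :
  opmx R := map_mx (fun a : Pol R -> Pol R => T \o a) A.
Definition opmx_compr (R : realType) (A : opmx R) (T : Pol R -> Pol R) :
  opmx R := map_mx (fun a : Pol R -> Pol R => a \o T) A.

Definition Lax (R : realType) (x y z : 'I_6) (a1 a2 a3 : R[i]) : opmx R :=
  let O : Pol R -> Pol R := fun=> 0 in
  let I : Pol R -> Pol R := id in
  let M (q : Pol R) : Pol R -> Pol R := fun p => q * p in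
  let S (a : R[i]) : Pol R -> Pol R := fun p => a *: p in
  opmul
    (opmx_rows [:: [:: I;        O;        O];
                   [:: M (-'X_x); I;        O];
                   [:: M (-'X_y); M (-'X_z); I]])
    (opmul
      (opmx_rows [:: [:: S a1; fun p => p^`M(x) - 'X_z * p^`M(y); mderiv y];
                     [:: O;    S a2;                              mderiv z];
                     [:: O;    O;                                 S a3]])
      (opmx_rows [:: [:: I;                    O;      O];
                     [:: M 'X_x;               I;      O];
                     [:: M ('X_y + 'X_x * 'X_z); M 'X_z; I]])).

Definition L1 (R : realType) := @Lax R ix1 iy1 iz1.
Definition L2 (R : realType) := @Lax R ix2 iy2 iz2.

Definition S1 (R : realType) : Pol R -> Pol R :=
  expop (fun p : Pol R => ('X_iy1 - 'X_iz1 * 'X_ix2) * p^`M(iy2))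
  \o expop (fun p : Pol R => 'X_iz1 * p^`M(iz2))
  \o expop (fun p : Pol R => 'X_ix1 * p^`M(ix2)).

Definition S1inv (R : realType) : Pol R -> Pol R :=
  'pinv_(fun=> 0) [set: Pol R] (@S1 R).

(* C[x1, y1, z1][x, x^-1, y, z] as a vector space: the formal linear
   combinations of the monomials x1^a y1^b z1^c x^p y^q z^r, p : int, with
   x = x2, y = y2 + x2 z2, z = z2. *)
Definition lexp : choiceType := (nat * nat * nat * int * nat * nat)%type.
Notation laurent R := (monalg.malg lexp R[i]).

Definition lmon (R : realType) (e : lexp) : laurent R :=
  monalg.mkmalgU e (1 : R[i]).

Definition lin_ext (R : realType) (V : lmodType R[i]) (f : lexp -> V)
    (g : laurent R) : V :=
  \sum_(e <- monalg.msupp g) monalg.mcoeff e g *: f e.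

(* Rewriting a polynomial in the coordinates x, y, z: substitute
   y2 = y - x z. *)
Definition to_laurent (R : realType) (p : Pol R) : laurent R :=
  let q : Pol R :=
    p \mPo [tuple 'X_ix1; 'X_iy1; 'X_iz1;
                  'X_ix2; 'X_iy2 - 'X_ix2 * 'X_iz2; 'X_iz2] in
  \sum_(m <- msupp q) q@_m *:
    lmon R (m ix1, m iy1, m iz1, Posz (m ix2), m iy2, m iz2).

(* Back to the variables x2, y2, z2, on the span of the monomials without
   negative powers of x; the other monomials are sent to 0. *)
Definition of_laurent (R : realType) : laurent R -> Pol R :=
  lin_ext (fun e : lexp =>
    let '(a, b, c, p, q, r) := e in
    if p is Posz n then
      'X_ix1 ^+ a * 'X_iy1 ^+ b * 'X_iz1 ^+ c
        * ('X_ix2 ^+ n * ('X_iy2 + 'X_ix2 * 'X_iz2) ^+ q * 'X_iz2 ^+ r)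
    else 0 : Pol R).

(* f (x d/dx), for d/dx in the coordinates x, y, z; likewise below. *)
Definition fun_xdx (R : realType) (f : R[i] -> R[i]) : laurent R -> laurent R :=
  lin_ext (fun e : lexp =>
    let '(a, b, c, p, q, r) := e in f p%:~R *: lmon R (a, b, c, p, q, r)).

Definition fun_ydy (R : realType) (f : R[i] -> R[i]) : laurent R -> laurent R :=
  lin_ext (fun e : lexp =>
    let '(a, b, c, p, q, r) := e in f q%:R *: lmon R (a, b, c, p, q, r)).

(* (y / x) d/dz *)
Definition yx_dz (R : realType) : laurent R -> laurent R :=
  lin_ext (fun e : lexp =>
    let '(a, b, c, p, q, r) := e in
    r%:R *: lmon R (a, b, c, p - 1, q.+1, r.-1)).

Definition R1_formula (R : realType) (u1 v1 v2 v3 : R[i]) : Pol R -> Pol R :=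
  @S1inv R
  \o @of_laurent R
  \o fun_xdx (fun t => Gamma (t + u1 - v2 + 1) * rGamma (t + 1))
  \o expop (fun g => - yx_dz g)
  \o fun_ydy (fun t => Gamma (t + u1 - v3 + 1) * rGamma (t + v1 - v3 + 1))
  \o expop (@yx_dz R)
  \o fun_xdx (fun t => Gamma (t + 1) * rGamma (t + v1 - v2 + 1))
  \o @to_laurent R
  \o @S1 R.

Definition opfamily (R : realType) :=
  R[i] -> R[i] -> R[i] -> R[i] -> {linear Pol R -> Pol R}.

Definition shift_invariant (R : realType) (R1 : opfamily R) : Prop :=
  forall u1 v1 v2 v3 : R[i], generic [:: u1; v1; v2; v3] ->
  forall lambda : R[i],
    R1 u1 v1 v2 v3 =1 R1 (u1 + lambda) (v1 + lambda) (v2 + lambda) (v3 + lambda).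

Definition defining_equations (R : realType) (R1 : opfamily R) : Prop :=
  forall u1 u2 u3 v1 v2 v3 : R[i], generic [:: u1; u2; u3; v1; v2; v3] ->
    opmx_compl (R1 u1 v1 v2 v3) (opmul (L1 u1 u2 u3) (L2 v1 v2 v3))
    = opmx_compr (opmul (L1 v1 u2 u3) (L2 u1 v2 v3)) (R1 u1 v1 v2 v3).

(* Main.v *)
From HB Require Import structures.
Require Import Defs.
From mathcomp Require Import all_boot all_order all_algebra.
From mathcomp Require Import finmap.
From mathcomp Require Import all_classical all_reals all_analysis.
From mathcomp Require Import ring lra.

(** Conjugation by an automorphism [theta] of the polynomial ring removes the
    first point from L_2.  [theta] fixes x1, y1, z1 and is S_1 followed by the
    passage to the coordinates x, y, z; it refers the second point to a frame
    attached to the first one.  Let N be the rightmost unitriangular factor of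
    L_1 ([lower]).  In the frame, L_2(v) becomes N^-1 LL(v) N, where the entries
    of LL involve x, y, z only, and L_1(u) becomes N^-1 tau(u) N, where tau is
    upper triangular with the parameters on its diagonal ([theta_lax1],
    [theta_lax2]).  The defining equation for R_1 becomes an equation between
    tau LL and F = theta R_1 theta^-1 ([LL_equationE]).

    Uniqueness.  R_1 does not see u2, u3 nor a common shift of all parameters,
    and shifts by integers preserve genericity.  Such shifts add constant
    diagonal matrices to tau and LL, so the differences of the equations at
    shifted parameters are equations of lower order.  They give that F commutes
    with N, with the variables and the derivatives of the first point, and that
    F intertwines the second and the third row of LL ([intertwiner],
    [intertwiner_of_equations]).  Such an F sends 1 to a constant
    ([intertwiner_const]), and is determined by it: the entries of these rows
    produce every monomial from 1, with coefficients that do not vanish for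
    generic parameters ([intertwiner_eq0]).  So two solutions are proportional.

    Existence.  An intertwiner solves the equations as soon as it intertwines
    two quadratic operators from the first row of tau LL as well
    ([intertwiner_equation]); the other entries are commutators of entries
    already treated ([o31_commutator], [q12_commutator]).  In the frame, the
    explicit formula maps x^p y^q z^r to the sum over k of

      C(u1 - v1, k) p^_k r^_k  a_k  x^(p-k) y^(q+k) z^(r-k),

    where a_k is a product of values of Gamma and 1 / Gamma.  Indeed, the
    conjugation of a function of y d/dy by exp (y/x d/dz) is Newton's expansion
    in finite differences ([exp_conjugation]), and the finite differences of a
    quotient of Gamma functions have a closed form ([fdiff_ratio]).  Each
    relation then compares two consecutive coefficients and reduces to a
    rational identity ([closed_form_intertwiner]).

    Of the Gamma function, only Gamma(z + 1) = z Gamma(z) and the finiteness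
    and non-vanishing away from the nonpositive integers matter.  Both follow
    from Gauss' product, because the quotient of two consecutive terms is
    1 + O(1 / n^2) ([gauss_err_bound], [prod_cvg_neq0]). *)

Import Order.TTheory GRing.Theory Num.Theory numFieldNormedType.Exports.
Set Implicit Arguments.
Unset Strict Implicit.
Unset Printing Implicit Defensive.
Local Open Scope ring_scope.

(** * Elementary bounds and infinite products *)

Section elementary_bounds.
Local Open Scope classical_set_scope.
Local Open Scope ring_scope.
Variable R : realType.
Implicit Types (x t : R).

Lemma mvt0 (f df : R -> R) x : (forall y : R, is_derive y 1 f (df y)) ->
  exists2 c, `|c| <= `|x| & f x - f 0 = df c * x.
Proof.
move=> fdf.
have cf a b : {within `[a, b], continuous f}.
  apply: continuous_subspaceT => y; apply: differentiable_continuous.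
  by apply/derivable1_diffP; case: (fdf y).
have [x0|x0] := leP 0 x.
  have [c + ->] := MVT_segment x0 (fun y _ => fdf y) (cf 0 x).
  by rewrite in_itv/= => /andP[c0 cx]; exists c; rewrite ?subr0// !ger0_norm.
have [c + E] := MVT_segment (ltW x0) (fun y _ => fdf y) (cf x 0).
rewrite in_itv/= => /andP[xc c0]; exists c; first by rewrite !ler0_norm ?lerN2 // ltW.
by rewrite -opprB E; ring.
Qed.

Lemma norm_sin_le x : `|sin x| <= `|x|.
Proof.
have [c _] := @mvt0 sin cos x (fun y => is_derive_sin y).
by rewrite sin0 subr0 => ->; rewrite normrM ler_piMl// cos_max.
Qed.

Lemma norm_cosB1_le x : `|cos x - 1| <= x ^+ 2.
Proof.
have [c cx] := @mvt0 cos (fun y => - sin y) x (fun y => is_derive_cos y).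
rewrite cos0 => ->; rewrite normrM normrN -(ger0_norm (sqr_ge0 x)) expr2 normrM.
by rewrite ler_wpM2r// (le_trans (norm_sin_le _)).
Qed.

Lemma norm_sinB_le x : `|sin x - x| <= `|x| ^+ 3.
Proof.
have [c cx] := @mvt0 (fun y => sin y - y) (fun y => cos y - 1) x
   (fun y => is_deriveB (is_derive_sin y) (is_derive_id y 1)).
rewrite sin0 !subr0 => ->; rewrite normrM exprSr ler_wpM2r//.
apply: le_trans (norm_cosB1_le _) _.
by rewrite -(real_normK (num_real c)) lerXn2r ?nnegrE.
Qed.

Lemma norm_expRB_le x : `|expR x - 1 - x| <= x ^+ 2 * expR `|x|.
Proof.
have e1 := expR_ge1Dx x.
have e2 : expR x - 1 <= x * expR x.
  have := expR_ge1Dx (- x); rewrite expRN => h.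
  have := ler_wpM2r (expR_ge0 x) h; rewrite mulVf ?gt_eqF ?expR_gt0//; lra.
rewrite ger0_norm; last by lra.
have [x0|x0] := leP 0 x.
  rewrite ger0_norm//; have := ler_wpM2l x0 e2; rewrite expr2; lra.
rewrite ltr0_norm//; have x0' : 0 <= - x by lra.
have e3 : 1 <= expR (- x) by rewrite -expR0 ler_expR.
have := ler_wpM2l (sqr_ge0 x) e3.
have : - x * (1 - expR x) <= - x * - x by apply: ler_wpM2l => //; lra.
rewrite mulr1 expr2; lra.
Qed.

(** The first-order expansion of exp ((a + i b) t) at t = 0.  With
    t = ln (n + 1) - ln n, it controls the quotient of n ^ z and (n + 1) ^ z. *)
Lemma cexp_taylor (a b : R) : exists2 K : R, 0 <= K & forall t, 0 <= t <= 1 ->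
  `|expR (a * t) * cos (b * t) - 1 - a * t| <= K * t ^+ 2 /\
  `|expR (a * t) * sin (b * t) - b * t| <= K * t ^+ 2.
Proof.
pose E := expR `|a|.
have E0 : 0 <= E by apply: expR_ge0.
exists (E * `|b| ^+ 2 + `|a| ^+ 2 * E + E * `|b| ^+ 3 + E * `|a| * `|b| +
   E * `|b| ^+ 2 + `|a| ^+ 2 * E).
  by rewrite !addr_ge0// ?mulr_ge0// ?exprn_ge0.
move=> t /andP[t0 t1].
have Nt : `|t| = t by rewrite ger0_norm.
have at_ : `|a * t| <= `|a| by rewrite normrM Nt ler_piMr.
have bt : `|b * t| = `|b| * t by rewrite normrM Nt.
have Eat : expR (a * t) <= E by rewrite ler_expR (le_trans (ler_norm _)).
have e1 : `|expR (a * t) - 1 - a * t| <= `|a| ^+ 2 * E * t ^+ 2.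
  apply: le_trans (norm_expRB_le _) _.
  rewrite -[(a * t) ^+ 2]ger0_norm ?sqr_ge0// normrX normrM Nt exprMn mulrAC.
  by rewrite ler_wpM2r ?sqr_ge0// ler_wpM2l ?sqr_ge0// ler_expR ler_piMr.
have e2 : `|expR (a * t) - 1| <= E * `|a| * t.
  have [c cx] := @mvt0 expR expR (a * t) (fun y => is_derive_expR y).
  rewrite expR0 => ->; rewrite normrM normrM Nt mulrA ler_wpM2r// ler_wpM2r//.
  by rewrite ger0_norm ?expR_ge0// ler_expR (le_trans (ler_norm _))// (le_trans cx).
have c1 : `|cos (b * t) - 1| <= `|b| ^+ 2 * t ^+ 2.
  by apply: le_trans (norm_cosB1_le _) _; rewrite -exprMn -bt -normrX ger0_norm ?sqr_ge0.
have s1 : `|sin (b * t) - b * t| <= `|b| ^+ 3 * t ^+ 2.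
  apply: le_trans (norm_sinB_le _) _; rewrite bt exprMn ler_wpM2l ?exprn_ge0//.
  by rewrite exprSr ler_piMr ?sqr_ge0.
have F0 := expR_ge0 (a * t).
have b0 : 0 <= `|b| by []. have a0 : 0 <= `|a| by [].
have T2 := sqr_ge0 t.
split.
  have -> : expR (a * t) * cos (b * t) - 1 - a * t =
    expR (a * t) * (cos (b * t) - 1) + (expR (a * t) - 1 - a * t) by ring.
  apply: le_trans (ler_normD _ _) _; rewrite normrM (ger0_norm F0).
  have := ler_pM F0 (normr_ge0 _) Eat c1.
  have : 0 <= (E * `|b| ^+ 3 + E * `|a| * `|b| +
   E * `|b| ^+ 2 + `|a| ^+ 2 * E) * t ^+ 2 by rewrite !(addr_ge0, mulr_ge0, exprn_ge0).
  lra.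
have -> : expR (a * t) * sin (b * t) - b * t =
   expR (a * t) * (sin (b * t) - b * t) + (expR (a * t) - 1) * (b * t) by ring.
apply: le_trans (ler_normD _ _) _; rewrite !normrM (ger0_norm F0) Nt.
have := ler_pM F0 (normr_ge0 _) Eat s1.
have bt0 : 0 <= `|b| * t by rewrite mulr_ge0.
have := ler_wpM2r bt0 e2.
have : 0 <= (E * `|b| ^+ 2 + `|a| ^+ 2 * E + E * `|b| ^+ 2 + `|a| ^+ 2 * E) * t ^+ 2
  by rewrite !(addr_ge0, mulr_ge0, exprn_ge0).
lra.
Qed.
End elementary_bounds.

Section infinite_products.
Import ComplexField.Normc.
Local Open Scope classical_set_scope.
Local Open Scope ring_scope.
Variable R : realType.
Local Notation C := (R[i]).
Local Notation Ctop := ((R[i] : numFieldType)^o).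
Implicit Types (w e : nat -> C).

(** A majorant of order 1 / n^2 whose sums telescope. *)
Definition gap n : R := n.+1%:R^-1 - n.+2%:R^-1.

Lemma gap_gt0 n : 0 < gap n.
Proof. by rewrite subr_gt0 ltf_pV2 ?posrE ?ltr0n// ltr_nat. Qed.

(** a_n - K / (n + 1) is nondecreasing and bounded, and K / (n + 1) tends
    to 0. *)
Lemma cvg_of_gap (a : R^nat) K : (forall n, `|a n.+1 - a n| <= K * gap n) ->
  cvgn a.
Proof.
move=> aK.
have K0 : 0 <= K.
  by have := le_trans (normr_ge0 _) (aK 0%N); rewrite pmulr_lge0 ?gap_gt0.
pose h n : R := K * n.+1%:R^-1.
have h0 n : 0 <= h n by rewrite mulr_ge0.
have hgap n : h n - h n.+1 = K * gap n by rewrite /h /gap; ring.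
have ub n : a n + h n <= a 0%N + h 0%N.
  elim: n => // n IH; apply: le_trans IH.
  have /ler_normlP[] := aK n; rewrite -hgap; lra.
have c1 : cvgn (a \- h).
  apply: nondecreasing_is_cvgn.
    apply/nondecreasing_seqP => n /=.
    have /ler_normlP[] := aK n; rewrite -hgap; lra.
  exists (a 0%N + h 0%N) => _ [n _ <-] /=; have := ub n; have := h0 n; lra.
have c2 : h @ \oo --> K * 0 by apply: cvgM; [exact: cvg_cst|exact: cvg_harmonic].
have -> : a = (a \- h) \+ h by apply/funext => n /=; ring.
by apply: is_cvgD => //; apply/cvg_ex; exists (K * 0).
Qed.

Lemma normc_Re (x : C) : `|complex.Re x| <= normc x.
Proof.
case: x => a b /=; rewrite -sqrtr_sqr ler_wsqrtr// lerDl sqr_ge0 //.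
Qed.

Lemma normc_Im (x : C) : `|complex.Im x| <= normc x.
Proof.
case: x => a b /=; rewrite -sqrtr_sqr ler_wsqrtr// lerDr sqr_ge0 //.
Qed.

Lemma normc_ge0 (x : C) : 0 <= normc x.
Proof. by case: x => a b; exact: sqrtr_ge0. Qed.

Lemma normc_real (x : R) : normc x%:C%C = `|x|.
Proof. by rewrite /= expr0n addr0 sqrtr_sqr. Qed.

Lemma normc_le (x : C) : normc x <= `|complex.Re x| + `|complex.Im x|.
Proof.
case: x => a b; have -> : (a +i* b)%C = a%:C%C + 'i%C * b%:C%C by rewrite [LHS]complexE.
apply: le_trans (le_normcD _ _) _; rewrite normcM !normc_real /=.
by rewrite !(mul0r,mul1r,mulr0,addr0,add0r,subr0,oppr0) expr0n /= add0r expr1n sqrtr1 mul1r.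
Qed.

Lemma cvg_complex (a b : R^nat) la lb : a @ \oo --> la -> b @ \oo --> lb ->
  (fun n => (a n +i* b n)%C : Ctop) @ \oo --> ((la +i* lb)%C : Ctop).
Proof.
move=> ca cb; apply/cvgrPdist_lt => eps eps0.
have [e0 Ee] : 0 < complex.Re eps /\ eps = (complex.Re eps)%:C%C.
  by move: eps0; case: eps => x y; rewrite ltcE /= => /andP[/eqP-> ->].
have e20 : 0 < complex.Re eps / 2 by rewrite divr_gt0.
move/cvgrPdist_lt: ca => /(_ _ e20) ca; move/cvgrPdist_lt: cb => /(_ _ e20) cb.
near=> n.
have h1 : `|la - a n| < complex.Re eps / 2 by near: n.
have h2 : `|lb - b n| < complex.Re eps / 2 by near: n.
rewrite Ee.
have -> : `|(la +i* lb)%C - (a n +i* b n)%C : Ctop| = (normc ((la - a n) +i* (lb - b n))%C)%:C%C by [].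
rewrite ltcR; apply: le_lt_trans (normc_le _) _ => /=; lra.
Unshelve. all: by end_near. Qed.

(** |1 + e_n| <= exp (K gap n), and the exponents telescope. *)
Lemma prod_bounded w e K : (forall n, w n.+1 = w n * (1 + e n)) ->
  (forall n, normc (e n) <= K * gap n) -> exists B, forall n, normc (w n) <= B.
Proof.
move=> we eK; exists (normc (w 0%N) * expR K) => n.
have K0 : 0 <= K.
  by have := le_trans (normc_ge0 _) (eK 0%N); rewrite pmulr_lge0 ?gap_gt0.
have : normc (w n) * expR (K * n.+1%:R^-1) <= normc (w 0%N) * expR K.
  elim: n => [|n IH]; first by rewrite invr1 mulr1.
  apply: le_trans IH; rewrite we normcM -mulrA ler_wpM2l ?normc_ge0//.
  have -> : n.+1%:R^-1 = gap n + n.+2%:R^-1 :> R by rewrite /gap; ring.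
  rewrite mulrDr expRD ler_wpM2r ?expR_ge0//.
  apply: le_trans (le_normcD _ _) _; rewrite normc1.
  by apply: le_trans (expR_ge1Dx _); rewrite lerD2l.
apply: le_trans; rewrite ler_peMr ?normc_ge0// -expR0 ler_expR mulr_ge0//.
Qed.

Lemma prod_cvg w e K : (forall n, w n.+1 = w n * (1 + e n)) ->
  (forall n, normc (e n) <= K * gap n) -> exists l : C, (w : nat -> Ctop) @ \oo --> (l : Ctop).
Proof.
move=> we eK; have [B wB] := prod_bounded we eK.
have B0 : 0 <= B := le_trans (normc_ge0 _) (wB 0%N).
have wd n : normc (w n.+1 - w n) <= (B * K) * gap n.
  have -> : w n.+1 - w n = w n * e n by rewrite we; ring.
  by rewrite normcM -mulrA ler_pM ?normc_ge0.
have c1 : cvgn (fun n => complex.Re (w n)).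
  apply: (@cvg_of_gap _ (B * K)) => n; apply: le_trans (wd n); apply: le_trans (normc_Re _).
  by case: (w n.+1) (w n) => ? ? [].
have c2 : cvgn (fun n => complex.Im (w n)).
  apply: (@cvg_of_gap _ (B * K)) => n; apply: le_trans (wd n); apply: le_trans (normc_Im _).
  by case: (w n.+1) (w n) => ? ? [].
have := cvg_complex c1 c2.
have -> : (fun n => (complex.Re (w n) +i* complex.Im (w n))%C : Ctop) = w.
  by apply/funext => n; case: (w n).
by exists (limn (fun n => complex.Re (w n)) +i* limn (fun n => complex.Im (w n)))%C.
Qed.

Lemma gap_small (K : R) : 0 <= K -> exists N, forall n, (N <= n)%N -> K * gap n <= 2^-1.
Proof.
move=> K0; exists (Num.truncn (2 * K)).+1 => n Nn.
have h : 2 * K <= n.+1%:R.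
  apply: ltW; apply: lt_le_trans (truncnS_gt _) _; by rewrite ler_nat ltnW.
apply: (@le_trans _ _ (K * n.+1%:R^-1)); first by rewrite ler_wpM2l// /gap lerBlDr lerDl.
by rewrite ler_pdivrMr ?ltr0n// mulrC ler_pdivlMr// mulrC.
Qed.

(** Once |e_n| <= 1/2, the inverses of the partial products satisfy a recursion
    of the same kind, hence they converge too, and the limit cannot be 0. *)
Lemma prod_cvg_neq0 w e K : (forall n, w n.+1 = w n * (1 + e n)) ->
  (forall n, normc (e n) <= K * gap n) -> (forall n, w n != 0) ->
  exists2 l : C, (w : nat -> Ctop) @ \oo --> (l : Ctop) & l != 0.
Proof.
move=> we eK w0; have [l wl] := prod_cvg we eK; exists l => //.
have K0 : 0 <= K.
  by have := le_trans (normc_ge0 _) (eK 0%N); rewrite pmulr_lge0 ?gap_gt0.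
have [N HN] := gap_small K0.
have n1e n : (N <= n)%N -> 2^-1 <= normc (1 + e n).
  move=> /HN h; have := le_normcD (1 + e n) (- e n); rewrite addrK normc1 normcN.
  have := eK n; lra.
have e1 n : 1 + e n != 0 by apply/negP => /eqP h; have := w0 n.+1; rewrite we h mulr0 eqxx.
have gapD n : gap (n + N) <= gap n.
  rewrite /gap.
  have E k : k.+1%:R^-1 - k.+2%:R^-1 = (k.+1%:R * k.+2%:R)^-1 :> R.
    rewrite -[k.+2%:R]natr1; have : 0 < k.+1%:R :> R by rewrite ltr0n.
    by move: k.+1%:R => x x0; field; rewrite !gt_eqF//; lra.
  by rewrite !E -!natrM lef_pV2 ?posrE ?ltr0n ?muln_gt0// ler_nat leq_mul// !ltnS leq_addr.
(* w_(n+1)^-1 = w_n^-1 (1 - e_n / (1 + e_n)) *)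
have [l' wl'] : exists l : C, ((fun n => (w (n + N)%N)^-1) : nat -> Ctop) @ \oo --> (l : Ctop).
  apply: (@prod_cvg _ (fun n => - e (n + N)%N / (1 + e (n + N)%N)) (2 * K)) => n.
    rewrite addSn we invfM; congr (_ * _); have := e1 (n + N)%N => h; field; done.
  rewrite normcM normcN normcV.
  have h := n1e _ (leq_addl n N).
  rewrite ler_pdivrMr; last by lra.
  apply: le_trans (eK _) _; apply: (@le_trans _ _ (K * gap n)); first by rewrite ler_wpM2l.
  have g0 := gap_gt0 n.
  have : 0 <= K * gap n by rewrite mulr_ge0// ltW.
  move=> h3; have := ler_wpM2l h3 h; lra.
apply/negP => /eqP l0; move: wl; rewrite l0 => wl.
have wl2 : (fun n => w (n + N)%N : Ctop) @ \oo --> (0 : Ctop) by rewrite cvg_shiftn.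
have := cvgM wl2 wl'; rewrite mul0r => h.
have h1 : (fun _ : nat => 1 : Ctop) @ \oo --> (0 : Ctop).
  have -> : (fun _ : nat => 1 : Ctop) = (fun n => (w (n + N)%N : Ctop) * (w (n + N)%N)^-1).
    by apply/funext => n; rewrite mulfV.
  exact: h.
have h2 : (fun _ : nat => 1 : Ctop) @ \oo --> (1 : Ctop) by apply: cvg_cst.
have /eqP : (0 : Ctop) = 1 by apply: (cvg_unique _ h1 h2); exact: norm_hausdorff.
by rewrite eq_sym oner_eq0.
Qed.
End infinite_products.

(** * Functional equation and zeros of the reciprocal Gamma function *)

Section reciprocal_gamma.
Import ComplexField.Normc.
Local Open Scope classical_set_scope.
Local Open Scope ring_scope.
Variable R : realType.
Local Notation C := (R[i]).
Local Notation Ctop := ((R[i] : numFieldType)^o).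
Implicit Types (z : C).

Definition cexp (a b : R) : C := (expR a)%:C%C * (cos b +i* sin b)%C.

Lemma cexpE a b : cexp a b = (expR a * cos b +i* (expR a * sin b))%C.
Proof. by rewrite /cexp; simpc. Qed.

Lemma cexpD a b a' b' : cexp (a + a') (b + b') = cexp a b * cexp a' b'.
Proof.
by rewrite !cexpE; simpc; rewrite expRD cosD sinD; congr (_ +i* _)%C; ring.
Qed.

Lemma cexp0 : cexp 0 0 = 1.
Proof. by rewrite cexpE expR0 cos0 sin0 !mul1r. Qed.

Lemma cexp_neq0 a b : cexp a b != 0.
Proof.
apply/eqP => h; have := cexpD a b (- a) (- b); rewrite h mul0r !subrr cexp0.
by move/eqP; rewrite oner_eq0.
Qed.

Definition gauss z (m : nat) : C :=
  (\prod_(k < m.+1) (z + k%:R)) / (m`!%:R * natpowC m z).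

Lemma natpowCE m z : natpowC m z =
  cexp (complex.Re z * ln m%:R) (complex.Im z * ln m%:R).
Proof. by []. Qed.

Lemma natpowC_neq0 m z : natpowC m z != 0.
Proof. exact: cexp_neq0. Qed.

Lemma real_natC (n : nat) : (n%:R : R)%:C%C = n%:R :> C.
Proof. by rewrite rmorph_nat. Qed.

Lemma natpowCD1 m z : natpowC m.+1 (z + 1) = natpowC m.+1 z * m.+1%:R.
Proof.
rewrite !natpowCE; case: z => a b /=; rewrite addr0 mulrDl mul1r.
rewrite -[X in cexp _ X]addr0 cexpD; congr (_ * _).
by rewrite cexpE lnK ?posrE ?ltr0n// cos0 sin0 mulr1 mulr0 complexr0 real_natC.
Qed.

Lemma natfC_neq0 m : m`!%:R != 0 :> C.
Proof. by rewrite pnatr_eq0 -lt0n fact_gt0. Qed.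

Lemma natSC_neq0 m : m.+1%:R != 0 :> C.
Proof. by rewrite pnatr_eq0. Qed.

(** The relative increment of Gauss' product, from index n + 1 to n + 2.  The
    index 0 is avoided, because ln 0 = 0 makes the power 0 ^ z equal to 1. *)
Definition gauss_err z (n : nat) : C :=
  (1 + z / n.+2%:R) * (natpowC n.+1 z / natpowC n.+2 z) - 1.

Lemma gauss_rec z n : gauss z n.+2 = gauss z n.+1 * (1 + gauss_err z n).
Proof.
rewrite /gauss /gauss_err big_ord_recr /= factS natrM.
have := natpowC_neq0 n.+1 z; have := natpowC_neq0 n.+2 z.
have := natfC_neq0 n.+1; have := natSC_neq0 n.+1.
move: (\prod_(i < _) _) (natpowC _ _) (natpowC _ _) (_`!%:R) (n.+2%:R).
move=> P a b c d *; field; by repeat (apply/andP; split).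
Qed.

(** With h = 1 / (n + 2) and t = ln (n + 2) - ln (n + 1) = h + O(h^2), the
    factor is (1 + z h) exp (- z t); its terms of first order cancel. *)
Lemma gauss_err_bound z : exists K : R, forall n,
  normc (gauss_err z n) <= K * gap R n.
Proof.
case: z => a b; pose z : C := (a +i* b)%C; rewrite -/z; have [K K0 HK] := cexp_taylor (- a) (- b).
pose N := normc z.
exists (N + N ^+ 2 + (1 + N) * (2 * K) * 2) => n.
pose h : R := n.+2%:R^-1; pose h' : R := n.+1%:R^-1.
pose t : R := ln n.+2%:R - ln n.+1%:R.
have n2 : (0 : R) < n.+2%:R by rewrite ltr0n.
have n1 : (0 : R) < n.+1%:R by rewrite ltr0n.
have N0 : 0 <= N := normc_ge0 _.
have hh' : h < h' by rewrite ltf_pV2 ?posrE// ltr_nat.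
have h0 : 0 < h by rewrite invr_gt0.
have h'1 : h' <= 1 by rewrite invf_le1// ler1n.
have n2E : n.+2%:R = n.+1%:R + 1 :> R by rewrite -natr1.
have tle : t <= h'.
  have -> : t = ln (1 + h').
    rewrite /t -ln_div ?posrE//; congr ln; rewrite /h' n2E; field; lra.
  by apply: le_ln1Dx; lra.
have tge : h <= t.
  have -> : t = - ln (1 + - h).
    rewrite /t -opprB -ln_div ?posrE//; congr (- ln _); rewrite /h n2E; field; lra.
  rewrite lerNr; apply: le_ln1Dx; lra.
have gE : gap R n = h' - h by [].
have gE2 : gap R n = h' * h by rewrite gE /h /h' n2E; field; rewrite !gt_eqF//; lra.
have h'2 : h' <= 2 * h.
  have n1' : (1 : R) <= n.+1%:R by rewrite ler1n.
  rewrite /h /h' n2E ler_pdivlMr; last by lra.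
  rewrite mulrC ler_pdivrMr; lra.
have /(HK t)[b1 b2] : 0 <= t <= 1 by lra.
pose P := cexp (- a * t) (- b * t).
have EP : natpowC n.+1 z / natpowC n.+2 z = P.
  apply: canLR (mulfK (natpowC_neq0 _ _)) _; rewrite !natpowCE -cexpD /=.
  by rewrite /t; congr cexp; ring.
pose rho : C := P - 1 + z * t%:C%C.
have rhoB : normc rho <= (2 * K) * t ^+ 2.
  apply: le_trans (normc_le _) _.
  have -> : rho = ((expR (- a * t) * cos (- b * t) - 1 - (- a) * t) +i*
                  (expR (- a * t) * sin (- b * t) - (- b) * t))%C.
    by rewrite /rho /P cexpE /z; simpc; congr (_ +i* _)%C; ring.
  rewrite [complex.Re _]/= [complex.Im _]/=; lra.
have -> : gauss_err z n = z * (h - t)%:C%C - z * z * (h * t)%:C%C + (1 + z * h%:C%C) * rho.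
  rewrite /gauss_err EP /rho rmorphB rmorphM.
  have -> : n.+2%:R^-1 = h%:C%C :> C by rewrite /h fmorphV /= real_natC.
  by ring.
apply: le_trans (le_normcD _ _) _.
have t2 : 0 <= t ^+ 2 := sqr_ge0 t.
have t2g : t ^+ 2 <= 2 * gap R n.
  rewrite gE2 expr2; apply: (@le_trans _ _ (h' * h')); first by rewrite ler_pM//; lra.
  have : h' * h' <= h' * (2 * h) by rewrite ler_wpM2l//; lra.
  lra.
have p1 : normc (z * (h - t)%:C%C - z * z * (h * t)%:C%C) <= N * gap R n + N ^+ 2 * gap R n.
  apply: le_trans (le_normcD _ _) _; rewrite normcN !normcM !normc_real -/N -expr2.
  apply: lerD; rewrite ler_wpM2l ?sqr_ge0//.
    by rewrite gE distrC ger0_norm; lra.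
  rewrite ger0_norm ?mulr_ge0//; try lra.
  by rewrite gE2 mulrC ler_pM//; lra.
have p2 : normc ((1 + z * h%:C%C) * rho) <= (1 + N) * ((2 * K) * (2 * gap R n)).
  rewrite normcM ler_pM ?normc_ge0//.
    apply: le_trans (le_normcD _ _) _; rewrite normc1 normcM normc_real -/N.
    by rewrite lerD2l ger0_norm; [rewrite ler_piMr//; lra|lra].
  apply: le_trans rhoB _; rewrite ler_wpM2l//; lra.
lra.
Qed.

Lemma gauss_cvg z : (forall k : nat, z + k%:R != 0) ->
  exists2 l : C, (fun n => gauss z n.+1 : Ctop) @ \oo --> (l : Ctop) & l != 0.
Proof.
move=> z0; have [K HK] := gauss_err_bound z.
have w0 n : gauss z n.+1 != 0.
  apply: mulf_neq0; first by apply/prodf_neq0.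
  by apply/invr_neq0/mulf_neq0; [exact: natfC_neq0|exact: natpowC_neq0].
have [l l1 l0] := prod_cvg_neq0 (w := fun n => gauss z n.+1) (gauss_rec z) HK w0.
by exists l.
Qed.

Lemma rGammaP z : (forall k : nat, z + k%:R != 0) ->
  (fun n => gauss z n.+1 : Ctop) @ \oo --> (rGamma z : Ctop) /\ rGamma z != 0.
Proof.
move=> z0; have [l l1 l0] := gauss_cvg z0.
have -> : rGamma z = l.
  apply: (@cvg_lim Ctop); first exact: norm_hausdorff.
  by rewrite -(cvg_shiftS (gauss z : nat -> Ctop)); exact: l1.
by [].
Qed.

Lemma rGamma_neq0 z : (forall k : nat, z + k%:R != 0) -> rGamma z != 0.
Proof. by move=> /rGammaP[]. Qed.

Lemma gaussD1 z n : z * gauss (z + 1) n.+1 = gauss z n.+1 * (1 + (z + 1) * (n.+1%:R^-1)).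
Proof.
have PE : \prod_(k < n.+2) (z + k%:R) = z * \prod_(k < n.+1) (z + 1 + k%:R).
  rewrite big_ord_recl addr0; congr (_ * _).
  by apply: eq_bigr => i _; rewrite -addrA nat1r.
rewrite /gauss PE natpowCD1 big_ord_recr /=.
have -> : z + 1 + n.+1%:R = n.+1%:R * (1 + (z + 1) * (n.+1%:R^-1)).
  by have := natSC_neq0 n; move: (n.+1%:R) => x x0; field.
have := natfC_neq0 n.+1; have := natSC_neq0 n; have := natpowC_neq0 n.+1 z.
move: (\prod_(i < _) _) (natpowC _ _) (_`!%:R) (n.+1%:R) => P a b c *.
by field; repeat (apply/andP; split).
Qed.

(** The two Gauss products differ by the factor 1 + (z + 1) / n, which tends
    to 1. *)
Lemma rGammaD1 z : (forall k : nat, z + k%:R != 0) -> rGamma z = z * rGamma (z + 1).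
Proof.
move=> z0; have [c0 _] := rGammaP z0.
have z1 k : z + 1 + k%:R != 0 by rewrite -addrA nat1r.
have [c1 _] := rGammaP z1.
have hC : (fun n => n.+1%:R^-1 : Ctop) @ \oo --> (0 : Ctop).
  have h1 : (fun n => n.+1%:R^-1 : R) @ \oo --> (0 : R) by exact: cvg_harmonic.
  have h2 : (fun _ : nat => 0 : R) @ \oo --> (0 : R) by exact: cvg_cst.
  have := cvg_complex h1 h2.
  have -> // : (fun n => n.+1%:R^-1 : Ctop) = (fun n => (n.+1%:R^-1 +i* 0)%C : Ctop).
  by apply/funext => n; rewrite complexr0 fmorphV /= real_natC.
have a1 : (fun n => z * gauss (z + 1) n.+1 : Ctop) @ \oo --> (z * rGamma (z + 1) : Ctop).
  by apply: cvgM; [exact: cvg_cst|exact: c1].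
have a2 : (fun n => gauss z n.+1 * (1 + (z + 1) * (n.+1%:R^-1)) : Ctop) @ \oo -->
   (rGamma z * (1 + (z + 1) * 0) : Ctop).
  apply: cvgM; first exact: c0.
  apply: cvgD; first exact: cvg_cst.
  by apply: cvgM; [exact: cvg_cst|exact: hC].
rewrite mulr0 addr0 mulr1 in a2.
have E : (fun n => z * gauss (z + 1) n.+1 : Ctop) =
    (fun n => gauss z n.+1 * (1 + (z + 1) * (n.+1%:R^-1)) : Ctop).
  by apply/funext => n; rewrite gaussD1.
rewrite E in a1.
by apply: (cvg_unique _ a2 a1); exact: norm_hausdorff.
Qed.
End reciprocal_gamma.

(** * Polynomials and the frame attached to the first point *)

Section linear_maps.
Variable K : comNzRingType.

Definition islin (U W : lmodType K) (f : U -> W) :=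
  forall (a : K) p q, f (a *: p + q) = a *: f p + f q.

Section one_map.
Variables (U W : lmodType K) (F : U -> W).
Hypothesis hF : islin F.
Lemma lin0 : F 0 = 0.
Proof. by have := hF (-1) 0 0; rewrite scaler0 addr0 scaleN1r addNr. Qed.
Lemma linD p q : F (p + q) = F p + F q.
Proof. by have := hF 1 p q; rewrite !scale1r. Qed.
Lemma linZ a p : F (a *: p) = a *: F p.
Proof. by have := hF a p 0; rewrite !addr0 lin0 addr0. Qed.
Lemma linN p : F (- p) = - F p.
Proof. by rewrite -scaleN1r linZ scaleN1r. Qed.
Lemma lin_sum n (c : 'I_n -> K) (e : 'I_n -> U) :
  F (\sum_(k < n) c k *: e k) = \sum_(k < n) c k *: F (e k).
Proof.
elim: n => [|n IH] in c e *; first by rewrite !big_ord0 lin0.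
by rewrite !big_ord_recr /= linD IH linZ.
Qed.
End one_map.

Lemma lin_comp (U W W' : lmodType K) (f : W -> W') (g : U -> W) :
  islin f -> islin g -> islin (f \o g).
Proof. by move=> hf hg a u v; rewrite /= hg hf. Qed.
End linear_maps.

Section mpoly_complements.
Variables (n : nat) (K : comNzRingType).
Local Notation P := {mpoly K[n]}.

Lemma mpoly_alg_ind (Q : P -> Prop) :
  (forall c, Q c%:MP) -> (forall i, Q 'X_i) ->
  (forall p q, Q p -> Q q -> Q (p + q)) ->
  (forall p q, Q p -> Q q -> Q (p * q)) -> forall p, Q p.
Proof.
move=> QC QX QD QM p; rewrite (mpolyE p); apply: (big_ind Q _ QD).
  by rewrite -mpolyC0.
move=> m _; rewrite -mul_mpolyC; apply: (QM) => //; rewrite mpolyXE_id.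
apply: (big_ind Q _ QM); first by rewrite -mpolyC1.
move=> i _; elim: (m i) => [|k IH]; first by rewrite expr0 -mpolyC1.
by rewrite exprS; exact: QM.
Qed.

Lemma mderivXU (i j : 'I_n) : ('X_i : P)^`M(j) = (nat_of_ord i == j)%:R.
Proof.
rewrite mderivX mnm1E -(inj_eq val_inj) /=; case: eqP => [e|_]; last by rewrite scale0r.
rewrite (val_inj e) (_ : (_ - _)%MM = 0%MM) ?mpolyX0 ?scale1r//.
by apply/mnmP => k; rewrite mnmBE subnn mnm0E.
Qed.

Lemma mderiv_comp (t : n.-tuple P) (p : P) (i : 'I_n) :
  (p \mPo t)^`M(i) = \sum_(j < n) (p^`M(j) \mPo t) * (tnth t j)^`M(i).
Proof.
elim/mpoly_alg_ind : p => [c|k|p q IHp IHq|p q IHp IHq].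
- by rewrite comp_mpolyC mderivC big1// => j _; rewrite mderivC comp_mpoly0 mul0r.
- rewrite comp_mpolyXU (bigD1 k)//= mderivXU eqxx comp_mpoly1 mul1r big1 ?addr0.
    by rewrite -tnth_nth.
  move=> j jk; rewrite mderivXU (_ : (_ == _) = false) ?comp_mpoly0 ?mul0r//.
  by rewrite eq_sym; apply/negbTE.
- rewrite comp_mpolyD mderivD IHp IHq -big_split; apply: eq_bigr => j _ /=.
  by rewrite mderivD comp_mpolyD mulrDl.
- rewrite rmorphM mderivM IHp IHq mulr_suml mulr_sumr -big_split.
  apply: eq_bigr => j _ /=; rewrite mderivM rmorphD !rmorphM /=; ring.
Qed.

Lemma islin_ext (W : lmodType K) (f g : P -> W) : islin f -> islin g ->
  (forall m, f 'X_[m] = g 'X_[m]) -> f =1 g.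
Proof.
move=> lf lg fg p; elim/mpolyind : p => [|c m p _ _ IH].
  by rewrite (lin0 lf) (lin0 lg).
by rewrite lf lg fg IH.
Qed.
End mpoly_complements.

Section frame_coordinates.
Variable R : realType.
Local Notation P := (Pol R).

(** The variables, derivatives, constants and substitutions are locked, so that
    [ring] and rewriting treat them as atoms. *)
Fact frame_key : unit. Proof. exact: tt. Qed.

Definition V : 'I_6 -> P := locked_with frame_key (fun i => 'X_i).
Definition D : 'I_6 -> P -> P := locked_with frame_key (fun i p => p^`M(i)).

Lemma VE i : V i = 'X_i. Proof. by rewrite /V unlock. Qed.
Lemma DerE i p : D i p = p^`M(i). Proof. by rewrite /D unlock. Qed.

Local Notation X1 := (V ix1).
Local Notation Y1 := (V iy1).
Local Notation Z1 := (V iz1).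
Local Notation X := (V ix2).
Local Notation Y := (V iy2).
Local Notation Z := (V iz2).

Lemma ord6_ind (Q : 'I_6 -> Prop) : Q ix1 -> Q iy1 -> Q iz1 -> Q ix2 -> Q iy2 -> Q iz2 ->
  forall i, Q i.
Proof.
move=> q0 q1 q2 q3 q4 q5 [[|[|[|[|[|[|//]]]]]] h];
 by rewrite (bool_irrelevance h isT).
Qed.

Lemma big_ord6 (V : nmodType) (F : 'I_6 -> V) : \sum_i F i =
  F ix1 + F iy1 + F iz1 + F ix2 + F iy2 + F iz2.
Proof.
rewrite !big_ord_recr big_ord0 /= add0r.
by do ![congr (_ + _)]; congr F; apply: val_inj.
Qed.

Lemma DM i p q : D i (p * q) = D i p * q + p * D i q. Proof. by rewrite !DerE; exact: mderivM. Qed.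
Lemma DD i p q : D i (p + q) = D i p + D i q. Proof. by rewrite !DerE; exact: mderivD. Qed.
Lemma DN i p : D i (- p) = - D i p. Proof. by rewrite !DerE; exact: mderivN. Qed.
Lemma DZ i a p : D i (a *: p) = a *: D i p. Proof. by rewrite !DerE; exact: mderivZ. Qed.
Lemma DV i j : D j (V i) = (nat_of_ord i == j)%:R. Proof. by rewrite DerE VE; exact: mderivXU. Qed.
Lemma DC i j p : D i (D j p) = D j (D i p). Proof. by rewrite !DerE; exact: mderiv_comm. Qed.
Definition DE := (DD, DN, DM, DZ).

Definition Cst : R[i] -> P := locked_with frame_key (fun c => c%:MP).
Lemma CstU c : Cst c = c%:MP. Proof. by rewrite /Cst unlock. Qed.
Lemma scale_Cst c p : c *: p = Cst c * p. Proof. by rewrite CstU mul_mpolyC. Qed.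
Lemma CstD a b : Cst (a + b) = Cst a + Cst b. Proof. by rewrite !CstU mpolyCD. Qed.
Lemma CstN a : Cst (- a) = - Cst a. Proof. by rewrite !CstU mpolyCN. Qed.
Lemma CstM a b : Cst (a * b) = Cst a * Cst b. Proof. by rewrite !CstU mpolyCM. Qed.
Lemma Cst1 : Cst 1 = 1. Proof. by rewrite CstU mpolyC1. Qed.
Lemma Cst0 : Cst 0 = 0. Proof. by rewrite CstU mpolyC0. Qed.
Lemma Cst_nat n : Cst n%:R = n%:R.
Proof. by elim: n => [|n IH]; rewrite ?Cst0// -!natr1 CstD IH Cst1. Qed.
Definition CstE := (CstD, CstN, CstM, Cst1, Cst0, Cst_nat).

(** The images of the variables under the automorphism [theta]: the substitution
    S_1, followed by y2 = y - x z. *)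
Definition theta_tuple : 6.-tuple P :=
  [tuple X1; Y1; Z1; X + X1; Y - X * Z + Y1 - Z1 * X; Z + Z1].
Definition thetai_tuple : 6.-tuple P :=
  [tuple X1; Y1; Z1; X - X1; Y + (X - X1) * Z - Y1; Z - Z1].
Definition theta : P -> P := locked_with frame_key (comp_mpoly theta_tuple).
Definition thetai : P -> P := locked_with frame_key (comp_mpoly thetai_tuple).
Lemma thetaU p : theta p = p \mPo theta_tuple. Proof. by rewrite /theta unlock. Qed.
Lemma thetaiU p : thetai p = p \mPo thetai_tuple. Proof. by rewrite /thetai unlock. Qed.
End frame_coordinates.

(** [ring] for polynomials whose coefficients act by scaling: scalars become
    constant polynomials, and locked terms are generalized, since comparing two of
    them by conversion is expensive. *)
Ltac pring :=
  rewrite ?scale_Cst ?CstE;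
  repeat match goal with |- context [@D ?R ?i ?p] => generalize (@D R i p); intro end;
  repeat match goal with |- context [@theta ?R ?p] => generalize (@theta R p); intro end;
  repeat match goal with |- context [@thetai ?R ?p] => generalize (@thetai R p); intro end;
  repeat match goal with |- context [@V ?R ?m] => generalize (@V R m); intro end;
  repeat match goal with |- context [@Cst ?R ?m] => generalize (@Cst R m); intro end;
  ring.

Section frame_automorphism.
Variable R : realType.
Local Notation P := (Pol R).
Local Notation X1 := (V R ix1).
Local Notation Y1 := (V R iy1).
Local Notation Z1 := (V R iz1).
Local Notation X := (V R ix2).
Local Notation Y := (V R iy2).
Local Notation Z := (V R iz2).
Implicit Types (p q : P).

Lemma theta_var : ((theta X1 = X1) * (theta Y1 = Y1) * (theta Z1 = Z1) *
  (theta X = (X + X1)%R) * (theta Y = (Y - X * Z + Y1 - Z1 * X)%R) *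
  (theta Z = (Z + Z1)%R))%type.
Proof. by do ![split]; rewrite thetaU [X in X \mPo _]VE comp_mpolyXU. Qed.

Lemma thetai_var : ((thetai X1 = X1) * (thetai Y1 = Y1) * (thetai Z1 = Z1) *
  (thetai X = (X - X1)%R) * (thetai Y = (Y + (X - X1) * Z - Y1)%R) *
  (thetai Z = (Z - Z1)%R))%type.
Proof. by do ![split]; rewrite thetaiU [X in X \mPo _]VE comp_mpolyXU. Qed.

Lemma thetaM p q : theta (p * q) = theta p * theta q. Proof. by rewrite !thetaU; exact: rmorphM. Qed.
Lemma thetaD p q : theta (p + q) = theta p + theta q. Proof. by rewrite !thetaU; exact: comp_mpolyD. Qed.
Lemma thetaN p : theta (- p) = - theta p. Proof. by rewrite !thetaU; exact: comp_mpolyN. Qed.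
Lemma thetaZ a p : theta (a *: p) = a *: theta p. Proof. by rewrite !thetaU; exact: comp_mpolyZ. Qed.
Lemma thetaiM p q : thetai (p * q) = thetai p * thetai q. Proof. by rewrite !thetaiU; exact: rmorphM. Qed.
Lemma thetaiD p q : thetai (p + q) = thetai p + thetai q. Proof. by rewrite !thetaiU; exact: comp_mpolyD. Qed.
Lemma thetaiN p : thetai (- p) = - thetai p. Proof. by rewrite !thetaiU; exact: comp_mpolyN. Qed.
Lemma thetaiZ a p : thetai (a *: p) = a *: thetai p. Proof. by rewrite !thetaiU; exact: comp_mpolyZ. Qed.
Definition thetaE := (thetaD, thetaN, thetaM, thetaZ).
Definition thetaiE := (thetaiD, thetaiN, thetaiM, thetaiZ).

Lemma pol_ind (Q : P -> Prop) :
  (forall c : R[i], Q c%:MP) -> (forall i, Q (V R i)) ->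
  (forall p q : P, Q p -> Q q -> Q (p + q)) ->
  (forall p q : P, Q p -> Q q -> Q (p * q)) -> forall p, Q p.
Proof. by move=> QC QV; apply: mpoly_alg_ind => // i; rewrite -VE. Qed.

Lemma thetaK : cancel (@theta R) (@thetai R).
Proof.
elim/pol_ind => [c||p q hp hq|p q hp hq].
- by rewrite thetaU thetaiU !comp_mpolyC.
- apply: ord6_ind; rewrite !theta_var ?thetaiE !thetai_var; by pring.
- by rewrite thetaD thetaiD hp hq.
- by rewrite thetaM thetaiM hp hq.
Qed.

Lemma thetaiK : cancel (@thetai R) (@theta R).
Proof.
elim/pol_ind => [c||p q hp hq|p q hp hq].
- by rewrite thetaiU thetaU !comp_mpolyC.
- by apply: ord6_ind; rewrite !thetai_var ?thetaE !theta_var; pring.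
- by rewrite thetaiD thetaD hp hq.
- by rewrite thetaiM thetaM hp hq.
Qed.

(** The chain rule gives the derivatives of [theta p]; the formulas come from
    inverting the Jacobian matrix of [theta]. *)
Lemma theta_der p :
  ((theta (D ix1 p) =
     (D ix1 (theta p) - D ix2 (theta p) - (Z + Z1) * D iy2 (theta p))%R) *
  (theta (D iy1 p) = (D iy1 (theta p) - D iy2 (theta p))%R) *
  (theta (D iz1 p) = (D iz1 (theta p) - D iz2 (theta p))%R) *
  (theta (D ix2 p) = (D ix2 (theta p) + (Z + Z1) * D iy2 (theta p))%R) *
  (theta (D iy2 p) = D iy2 (theta p)) *
  (theta (D iz2 p) = (D iz2 (theta p) + X * D iy2 (theta p))%R))%type.
Proof.
have E i : D i (theta p) = theta (D ix1 p) * D i X1 + theta (D iy1 p) * D i Y1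
   + theta (D iz1 p) * D i Z1 + theta (D ix2 p) * D i (X + X1)
   + theta (D iy2 p) * D i (Y - X * Z + Y1 - Z1 * X) + theta (D iz2 p) * D i (Z + Z1).
  by rewrite !DerE !thetaU mderiv_comp big_ord6.
have E1 := E ix1. have E2 := E iy1. have E3 := E iz1. have E4 := E ix2.
have E5 := E iy2. have E6 := E iz2.
rewrite !DE !DV /= in E1 E2 E3 E4 E5 E6.
by rewrite E1 E2 E3 E4 E5 E6; do 5?[split]; pring.
Qed.
End frame_automorphism.

(** * Operator matrices and the Lax operators in the frame *)

Section operator_matrices.
Variable R : realType.
Local Notation P := (Pol R).

Definition triple := (P * P * P)%type.
Implicit Types (f g : triple) (A B : opmx R).

(** Operator matrices are studied through their action on columns with three
    polynomial entries, where composition of entries is ordinary application. *)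
Definition map3 (F : P -> P) f : triple := (F f.1.1, F f.1.2, F f.2).

(** The action of a Lax matrix on columns, without the matrices (see [act_Lax]). *)
Definition lax (x y z : 'I_6) (a1 a2 a3 : R[i]) f : triple :=
  let g1 := f.1.1 in let g2 := V R x * f.1.1 + f.1.2 in
  let g3 := (V R y + V R x * V R z) * f.1.1 + V R z * f.1.2 + f.2 in
  let h1 := a1 *: g1 + (D x g2 - V R z * D y g2) + D y g3 in
  let h2 := a2 *: g2 + D z g3 in
  let h3 := a3 *: g3 in
  (h1, - V R x * h1 + h2, - V R y * h1 + - V R z * h2 + h3).

Definition o0 : 'I_3 := @Ordinal 3 0 isT.
Definition o1 : 'I_3 := @Ordinal 3 1 isT.
Definition o2 : 'I_3 := @Ordinal 3 2 isT.

Lemma ord3_ind (Q : 'I_3 -> Prop) : Q o0 -> Q o1 -> Q o2 -> forall i, Q i.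
Proof.
by move=> q0 q1 q2 [[|[|[|//]]] h]; rewrite (bool_irrelevance h isT).
Qed.

Lemma big_ord3 (U : nmodType) (F : 'I_3 -> U) : \sum_i F i = F o0 + F o1 + F o2.
Proof.
rewrite !big_ord_recr big_ord0 /= add0r.
by do ![congr (_ + _)]; congr F; apply: val_inj.
Qed.

Definition act (A : opmx R) f : triple :=
  (A o0 o0 f.1.1 + A o0 o1 f.1.2 + A o0 o2 f.2,
   A o1 o0 f.1.1 + A o1 o1 f.1.2 + A o1 o2 f.2,
   A o2 o0 f.1.1 + A o2 o1 f.1.2 + A o2 o2 f.2).

Definition additive_entries (A : opmx R) := forall i j p q,
  A i j (p + q) = A i j p + A i j q.

Lemma opmulE (A B : opmx R) i k p :
  opmul A B i k p = A i o0 (B o0 k p) + A i o1 (B o1 k p) + A i o2 (B o2 k p).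
Proof. by rewrite mxE big_ord3. Qed.

Lemma act_opmul A B f : additive_entries A ->
  act (opmul A B) f = act A (act B f).
Proof.
move=> addA; rewrite /act /= !opmulE !addA.
by repeat match goal with |- context [A ?i ?j ?p] => generalize (A i j p); intro end;
  congr ((_, _), _); ring.
Qed.

Lemma opmul_additive A B : additive_entries A -> additive_entries B ->
  additive_entries (opmul A B).
Proof.
move=> addA addB i j p q; rewrite !opmulE !addB !addA.
by repeat match goal with |- context [A ?i ?j ?p] => generalize (A i j p); intro end; ring.
Qed.

Definition rows3 a00 a01 a02 a10 a11 a12 a20 a21 a22 : opmx R :=
  opmx_rows [:: [:: a00; a01; a02]; [:: a10; a11; a12]; [:: a20; a21; a22]].

Lemma act_rows a00 a01 a02 a10 a11 a12 a20 a21 a22 f :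
  act (rows3 a00 a01 a02 a10 a11 a12 a20 a21 a22) f
  = (a00 f.1.1 + a01 f.1.2 + a02 f.2, a10 f.1.1 + a11 f.1.2 + a12 f.2,
     a20 f.1.1 + a21 f.1.2 + a22 f.2).
Proof. by rewrite /act !mxE. Qed.

Lemma rows_additive a00 a01 a02 a10 a11 a12 a20 a21 a22 :
  (forall k p q, let a := nth id [:: a00; a01; a02; a10; a11; a12; a20; a21; a22] k in
     a (p + q) = a p + a q) ->
  additive_entries (rows3 a00 a01 a02 a10 a11 a12 a20 a21 a22).
Proof.
move=> H; apply: ord3_ind; apply: ord3_ind => p q; rewrite !mxE /=.
- exact: H 0%N p q. - exact: H 1%N p q. - exact: H 2%N p q.
- exact: H 3%N p q. - exact: H 4%N p q. - exact: H 5%N p q.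
- exact: H 6%N p q. - exact: H 7%N p q. - exact: H 8%N p q.
Qed.

Lemma Lax_rows x y z a1 a2 a3 : @Lax R x y z a1 a2 a3 =
  opmul (rows3 id (fun=> 0) (fun=> 0) (fun p => - V R x * p) id (fun=> 0)
            (fun p => - V R y * p) (fun p => - V R z * p) id)
   (opmul (rows3 (fun p => a1 *: p) (fun p => D x p - V R z * D y p) (D y)
                 (fun=> 0) (fun p => a2 *: p) (D z)
                 (fun=> 0) (fun=> 0) (fun p => a3 *: p))
     (rows3 id (fun=> 0) (fun=> 0) (fun p => V R x * p) id (fun=> 0)
        (fun p => (V R y + V R x * V R z) * p) (fun p => V R z * p) id)).
Proof. by rewrite /Lax /rows3 /V /D !unlock. Qed.

Lemma lax_additive_aux x y z a1 a2 a3 :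
  [/\ additive_entries (rows3 id (fun=> 0) (fun=> 0) (fun p => - V R x * p) id (fun=> 0)
            (fun p => - V R y * p) (fun p => - V R z * p) id),
    additive_entries (rows3 (fun p => a1 *: p) (fun p => D x p - V R z * D y p) (D y)
                 (fun=> 0) (fun p => a2 *: p) (D z)
                 (fun=> 0) (fun=> 0) (fun p => a3 *: p)) &
    additive_entries (rows3 id (fun=> 0) (fun=> 0) (fun p => V R x * p) id (fun=> 0)
        (fun p => (V R y + V R x * V R z) * p) (fun p => V R z * p) id)].
Proof.
split; apply: rows_additive => -[|[|[|[|[|[|[|[|[|k]]]]]]]]] p q /=; rewrite ?nth_nil //;
 rewrite ?addr0 ?mulrDr ?scalerDr ?DD //.
by rewrite mulrDr opprD addrACA.
Qed.

Lemma Lax_additive x y z a1 a2 a3 : additive_entries (@Lax R x y z a1 a2 a3).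
Proof.
have [h1 h2 h3] := lax_additive_aux x y z a1 a2 a3.
by rewrite Lax_rows; do ?apply: opmul_additive.
Qed.

Lemma act_Lax x y z a1 a2 a3 f : act (@Lax R x y z a1 a2 a3) f = lax x y z a1 a2 a3 f.
Proof.
have [h1 h2 h3] := lax_additive_aux x y z a1 a2 a3.
rewrite Lax_rows !act_opmul// !act_rows /lax /= !addr0 !add0r.
by [].
Qed.

Definition additive_op (F : P -> P) := forall p q, F (p + q) = F p + F q.

Lemma additive_op0 F : additive_op F -> F 0 = 0.
Proof. by move=> h; apply: (addrI (F 0)); rewrite -h !addr0. Qed.

(** The entry (i, j) is recovered from the columns that vanish outside row j. *)
Lemma intertwine_act (A A' : opmx R) (F : P -> P) :
  additive_entries A -> additive_entries A' -> additive_op F ->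
  (opmx_compl F A = opmx_compr A' F) <->
  (forall f, map3 F (act A f) = act A' (map3 F f)).
Proof.
move=> hA hA' hF; split => [/matrixP H f|H].
  have {}H i j p : F (A i j p) = A' i j (F p).
    by have := H i j; rewrite !mxE => /(congr1 (fun h => h p)).
  by rewrite /map3 /act /= !hF !H.
have A0 i j : A i j 0 = 0 := additive_op0 (hA i j).
have A'0 i j : A' i j 0 = 0 := additive_op0 (hA' i j).
have F0 := additive_op0 hF.
apply/matrixP => i j; rewrite !mxE; apply/funext => p /=.
elim/ord3_ind : j.
- have := H (p, 0, 0); rewrite /map3 /act /= F0 !A0 !A'0 !addr0 => -[].
  by elim/ord3_ind : i.
- have := H (0, p, 0); rewrite /map3 /act /= F0 !A0 !A'0 !addr0 !add0r => -[].
  by elim/ord3_ind : i.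
- have := H (0, 0, p); rewrite /map3 /act /= F0 !A0 !A'0 !addr0 !add0r => -[].
  by elim/ord3_ind : i.
Qed.

Lemma opmul_LL_additive u1 u2 u3 v1 v2 v3 :
  additive_entries (opmul (@L1 R u1 u2 u3) (@L2 R v1 v2 v3)).
Proof. by apply: opmul_additive; rewrite /L1 /L2; exact: Lax_additive. Qed.

Lemma act_opmul_LL u1 u2 u3 v1 v2 v3 f :
  act (opmul (@L1 R u1 u2 u3) (@L2 R v1 v2 v3)) f =
  lax ix1 iy1 iz1 u1 u2 u3 (lax ix2 iy2 iz2 v1 v2 v3 f).
Proof.
rewrite act_opmul; last by rewrite /L1; exact: Lax_additive.
by rewrite /L1 /L2 !act_Lax.
Qed.

Lemma intertwine_lax (F : P -> P) u1 u2 u3 v1 v2 v3 w1 w2 w3 t1 t2 t3 :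
  additive_op F ->
  (opmx_compl F (opmul (L1 u1 u2 u3) (L2 v1 v2 v3)) =
   opmx_compr (opmul (L1 w1 w2 w3) (L2 t1 t2 t3)) F) <->
  (forall f, map3 F (lax ix1 iy1 iz1 u1 u2 u3 (lax ix2 iy2 iz2 v1 v2 v3 f)) =
    lax ix1 iy1 iz1 w1 w2 w3 (lax ix2 iy2 iz2 t1 t2 t3 (map3 F f))).
Proof.
move=> hF; rewrite (intertwine_act (opmul_LL_additive _ _ _ _ _ _) (opmul_LL_additive _ _ _ _ _ _) hF).
by split=> H f; have := H f; rewrite !act_opmul_LL.
Qed.
End operator_matrices.

Section twisted_lax.
Variable R : realType.
Local Notation P := (Pol R).
Local Notation X1 := (V R ix1).
Local Notation Y1 := (V R iy1).
Local Notation Z1 := (V R iz1).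
Local Notation X := (V R ix2).
Local Notation Y := (V R iy2).
Local Notation Z := (V R iz2).
Local Notation Dx := (@D R ix2).
Local Notation Dy := (@D R iy2).
Local Notation Dz := (@D R iz2).
Implicit Types (p q : P) (f g : triple R).

(** The rightmost factor of L_1, acting on columns. *)
Definition lower f : triple R :=
  (f.1.1, X1 * f.1.1 + f.1.2, (Y1 + X1 * Z1) * f.1.1 + Z1 * f.1.2 + f.2).
Definition lower_inv f : triple R :=
  (f.1.1, - X1 * f.1.1 + f.1.2, - Y1 * f.1.1 - Z1 * f.1.2 + f.2).

Lemma triple_eq f g : f.1.1 = g.1.1 -> f.1.2 = g.1.2 -> f.2 = g.2 -> f = g.
Proof. by case: f g => [[? ?] ?] [[? ?] ?] /= -> -> ->. Qed.

Lemma lowerK f : lower_inv (lower f) = f.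
Proof. by apply: triple_eq => /=; pring. Qed.
Lemma lower_invK f : lower (lower_inv f) = f.
Proof. by apply: triple_eq => /=; pring. Qed.

(** [oij] is the entry (i, j) of L_2 in the frame, up to the conjugation by
    [lower] (see [theta_lax2]); [LL] is the whole matrix. *)
Definition o12 : P -> P :=
  locked_with frame_key (fun p => Dx p + Z * Dy p).
Lemma o12E p : o12 p = Dx p + Z * Dy p.
Proof. by rewrite /o12 unlock. Qed.
Definition o21 : R[i] -> R[i] -> P -> P :=
  locked_with frame_key (fun a1 a2 p => Y * Dz p - X * Dx (X * p) - (a1 - a2) *: (X * p)).
Lemma o21E a1 a2 p : o21 a1 a2 p = Y * Dz p - X * Dx (X * p) - (a1 - a2) *: (X * p).
Proof. by rewrite /o21 unlock. Qed.
Definition o22 : R[i] -> P -> P :=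
  locked_with frame_key (fun a2 p => (a2 + 1) *: p + Z * Dz p - X * Dx p).
Lemma o22E a2 p : o22 a2 p = (a2 + 1) *: p + Z * Dz p - X * Dx p.
Proof. by rewrite /o22 unlock. Qed.
Definition o31 : R[i] -> R[i] -> R[i] -> P -> P :=
  locked_with frame_key (fun a1 a2 a3 p => (a3 - a1) *: (Y * p) + (a1 - a2) *: (X * Z * p)
  - Y * Z * Dz p - Y * Dx (X * p) - Y * Dy (Y * p) + X * Z * Dx (X * p)).
Lemma o31E a1 a2 a3 p : o31 a1 a2 a3 p = (a3 - a1) *: (Y * p) + (a1 - a2) *: (X * Z * p)
  - Y * Z * Dz p - Y * Dx (X * p) - Y * Dy (Y * p) + X * Z * Dx (X * p).
Proof. by rewrite /o31 unlock. Qed.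
Definition o32 : R[i] -> R[i] -> P -> P :=
  locked_with frame_key (fun a2 a3 p => (a3 - a2 - 1) *: (Z * p) - Z * Z * Dz p
  - Y * Dx p - Z * Y * Dy p + Z * X * Dx p).
Lemma o32E a2 a3 p : o32 a2 a3 p = (a3 - a2 - 1) *: (Z * p) - Z * Z * Dz p
  - Y * Dx p - Z * Y * Dy p + Z * X * Dx p.
Proof. by rewrite /o32 unlock. Qed.
Definition o33 : R[i] -> P -> P :=
  locked_with frame_key (fun a3 p => a3 *: p - Z * Dz p - Y * Dy p).
Lemma o33E a3 p : o33 a3 p = a3 *: p - Z * Dz p - Y * Dy p.
Proof. by rewrite /o33 unlock. Qed.

Definition ll1 (a1 : R[i]) f :=
  a1 *: f.1.1 + Dx (X * f.1.1) + Dy (Y * f.1.1) + o12 f.1.2 + Dy f.2.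
Definition ll2 (a1 a2 : R[i]) f := o21 a1 a2 f.1.1 + o22 a2 f.1.2 + Dz f.2.
Definition ll3 (a1 a2 a3 : R[i]) f := o31 a1 a2 a3 f.1.1 + o32 a2 a3 f.1.2 + o33 a3 f.2.
Definition LL a1 a2 a3 f : triple R := (ll1 a1 f, ll2 a1 a2 f, ll3 a1 a2 a3 f).

(** Moving the first point moves the frame; the derivatives of the first point
    therefore lose the entry (1, 2) of LL, here, and (1, 3) and (2, 3) in [tau]. *)
Definition d12 : P -> P :=
  locked_with frame_key (fun p => D ix1 p - Z1 * D iy1 p - o12 p).
Lemma d12E p : d12 p = D ix1 p - Z1 * D iy1 p - o12 p.
Proof. by rewrite /d12 unlock. Qed.
Definition tau (u1 u2 u3 : R[i]) f : triple R :=
  (u1 *: f.1.1 + d12 f.1.2 + (D iy1 f.2 - Dy f.2),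
   u2 *: f.1.2 + (D iz1 f.2 - Dz f.2), u3 *: f.2).

(** LL factors like a Lax matrix: g2, g3, h1 and h2 are the steps of [lax], seen
    in the frame. *)
Lemma LLE a1 a2 a3 a b c (g2 := X * a + b) (g3 := Y * a + Z * b + c)
    (h1 := a1 *: a + Dx g2 + Dy g3) (h2 := a2 *: g2 + Dz g3 + X * Dy g3) :
  LL a1 a2 a3 (a, b, c) = (h1, h2 - X * h1, (X * Z - Y) * h1 - Z * h2 + a3 *: g3).
Proof.
rewrite /LL /ll1 /ll2 /ll3 /=; congr ((_, _), _).
- by rewrite /h1 /g2 /g3 o12E !DE !DV /=; pring.
- by rewrite o21E o22E /h2 /h1 /g2 /g3 !DE !DV /=; pring.
- by rewrite o31E o32E o33E /h2 /h1 /g2 /g3 !DE !DV /=; pring.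
Qed.

Lemma theta_lax1 u1 u2 u3 f : map3 (@theta R) (lax ix1 iy1 iz1 u1 u2 u3 f) =
  lower_inv (tau u1 u2 u3 (lower (map3 (@theta R) f))).
Proof.
case: f => [[a b] c]; rewrite /map3 /lax /lower_inv /tau /lower /=.
set g2 := X1 * a + b; set g3 := _ * a + Z1 * b + c.
rewrite -(_ : theta g2 = X1 * theta a + theta b); last first.
  by rewrite /g2 !thetaE !theta_var.
rewrite -(_ : theta g3 = (Y1 + X1 * Z1) * theta a + Z1 * theta b + theta c); last first.
  by rewrite /g3 !thetaE !theta_var.
set h1 := _ + D iy1 g3; set h2 := u2 *: g2 + _.
have -> : u1 *: theta a + d12 (theta g2) + (D iy1 (theta g3) - Dy (theta g3)) = theta h1.
  by rewrite /h1; move: (g2) (g3) => p q; rewrite d12E o12E !thetaE !theta_var !theta_der; pring.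
have -> : u2 *: theta g2 + (D iz1 (theta g3) - Dz (theta g3)) = theta h2.
  by rewrite /h2; move: (g2) (g3) => p q; rewrite !thetaE !theta_der.
by move: h1 h2 (g3) => p q r; apply: triple_eq => /=; rewrite ?thetaE ?theta_var; pring.
Qed.

(** This is what the frame is for: up to the conjugation by [lower], the first
    point has disappeared from L_2. *)
Lemma theta_lax2 v1 v2 v3 f : map3 (@theta R) (lax ix2 iy2 iz2 v1 v2 v3 f) =
  lower_inv (LL v1 v2 v3 (lower (map3 (@theta R) f))).
Proof.
case: f => [[a b] c]; rewrite [lower _]/lower LLE /map3 /lax /lower_inv /=.
set g2 := X * a + b; set g3 := _ * a + Z * b + c.
have -> : X * theta a + (X1 * theta a + theta b) = theta g2.
  by rewrite /g2 !thetaE !theta_var; pring.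
have -> : Y * theta a + Z * (X1 * theta a + theta b) +
    ((Y1 + X1 * Z1) * theta a + Z1 * theta b + theta c) = theta g3.
  by rewrite /g3 !thetaE !theta_var; pring.
set h1 := _ + Dy g3; set h2 := v2 *: g2 + _.
have -> : v1 *: theta a + Dx (theta g2) + Dy (theta g3) = theta h1.
  by rewrite /h1; move: (g2) (g3) => p q; rewrite !thetaE !theta_var !theta_der; pring.
have -> : v2 *: theta g2 + Dz (theta g3) + X * Dy (theta g3) = theta h2.
  by rewrite /h2; move: (g2) (g3) => p q; rewrite !thetaE !theta_der; pring.
by move: h1 h2 (g3) => p q r; apply: triple_eq => /=; rewrite ?thetaE ?theta_var; pring.
Qed.
End twisted_lax.

(** * Intertwiners and their rigidity *)

Section kernel.
Variable R : realType.
Local Notation P := (Pol R).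
Local Notation X1 := (V R ix1).
Local Notation Y1 := (V R iy1).
Local Notation Z1 := (V R iz1).
Local Notation X := (V R ix2).
Local Notation Y := (V R iy2).
Local Notation Z := (V R iz2).
Local Notation Dx := (@D R ix2).
Local Notation Dy := (@D R iy2).
Local Notation Dz := (@D R iz2).
Implicit Types (p q : P) (f g : triple R).

Lemma linC F c p : islin F -> F (Cst c * p) = Cst c * F p :> P.
Proof. by move=> hF; rewrite -!scale_Cst (linZ hF). Qed.
Lemma lin_nat F n p : islin F -> F (n%:R * p) = n%:R * F p :> P.
Proof. by move=> hF; rewrite -Cst_nat (linC _ _ hF). Qed.

Lemma DVX (i : 'I_6) n : D i (V R i ^+ n) = n%:R * V R i ^+ n.-1.
Proof.
case: n => [|n]; first by rewrite expr0 mul0r -Cst1 CstU DerE mderivC.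
elim: n => [|n IH]; first by rewrite expr1 expr0 DV eqxx mulr1.
rewrite exprS DM DV eqxx IH mul1r /= -[n.+2%:R]natr1.
have -> : V R i * (n.+1%:R * V R i ^+ n) = n.+1%:R * V R i ^+ n.+1 by rewrite exprS mulrCA.
by rewrite mulrDl mul1r addrC.
Qed.

Lemma DVX_neq (i j : 'I_6) n : (nat_of_ord i == j) = false -> D j (V R i ^+ n) = 0.
Proof.
move=> ij; elim: n => [|n IH]; first by rewrite expr0 -Cst1 CstU DerE mderivC.
by rewrite exprS DM DV ij IH mul0r mulr0 addr0.
Qed.

Definition mono (a b c p q r : nat) : P :=
  X1 ^+ a * Y1 ^+ b * Z1 ^+ c * (X ^+ p * Y ^+ q * Z ^+ r).

Lemma prod_ord6 (A : comNzRingType) (G : 'I_6 -> A) : \prod_i G i =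
  G ix1 * G iy1 * G iz1 * (G ix2 * G iy2 * G iz2).
Proof.
rewrite !big_ord_recr big_ord0 /= mul1r !mulrA.
by do ![congr (_ * _)]; congr G; apply: val_inj.
Qed.

Lemma monoE (m : 'X_{1..6}) :
  'X_[m] = mono (m ix1) (m iy1) (m iz1) (m ix2) (m iy2) (m iz2).
Proof. by rewrite mpolyXE_id prod_ord6 /mono !VE. Qed.

(** The consequences of the defining equations for F = theta R_1 theta^-1 that
    determine F up to a factor.  The parameters v1 and u1 occur only in the first
    column of the lower rows of LL. *)
Record intertwiner (u1 v1 v2 v3 : R[i]) (F : P -> P) : Prop := Intertwiner {
  itw_lin : islin F;
  itw_V : forall (i : 'I_6) p, (i < 3)%N -> F (V R i * p) = V R i * F p;
  itw_D : forall (i : 'I_6) p, (i < 3)%N -> F (D i p) = D i (F p);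
  itw_23 : forall p, F (Dz p) = Dz (F p);
  itw_22 : forall p, F (o22 v2 p) = o22 v2 (F p);
  itw_33 : forall p, F (o33 v3 p) = o33 v3 (F p);
  itw_32 : forall p, F (o32 v2 v3 p) = o32 v2 v3 (F p);
  itw_21 : forall p, F (o21 v1 v2 p) = o21 u1 v2 (F p);
  itw_31 : forall p, F (o31 v1 v2 v3 p) = o31 u1 v2 v3 (F p) }.

Lemma o21_mono v1 v2 (n q : nat) :
  o21 v1 v2 (X ^+ n * Y ^+ q) = - (n.+1%:R + v1 - v2) *: (X ^+ n.+1 * Y ^+ q) :> P.
Proof.
rewrite ?o21E mulrA -exprS !DM !DVX (DVX_neq _ (i := iy2) (j := ix2))//.
rewrite (DVX_neq _ (i := ix2) (j := iz2))// (DVX_neq _ (i := iy2) (j := iz2))//=.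
rewrite !exprS; move: (X ^+ n) (Y ^+ q) => a b; pring.
Qed.

Lemma o31_mono v1 v2 v3 (q : nat) :
  o31 v1 v2 v3 (Y ^+ q) =
   (v3 - v1 - 2 - q%:R) *: (Y ^+ q.+1) + (v1 - v2 + 1) *: (X * Y ^+ q * Z) :> P.
Proof.
rewrite ?o31E -exprS !DM !DVX (DVX_neq _ (i := iy2) (j := ix2))//.
rewrite (DVX_neq _ (i := iy2) (j := iz2))// DV eqxx /= -natr1.
rewrite !exprS; move: (Y ^+ q) => a; pring.
Qed.

Lemma o32_mono v2 v3 (n q r : nat) :
  o32 v2 v3 (X ^+ n * Y ^+ q * Z ^+ r) =
    (v3 - v2 - 1 + n%:R - q%:R - r%:R) *: (X ^+ n * Y ^+ q * Z ^+ r.+1)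
    - n%:R *: (X ^+ n.-1 * Y ^+ q.+1 * Z ^+ r) :> P.
Proof.
have E (i : 'I_6) k : V R i * (k%:R * V R i ^+ k.-1) = k%:R * V R i ^+ k.
  by case: k => [|k]; rewrite ?mul0r ?mulr0// exprS mulrCA.
rewrite ?o32E !DM !DVX.
rewrite !(DVX_neq _ (i := iy2) (j := ix2))// !(DVX_neq _ (i := iz2) (j := ix2))//.
rewrite !(DVX_neq _ (i := ix2) (j := iy2))// !(DVX_neq _ (i := iz2) (j := iy2))//.
rewrite !(DVX_neq _ (i := iy2) (j := iz2))// !(DVX_neq _ (i := ix2) (j := iz2))//.
have -> : Z * Z * ((0 * Y ^+ q + X ^+ n * 0) * Z ^+ r + X ^+ n * Y ^+ q * (r%:R * Z ^+ r.-1))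
  = Z * X ^+ n * Y ^+ q * (Z * (r%:R * Z ^+ r.-1)) by ring.
have -> : Z * Y * ((0 * Y ^+ q + X ^+ n * (q%:R * Y ^+ q.-1)) * Z ^+ r + X ^+ n * Y ^+ q * 0)
  = Z * X ^+ n * (Y * (q%:R * Y ^+ q.-1)) * Z ^+ r by ring.
have -> : Z * X * ((n%:R * X ^+ n.-1 * Y ^+ q + X ^+ n * 0) * Z ^+ r + X ^+ n * Y ^+ q * 0)
  = Z * (X * (n%:R * X ^+ n.-1)) * Y ^+ q * Z ^+ r by ring.
rewrite !E [Y ^+ q.+1]exprS [Z ^+ r.+1]exprS.
move: (X ^+ n) (X ^+ n.-1) (Y ^+ q) (Z ^+ r) => a b c d; pring.
Qed.

Lemma D0 i : D i 0 = 0 :> P.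
Proof. by have := DZ i 0 (0 : P); rewrite !scale0r. Qed.

Lemma o21_0 a b : o21 a b 0 = 0 :> P.
Proof. by rewrite ?o21E !mulr0 !D0 !mulr0 scaler0 !subr0. Qed.
Lemma o31_0 a b c : o31 a b c 0 = 0 :> P.
Proof. by rewrite ?o31E !mulr0 !D0 !mulr0 !scaler0 !subr0 !addr0. Qed.
Lemma o32_0 a b : o32 a b 0 = 0 :> P.
Proof. by rewrite ?o32E !mulr0 !D0 !mulr0 !scaler0 !subr0 !addr0. Qed.

(** Induction along three ladders that start from 1: [o21] raises the power of x,
    [o31] and [o32] together raise the power of y, and [o32] raises the power of z.
    Each step divides by a difference of parameters plus an integer. *)
Lemma intertwiner_eq0 u1 v1 v2 v3 F : intertwiner u1 v1 v2 v3 F ->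
  (forall m : int, v1 - v2 <> m%:~R) -> (forall m : int, v1 - v3 <> m%:~R) ->
  (forall m : int, v2 - v3 <> m%:~R) ->
  F 1 = 0 -> F =1 (fun=> 0).
Proof.
move=> HF h12 h13 h23 F1; have hl := itw_lin HF.
have nz (a : R[i]) p : a != 0 -> a *: F p = 0 -> F p = 0.
  by move=> a0 /eqP; rewrite scaler_eq0 (negbTE a0) => /eqP.
have sX (n q : nat) : F (Y ^+ q) = 0 -> F (X ^+ n * Y ^+ q) = 0.
  move=> h; elim: n => [|n IH]; first by rewrite expr0 mul1r.
  have := itw_21 HF (X ^+ n * Y ^+ q); rewrite o21_mono (linZ hl) IH o21_0.
  apply: nz; rewrite oppr_eq0; apply/eqP => E; apply: (h12 (- n.+1%:Z)).
  apply/eqP; rewrite -subr_eq0; apply/eqP.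
  by rewrite -[RHS]E mulrNz -pmulrn -natr1; ring.
have sY : forall k : nat, F (Y ^+ k) = 0.
  elim => [|k IH]; first by rewrite expr0.
  have e1 := itw_31 HF (Y ^+ k); rewrite o31_mono (linD hl) !(linZ hl) IH o31_0 in e1.
  have E2 : o32 v2 v3 (X * Y ^+ k) = (v3 - v2 - k%:R) *: (X * Y ^+ k * Z) - Y ^+ k.+1.
    have := o32_mono v2 v3 1 k 0; rewrite !expr1 /= !expr0 !mulr1 mul1r scale1r => ->.
    by congr (_ *: _ - _); ring.
  have e3 : F (Y ^+ k.+1) = (v3 - v2 - k%:R) *: F (X * Y ^+ k * Z).
    have := itw_32 HF (X * Y ^+ k); rewrite E2 (linD hl) (linN hl) (linZ hl).
    have -> : F (X * Y ^+ k) = 0 by have := sX 1%N k IH; rewrite expr1.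
    by rewrite o32_0 => /eqP; rewrite subr_eq0 => /eqP ->.
  (* e1 and e3 are two linear equations for the images of Y^(k+1) and of X Y^k Z *)
  have /nz F0 : ((v3 - k%:R - 1 - v1) * (v3 - k%:R - 1 - v2)) *: F (X * Y ^+ k * Z) = 0.
    rewrite -[RHS]e1 e3 scalerA -scalerDl; congr (_ *: _); ring.
  rewrite e3 F0 ?scaler0// mulf_neq0//; apply/eqP => E.
    apply: (h13 (- k.+1%:Z)); apply/eqP; rewrite -subr_eq0; apply/eqP.
    by rewrite -[RHS]oppr0 -E mulrNz -pmulrn -natr1; ring.
  apply: (h23 (- k.+1%:Z)); apply/eqP; rewrite -subr_eq0; apply/eqP.
  by rewrite -[RHS]oppr0 -E mulrNz -pmulrn -natr1; ring.
have sZ : forall r' n' q' : nat, F (X ^+ n' * Y ^+ q' * Z ^+ r') = 0.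
  elim => [|r IH] n q; first by rewrite expr0 mulr1 sX.
  have := itw_32 HF (X ^+ n * Y ^+ q * Z ^+ r).
  rewrite o32_mono (linD hl) (linN hl) !(linZ hl) !IH o32_0 scaler0 subr0.
  apply: nz; apply/eqP => E; apply: (h23 (n%:Z - q%:Z - r%:Z - 1)).
  rewrite !rmorphB /= -[1%:~R]/1 -!pmulrn; apply/eqP; rewrite -subr_eq0; apply/eqP.
  by rewrite -[RHS]oppr0 -E; ring.
have V_pow (i : 'I_6) (k : nat) p : (i < 3)%N -> F (V R i ^+ k * p) = V R i ^+ k * F p.
  move=> i3; elim: k => [|k IH]; first by rewrite !expr0 !mul1r.
  by rewrite !exprS -!mulrA (itw_V HF)//= IH.
apply: islin_ext => // [a p q|m]; first by rewrite scaler0 addr0.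
rewrite monoE /mono -!mulrA (V_pow ix1)// (V_pow iy1)// (V_pow iz1)//.
by have := sZ (m iz2) (m ix2) (m iy2); rewrite -mulrA => ->; rewrite !mulr0.
Qed.

Lemma D_eq0_const p : (forall i, D i p = 0) -> p = Cst p@_0.
Proof.
move=> h; rewrite CstU; apply/mpolyP => m; rewrite mcoeffC.
have [->|m0] := eqVneq m 0%MM; first by rewrite mulr1.
rewrite mulr0; have [i mi] : exists i, m i != 0%N.
  apply/existsP; apply: contraNT m0; rewrite negb_exists => /forallP h0.
  by apply/eqP/mnmP => i; rewrite mnm0E; have := h0 i; rewrite negbK => /eqP.
have := congr1 (mcoeff (m - U_(i))) (h i); rewrite DerE mcoeff_deriv mcoeff0.
rewrite submK; last by rewrite lep1mP.
by move/eqP; rewrite mulrn_eq0 /= => /eqP.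
Qed.

Lemma V_neq0 i : V R i != 0.
Proof.
apply/eqP => h; have := @DV R i i; rewrite h D0 eqxx /= => /eqP.
by rewrite eq_sym oner_eq0.
Qed.

(** 1 is killed by all derivatives of point 1, by d/dz, and is an eigenvector of
    [o22] and [o33]; so F 1 is killed by all derivatives. *)
Lemma intertwiner_const u1 v1 v2 v3 F : intertwiner u1 v1 v2 v3 F ->
  exists k, F 1 = Cst k.
Proof.
move=> HF; have hl := itw_lin HF.
have D1 i : D i 1 = 0 :> P by rewrite -Cst1 CstU DerE mderivC.
have h1 : D ix1 (F 1) = 0 by rewrite -(itw_D HF)// D1 (lin0 hl).
have h2 : D iy1 (F 1) = 0 by rewrite -(itw_D HF)// D1 (lin0 hl).
have h3 : D iz1 (F 1) = 0 by rewrite -(itw_D HF)// D1 (lin0 hl).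
have h4 : Dz (F 1) = 0 by rewrite -(itw_23 HF) D1 (lin0 hl).
have h5 : Dx (F 1) = 0.
  have := itw_22 HF 1; rewrite ?o22E h4 !D1 !mulr0 !addr0 !subr0 (linZ hl).
  move/eqP; rewrite -subr_eq0 opprB addrCA subrr addr0 mulf_eq0.
  by rewrite (negbTE (V_neq0 _)) => /eqP.
have h6 : Dy (F 1) = 0.
  have := itw_33 HF 1; rewrite ?o33E h4 !D1 !mulr0 !subr0 (linZ hl).
  move/eqP; rewrite -subr_eq0 opprB addrCA subrr addr0 mulf_eq0.
  by rewrite (negbTE (V_neq0 _)) => /eqP.
by exists (F 1)@_0; apply: D_eq0_const; apply: ord6_ind.
Qed.

(** The parts of the entries (1, 1), (1, 2), (1, 3) of the product tau LL that are
    free of derivatives of point 1; b is the first parameter of tau, c the first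
    parameter of LL (see [first_row]). *)
Definition q11 : R[i] -> R[i] -> R[i] -> R[i] -> P -> P :=
  locked_with frame_key (fun b c v2 v3 p =>
  b *: (c *: p + Dx (X * p) + Dy (Y * p)) - o12 (o21 c v2 p) - Dy (o31 c v2 v3 p)).
Lemma q11_def b c v2 v3 p : q11 b c v2 v3 p =
  b *: (c *: p + Dx (X * p) + Dy (Y * p)) - o12 (o21 c v2 p) - Dy (o31 c v2 v3 p).
Proof. by rewrite /q11 unlock. Qed.
Definition q12 : R[i] -> R[i] -> R[i] -> P -> P :=
  locked_with frame_key (fun b v2 v3 p =>
  b *: o12 p - o12 (o22 v2 p) - Dy (o32 v2 v3 p)).
Lemma q12_def b v2 v3 p : q12 b v2 v3 p =
  b *: o12 p - o12 (o22 v2 p) - Dy (o32 v2 v3 p).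
Proof. by rewrite /q12 unlock. Qed.
Definition q13 : R[i] -> R[i] -> P -> P :=
  locked_with frame_key (fun b v3 p => b *: Dy p - o12 (Dz p) - Dy (o33 v3 p)).
Lemma q13_def b v3 p : q13 b v3 p = b *: Dy p - o12 (Dz p) - Dy (o33 v3 p).
Proof. by rewrite /q13 unlock. Qed.

End kernel.

(** * Intertwiners and the defining equations *)

Section commutators.
Variable R : realType.
Local Notation P := (Pol R).
Local Notation X1 := (V R ix1).
Local Notation Y1 := (V R iy1).
Local Notation Z1 := (V R iz1).
Local Notation X := (V R ix2).
Local Notation Y := (V R iy2).
Local Notation Z := (V R iz2).
Local Notation Dx := (@D R ix2).
Local Notation Dy := (@D R iy2).
Local Notation Dz := (@D R iz2).
Implicit Types (p q : P) (f g h : triple R).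

Lemma Dnat i n : D i n%:R = 0 :> P.
Proof. by rewrite -Cst_nat CstU DerE mderivC. Qed.

Lemma q13E b v3 p :
  q13 b v3 p = (b - v3) *: Dy p - Dx (Dz p) + Dy (Y * Dy p).
Proof.
rewrite ?q13_def ?o12E ?o33E !DE !DV ?Dnat /= ?(DC iz2 iy2) ?(DC iz2 ix2); pring.
Qed.

Lemma q11E b c v2 v3 p : q11 b c v2 v3 p = (b * c) *: p + (b + c - v2) *: Dx (X * p)
  + (b + c - v3) *: Dy (Y * p) - Y * Dx (Dz p) + Dx (X * Dx (X * p))
  + Dy (Y * Dx (X * p)) + Dy (Y * Dy (Y * p)).
Proof.
rewrite ?q11_def ?o12E ?o21E ?o31E !DE !DV ?Dnat /= ?(DC iy2 ix2) ?(DC iz2 ix2) ?(DC iz2 iy2); pring.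
Qed.

(** An operator that intertwines [o21] and [o32] hence intertwines [o31]. *)
Lemma o31_commutator v1 v2 v3 p :
  o31 v1 v2 v3 p = o21 v1 v2 (o32 v2 v3 p) - o32 v2 v3 (o21 v1 v2 p).
Proof.
rewrite ?o31E ?o21E ?o32E !DE !DV ?Dnat /= ?(DC iy2 ix2) ?(DC iz2 ix2) ?(DC iz2 iy2); pring.
Qed.

Lemma o32_commutators a2 a3 p :
  ((Dx (o32 a2 a3 p) = (o32 a2 a3 (Dx p) + Z * Dx p)%R) *
   (Dy (o32 a2 a3 p) = (o32 a2 a3 (Dy p) - Dx p - Z * Dy p)%R) *
   (Dz (o32 a2 a3 p) = (o32 a2 a3 (Dz p) + (a3 - a2 - 1) *: p - Z * Dz p - Z * Dz p
      - Y * Dy p + X * Dx p)%R) *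
   (o32 a2 a3 (Y * p)%R = (Y * o32 a2 a3 p - Z * Y * p)%R))%type.
Proof.
by do ![split]; rewrite !o32E !DE !DV /= ?(DC iy2 ix2) ?(DC iz2 ix2) ?(DC iz2 iy2); pring.
Qed.

Lemma o32_lin a2 a3 : islin (@o32 R a2 a3).
Proof. by move=> a p q; rewrite !o32E !DE; pring. Qed.

(** Likewise, the relation for [q12] follows from those for [q13] and [o32]. *)
Lemma q12_commutator b v2 v3 p :
  q12 b v2 v3 p = o32 v2 v3 (q13 b v3 p) - q13 b v3 (o32 v2 v3 p).
Proof.
have hl := o32_lin v2 v3; have comm := o32_commutators v2 v3.
have [[[_ y0] z0] _] := comm p; have [[[x1 _] _] _] := comm (Dz p).
have [[[_ y2] _] _] := comm (Dy p); have [_ w2] := comm (Dy (Dy p)).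
have -> : o32 v2 v3 (q13 b v3 p) = (b - v3) *: o32 v2 v3 (Dy p)
    - o32 v2 v3 (Dx (Dz p)) + (o32 v2 v3 (Dy p) + o32 v2 v3 (Y * Dy (Dy p))).
  by rewrite q13E DM DV /= mul1r !(linD hl) (linN hl) (linZ hl).
rewrite q13E q12_def w2 y0 z0 !o12E o22E; move: (o32E v2 v3 (Dy p)) x1 y2; clear y0 z0 w2 comm hl.
move: (o32 _ _ _) (o32 _ _ _) (o32 _ _ _) (o32 _ _ _) => m1 m2 m3 m4 m2E x1 y2.
(* m1 and m3 cancel, m2 has to be expanded *)
rewrite !DE !DV ?x1 ?y2 /= m2E ?(DC iy2 ix2) ?(DC iz2 ix2) ?(DC iz2 iy2).
pring.
Qed.
End commutators.

Section frame_equation.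
Variable R : realType.
Local Notation P := (Pol R).
Local Notation X1 := (V R ix1).
Local Notation Y1 := (V R iy1).
Local Notation Z1 := (V R iz1).
Local Notation X := (V R ix2).
Local Notation Y := (V R iy2).
Local Notation Z := (V R iz2).
Local Notation Dx := (@D R ix2).
Local Notation Dy := (@D R iy2).
Local Notation Dz := (@D R iz2).
Implicit Types (p q : P) (f g h : triple R).

(** The first row of tau, without the derivatives of point 1, applied to LL. *)
Lemma first_row u1 a v2 v3 g :
  u1 *: ll1 a g - o12 (ll2 a v2 g) - Dy (ll3 a v2 v3 g) =
  q11 u1 a v2 v3 g.1.1 + q12 u1 v2 v3 g.1.2 + q13 u1 v3 g.2.
Proof.
rewrite /ll1 /ll2 /ll3 ?q11_def ?q12_def ?q13_def.
have o12D p q : o12 (p + q) = o12 p + o12 q.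
  by rewrite ?o12E !DD mulrDr addrACA.
rewrite !o12D !DD !scalerDr.
move: (o12 _) (o12 _) (o12 _) (o12 _) => A1 A2 A3 A4.
move: (Dy _) (Dy _) (Dy _) => B1 B2 B3; pring.
Qed.

Lemma map3_lower F f : islin F ->
  (forall (i : 'I_6) p, (i < 3)%N -> F (V R i * p) = V R i * F p) ->
  map3 F (lower f) = lower (map3 F f).
Proof.
move=> hl hV; apply: triple_eq; rewrite /map3 /lower //=.
  by rewrite (linD hl) hV.
by rewrite !mulrDl -!mulrA !(linD hl) !hV.
Qed.

Lemma map3_lower_inv F f : islin F ->
  (forall (i : 'I_6) p, (i < 3)%N -> F (V R i * p) = V R i * F p) ->
  map3 F (lower_inv f) = lower_inv (map3 F f).
Proof.
move=> hl hV; apply: triple_eq; rewrite /map3 /lower_inv //=.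
  by rewrite (linD hl) !mulNr (linN hl) hV.
by rewrite !(linD hl) !mulNr !(linN hl) !hV.
Qed.

Lemma intertwiner_ll u1 v1 v2 v3 F g : intertwiner u1 v1 v2 v3 F ->
  F (ll2 v1 v2 g) = ll2 u1 v2 (map3 F g) /\ F (ll3 v1 v2 v3 g) = ll3 u1 v2 v3 (map3 F g).
Proof.
case=> hl hV hD h23 h22 h33 h32 h21 h31.
by rewrite /ll2 /ll3 /= !(linD hl) h23 h22 h33 h32 h21 h31.
Qed.

(** The first row of tau LL splits into [q11], [q12], [q13] and derivatives of
    point 1 applied to the lower rows of LL, all of which are intertwined. *)
Lemma intertwiner_tau u1 u2 u3 v1 v2 v3 F g : intertwiner u1 v1 v2 v3 F ->
  (forall p, F (q11 u1 v1 v2 v3 p) = q11 v1 u1 v2 v3 (F p)) ->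
  (forall p, F (q13 u1 v3 p) = q13 v1 v3 (F p)) ->
  map3 F (tau u1 u2 u3 (LL v1 v2 v3 g)) = tau v1 u2 u3 (LL u1 v2 v3 (map3 F g)).
Proof.
move=> HF h11 h13; have hl := itw_lin HF.
have h12 p : F (q12 u1 v2 v3 p) = q12 v1 v2 v3 (F p).
  by rewrite !q12_commutator (linD hl) (linN hl) (itw_32 HF) !h13 (itw_32 HF).
have [e2 e3] := intertwiner_ll g HF.
have D1 (i : 'I_6) p : (i < 3)%N -> F (D i p) = D i (F p) by apply: (itw_D HF).
apply: triple_eq; rewrite /tau /map3 /=.
- set a := ll1 _ _; set b := ll2 _ _ _; set c := ll3 _ _ _ _.
  set a' := ll1 _ _; set b' := ll2 _ _ _; set c' := ll3 _ _ _ _.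
  have E s t w r : r *: s + d12 t + (D iy1 w - Dy w) =
     (r *: s - o12 t - Dy w) + (D ix1 t - Z1 * D iy1 t + D iy1 w).
    rewrite ?d12E; move: (o12 _) (D ix1 _) (D iy1 _) (D iy1 _) (Dy _) => *; pring.
  rewrite !E /a /b /c /a' /b' /c' !first_row /= !(linD hl) h11 h12 h13 (linN hl).
  by rewrite !D1// (itw_V HF)// !D1// e2 e3.
- by rewrite (linD hl) (linZ hl) e2 (linD hl) (linN hl) D1// (itw_23 HF) e3.
- by rewrite (linZ hl) e3.
Qed.

Lemma map3_theta_inj f g : map3 (@theta R) f = map3 (@theta R) g -> f = g.
Proof.
case: f g => [[a b] c] [[a' b'] c'] [/(can_inj (@thetaK R))-> /(can_inj (@thetaK R))->].
by move=> /(can_inj (@thetaK R))->.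
Qed.

(** The defining equation in the frame. *)
Definition LL_equation u1 u2 u3 v1 v2 v3 (F : P -> P) := forall f,
  map3 F (lower_inv (tau u1 u2 u3 (LL v1 v2 v3 (lower f)))) =
  lower_inv (tau v1 u2 u3 (LL u1 v2 v3 (lower (map3 F f)))).

Lemma LL_equationE u1 u2 u3 v1 v2 v3 (F G : P -> P) :
  additive_op G -> (forall p, F (theta p) = theta (G p)) ->
  (opmx_compl G (opmul (L1 u1 u2 u3) (L2 v1 v2 v3)) =
   opmx_compr (opmul (L1 v1 u2 u3) (L2 u1 v2 v3)) G) <->
  LL_equation u1 u2 u3 v1 v2 v3 F.
Proof.
move=> hG FG.
have E f : map3 (@theta R) (map3 G f) = map3 F (map3 (@theta R) f).
  by rewrite /map3 /= !FG.
have surj f : exists g, f = map3 (@theta R) g.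
  by exists (map3 (@thetai R) f); apply: triple_eq; rewrite /= thetaiK.
rewrite intertwine_lax//; split => H f.
  have [g ->] := surj f; have := congr1 (map3 (@theta R)) (H g).
  by rewrite E theta_lax1 theta_lax2 lower_invK theta_lax1 theta_lax2 lower_invK E.
apply: map3_theta_inj.
by rewrite E theta_lax1 theta_lax2 lower_invK theta_lax1 theta_lax2 lower_invK E H.
Qed.

Lemma intertwiner_equation u1 u2 u3 v1 v2 v3 F : intertwiner u1 v1 v2 v3 F ->
  (forall p, F (q11 u1 v1 v2 v3 p) = q11 v1 u1 v2 v3 (F p)) ->
  (forall p, F (q13 u1 v3 p) = q13 v1 v3 (F p)) ->
  LL_equation u1 u2 u3 v1 v2 v3 F.
Proof.
move=> HF h11 h13 f; have hl := itw_lin HF; have hV := itw_V HF.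
by rewrite (map3_lower_inv _ hl hV) (intertwiner_tau _ _ _ HF h11 h13) (map3_lower _ hl hV).
Qed.

Section intertwiner_of_equations.
Variables (u1 u2 u3 v1 v2 v3 : R[i]) (F : P -> P).
Hypothesis hl : islin F.
Hypothesis H0 : forall m n : nat, LL_equation u1 (u2 + m%:R) (u3 + n%:R) v1 v2 v3 F.
Hypothesis H1 : forall m n : nat,
  LL_equation (u1 + 1) (u2 + m%:R + 1) (u3 + n%:R + 1) (v1 + 1) (v2 + 1) (v3 + 1) F.

Lemma map3D f g : map3 F (f + g) = map3 F f + map3 F g.
Proof. by apply: triple_eq; rewrite /= (linD hl). Qed.

Lemma lower_invD f g : lower_inv (f + g) = lower_inv f + lower_inv g.
Proof. by case: f g => [[a b] c] [[a' b'] c']; apply: triple_eq; rewrite /=; pring. Qed.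

Lemma LL_shift a1 a2 a3 f : LL (a1 + 1) (a2 + 1) (a3 + 1) f = LL a1 a2 a3 f + f.
Proof.
by case: f => [[a b] c]; apply: triple_eq;
  rewrite /= /ll1 /ll2 /ll3 ?o12E ?o21E ?o22E ?o31E ?o32E ?o33E /=; pring.
Qed.

Lemma tauD a1 a2 a3 f g : tau a1 a2 a3 (f + g) = tau a1 a2 a3 f + tau a1 a2 a3 g.
Proof.
by case: f g => [[a b] c] [[a' b'] c']; apply: triple_eq;
  rewrite /= ?d12E ?o12E ?DD; pring.
Qed.

Lemma tau_shift a1 a2 a3 f : tau (a1 + 1) (a2 + 1) (a3 + 1) f = tau a1 a2 a3 f + f.
Proof.
by case: f => [[a b] c]; apply: triple_eq; rewrite /= ?d12E ?o12E ?DD; pring.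
Qed.

Lemma tau_shift2 a1 a2 a3 f : tau a1 (a2 + 1) a3 f = tau a1 a2 a3 f + (0, f.1.2, 0).
Proof.
by case: f => [[a b] c]; apply: triple_eq; rewrite /= ?d12E ?o12E ?DD; pring.
Qed.

Lemma tau_shift3 a1 a2 a3 f : tau a1 a2 (a3 + 1) f = tau a1 a2 a3 f + (0, 0, f.2).
Proof.
by case: f => [[a b] c]; apply: triple_eq; rewrite /= ?d12E ?o12E ?DD; pring.
Qed.

(** A common shift of all parameters by 1 adds the identity to tau and to LL, and
    (tau + 1) (LL + 1) = tau LL + (tau + LL) + 1. *)
Lemma sum_equation (m n : nat) f :
  map3 F (lower_inv (tau u1 (u2 + m%:R) (u3 + n%:R) (lower f) + LL v1 v2 v3 (lower f))) =
  lower_inv (tau v1 (u2 + m%:R) (u3 + n%:R) (lower (map3 F f)) + LL u1 v2 v3 (lower (map3 F f))).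
Proof.
have := H1 m n f; rewrite !LL_shift !tau_shift !tauD !lower_invD !map3D H0 !lowerK.
rewrite -!addrA => /addrI; rewrite !addrA => /addIr E; exact: E.
Qed.

(** Raising u3 by 1 changes tau by the projection to the third entry; so F
    commutes with this projection conjugated by [lower]. *)
Lemma commute_B3 f : map3 F (lower_inv (0, 0, (lower f).2)) = lower_inv (0, 0, (lower (map3 F f)).2).
Proof.
have := sum_equation 0 1 f; rewrite !addr0 !tau_shift3.
have := sum_equation 0 0 f; rewrite !addr0 => E.
rewrite !(addrAC _ (0, 0, _)) (lower_invD (_ + _)) map3D E (lower_invD (_ + _)).
by move=> /addrI.
Qed.

Lemma commute_B2 f : map3 F (lower_inv (0, (lower f).1.2, 0)) = lower_inv (0, (lower (map3 F f)).1.2, 0).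
Proof.
have := sum_equation 1 0 f; rewrite !addr0 !tau_shift2.
have := sum_equation 0 0 f; rewrite !addr0 => E.
rewrite !(addrAC _ (0, _, 0)) (lower_invD (_ + _)) map3D E (lower_invD (_ + _)).
by move=> /addrI.
Qed.

(** x1, y1 and z1 are the entries of [lower], hence, up to products, those of the
    conjugated projections. *)
Lemma commute_V (i : 'I_6) p : (i < 3)%N -> F (V R i * p) = V R i * F p.
Proof.
have F0 := lin0 hl.
have hZ p' : F (Z1 * p') = Z1 * F p'.
  have := congr1 snd (commute_B3 (0, p', 0)); rewrite /map3 /= F0.
  by rewrite !(mulr0, oppr0, add0r, addr0).
have hX p' : F (X1 * p') = X1 * F p'.
  have := congr1 (fun f => f.1.2) (commute_B2 (p', 0, 0)); rewrite /map3 /= F0.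
  by rewrite !(mulr0, oppr0, add0r, addr0).
have hY p' : F (Y1 * p') = Y1 * F p'.
  have := congr1 snd (commute_B3 (p', 0, 0)); rewrite /map3 /= F0.
  rewrite !(mulr0, oppr0, add0r, addr0) !mulrDl -!mulrA (linD hl) hX hZ.
  by move=> /addIr.
by move: i; apply: ord6_ind.
Qed.

Let lowerF f := map3_lower f hl commute_V.
Let lower_invF f := map3_lower_inv f hl commute_V.

Lemma lower_inv_inj f g : lower_inv f = lower_inv g -> f = g.
Proof. by move/(congr1 (@lower R)); rewrite !lower_invK. Qed.

Lemma LL_sum f : map3 F (tau u1 u2 u3 f + LL v1 v2 v3 f) =
  tau v1 u2 u3 (map3 F f) + LL u1 v2 v3 (map3 F f).
Proof.
have := sum_equation 0 0 (lower_inv f); rewrite !addr0 lower_invF lower_invK -lowerF lower_invK.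
by move/lower_inv_inj.
Qed.

Lemma LL_prod (m n : nat) f : map3 F (tau u1 (u2 + m%:R) (u3 + n%:R) (LL v1 v2 v3 f)) =
  tau v1 (u2 + m%:R) (u3 + n%:R) (LL u1 v2 v3 (map3 F f)).
Proof. by have := H0 m n (lower_inv f); rewrite lower_invF lower_invK -lowerF lower_invK => /lower_inv_inj. Qed.

(** Raising u3 by 1 changes tau LL by the third row of LL. *)
Lemma LL_row3 f : F (ll3 v1 v2 v3 f) = ll3 u1 v2 v3 (map3 F f).
Proof.
have := LL_prod 0 1 f; rewrite !addr0 !tau_shift3 map3D.
have := LL_prod 0 0 f; rewrite !addr0 => ->.
by move/addrI/(congr1 snd).
Qed.

Lemma LL_row2 f : F (ll2 v1 v2 f) = ll2 u1 v2 (map3 F f).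
Proof.
have := LL_prod 1 0 f; rewrite !addr0 !tau_shift2 map3D.
have := LL_prod 0 0 f; rewrite !addr0 => ->.
by move/addrI/(congr1 (fun f => f.1.2)).
Qed.

(** The rows of LL give the relations in the second point.  The derivatives of the
    first point come from tau + LL, where those of the second point cancel. *)
Lemma intertwiner_of_equations : intertwiner u1 v1 v2 v3 F.
Proof.
have F0 := lin0 hl.
have D00 i : D i 0 = 0 :> P := D0 _ i.
have r2 f : F (ll2 v1 v2 f) = ll2 u1 v2 (map3 F f) := LL_row2 f.
have r3 f : F (ll3 v1 v2 v3 f) = ll3 u1 v2 v3 (map3 F f) := LL_row3 f.
have o22_0 a : o22 a 0 = 0 :> P by rewrite ?o22E !D00 !mulr0 scaler0 addr0 subr0.
have o33_0 a : o33 a 0 = 0 :> P by rewrite ?o33E !D00 !mulr0 scaler0 !subr0.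
have o12_0 : o12 0 = 0 :> P by rewrite ?o12E !D00 !mulr0 addr0.
have d12_0 : d12 0 = 0 :> P by rewrite ?d12E o12_0 !D00 !mulr0 !subr0.
have h23 p : F (Dz p) = Dz (F p).
  by have := r2 (0, 0, p); rewrite /ll2 /map3 /= F0 o21_0 o21_0 !o22_0 !add0r.
have h22 p : F (o22 v2 p) = o22 v2 (F p).
  by have := r2 (0, p, 0); rewrite /ll2 /map3 /= F0 !o21_0 !D00 !add0r !addr0.
have h21 p : F (o21 v1 v2 p) = o21 u1 v2 (F p).
  by have := r2 (p, 0, 0); rewrite /ll2 /map3 /= F0 !o22_0 !D00 !addr0.
have h33 p : F (o33 v3 p) = o33 v3 (F p).
  by have := r3 (0, 0, p); rewrite /ll3 /map3 /= F0 !o31_0 !o32_0 !add0r.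
have h32 p : F (o32 v2 v3 p) = o32 v2 v3 (F p).
  by have := r3 (0, p, 0); rewrite /ll3 /map3 /= F0 !o31_0 !o33_0 !add0r !addr0.
have h31 p : F (o31 v1 v2 v3 p) = o31 u1 v2 v3 (F p).
  by have := r3 (p, 0, 0); rewrite /ll3 /map3 /= F0 !o32_0 !o33_0 !addr0.
have hz p : F (D iz1 p) = D iz1 (F p).
  have := congr1 (fun f => f.1.2) (LL_sum (0, 0, p)); rewrite /map3 /LL /ll2 /tau /= F0.
  by rewrite !o21_0 !o22_0 !scaler0 !add0r !subrK.
have hy p : F (D iy1 p) = D iy1 (F p).
  have := congr1 (fun f => f.1.1) (LL_sum (0, 0, p)); rewrite /map3 /LL /ll1 /tau /= F0.
  by rewrite !mulr0 !D00 !o12_0 !d12_0 !scaler0 !add0r !subrK.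
have hx p : F (D ix1 p) = D ix1 (F p).
  have := congr1 (fun f => f.1.1) (LL_sum (0, p, 0)); rewrite /map3 /LL /ll1 /tau /= F0.
  rewrite !mulr0 !D00 !scaler0 !subr0 !add0r !addr0 ?d12E !subrK.
  by rewrite (linD hl) (linN hl) (commute_V (i := iz1))// hy => /addIr.
split => //; first exact: commute_V.
by apply: ord6_ind.
Qed.
End intertwiner_of_equations.
End frame_equation.

(** * The closed form on monomials *)

Section monomials.
Variable R : realType.
Local Notation P := (Pol R).
Local Notation X1 := (V R ix1).
Local Notation Y1 := (V R iy1).
Local Notation Z1 := (V R iz1).
Local Notation X := (V R ix2).
Local Notation Y := (V R iy2).
Local Notation Z := (V R iz2).
Local Notation Dx := (@D R ix2).
Local Notation Dy := (@D R iy2).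
Local Notation Dz := (@D R iz2).

Definition emon : nat -> nat -> nat -> P :=
  locked_with frame_key (fun p q r => X ^+ p * Y ^+ q * Z ^+ r).
Lemma emonE p q r : emon p q r = X ^+ p * Y ^+ q * Z ^+ r.
Proof. by rewrite /emon unlock. Qed.

Lemma X_emon p q r : X * emon p q r = emon p.+1 q r.
Proof. by rewrite !emonE exprS !mulrA. Qed.
Lemma Y_emon p q r : Y * emon p q r = emon p q.+1 r.
Proof. by rewrite !emonE !exprS; move: (_ ^+ _) (_ ^+ _) (_ ^+ _) => a b c; pring. Qed.
Lemma Z_emon p q r : Z * emon p q r = emon p q r.+1.
Proof. by rewrite !emonE !exprS; move: (_ ^+ _) (_ ^+ _) (_ ^+ _) => a b c; pring. Qed.

Lemma Dx_emon p q r : Dx (emon p q r) = p%:R *: emon p.-1 q r.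
Proof.
rewrite !emonE !DM DVX (DVX_neq _ (i := iy2) (j := ix2))// (DVX_neq _ (i := iz2) (j := ix2))//.
by rewrite scale_Cst Cst_nat; move: (X ^+ _) (X ^+ _) (Y ^+ _) (Z ^+ _) => *; pring.
Qed.
Lemma Dy_emon p q r : Dy (emon p q r) = q%:R *: emon p q.-1 r.
Proof.
rewrite !emonE !DM DVX (DVX_neq _ (i := ix2) (j := iy2))// (DVX_neq _ (i := iz2) (j := iy2))//.
by rewrite scale_Cst Cst_nat; move: (X ^+ _) (Y ^+ _) (Y ^+ _) (Z ^+ _) => *; pring.
Qed.
Lemma Dz_emon p q r : Dz (emon p q r) = r%:R *: emon p q r.-1.
Proof.
rewrite !emonE !DM DVX (DVX_neq _ (i := ix2) (j := iz2))// (DVX_neq _ (i := iy2) (j := iz2))//.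
by rewrite scale_Cst Cst_nat; move: (X ^+ _) (Y ^+ _) (Z ^+ _) (Z ^+ _) => *; pring.
Qed.

(** The factors p, q, r make the truncation of the predecessor harmless. *)
Lemma emon_pred (p q r : nat) :
  ((p%:R *: emon p.-1.+1 q r = p%:R *: emon p q r) *
   (q%:R *: emon p q.-1.+1 r = q%:R *: emon p q r) *
   (r%:R *: emon p q r.-1.+1 = r%:R *: emon p q r))%type.
Proof. by split; [split|]; case: p q r => [|p] [|q] [|r]; rewrite ?scale0r. Qed.

Lemma VZ i a (p : P) : V R i * (a *: p) = a *: (V R i * p).
Proof. by rewrite -scalerAr. Qed.

Definition emon_ops := (X_emon, Y_emon, Z_emon, Dx_emon, Dy_emon, Dz_emon, VZ, @DZ R).

Lemma o21_emon v1 v2 p q r : o21 v1 v2 (emon p q r) =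
  r%:R *: emon p q.+1 r.-1 - (p%:R + (v1 - v2 + 1)) *: emon p.+1 q r.
Proof.
rewrite o21E !emon_ops /= -addrA -opprD -scalerDl.
by congr (_ - _ *: _); rewrite -natr1; ring.
Qed.

Lemma o22_emon v2 p q r : o22 v2 (emon p q r) = (v2 + 1 + r%:R - p%:R) *: emon p q r.
Proof.
rewrite o22E !emon_ops !emon_pred.
by rewrite -scalerDl -scalerBl.
Qed.

Lemma o33_emon v3 p q r : o33 v3 (emon p q r) = (v3 - r%:R - q%:R) *: emon p q r.
Proof.
rewrite o33E !emon_ops !emon_pred.
by rewrite -!scalerBl.
Qed.

Lemma o32_emon v2 v3 p q r : o32 v2 v3 (emon p q r) =
  (v3 - v2 - 1 + p%:R - q%:R - r%:R) *: emon p q r.+1 - p%:R *: emon p.-1 q.+1 r.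
Proof. by rewrite !emonE o32_mono. Qed.

Lemma q13_emon b v3 p q r : q13 b v3 (emon p q r) =
  (q%:R * (b - v3 + q%:R)) *: emon p q.-1 r - (p%:R * r%:R) *: emon p.-1 q r.-1.
Proof.
have qK : q%:R * q.-1.+1%:R = q%:R * q%:R :> R[i] by case: q => [|q]; rewrite ?mul0r.
rewrite q13E !emon_ops /= !scalerA qK.
by rewrite addrAC -scalerDl; congr (_ *: _ - _ *: _); ring.
Qed.

(** The eigenvalue of the part of [q11] that is diagonal on monomials. *)
Definition qdiag (b c v2 v3 p q : R[i]) : R[i] := b * c + (b + c - v2) * (p + 1)
  + (b + c - v3) * (q + 1) + (p + 1) * (p + 1) + (p + 1) * (q + 1) + (q + 1) * (q + 1).

Lemma q11_emon b c v2 v3 p q r : q11 b c v2 v3 (emon p q r) =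
  qdiag b c v2 v3 p%:R q%:R *: emon p q r - (p%:R * r%:R) *: emon p.-1 q.+1 r.-1.
Proof.
rewrite q11E !emon_ops /= !scalerA [_ - _ *: _ + _]addrAC [_ - _ *: _ + _]addrAC [_ - _ *: _ + _]addrAC.
rewrite -!scalerDl; congr (_ *: _ - _ *: _); rewrite /qdiag -?natr1; ring.
Qed.

Lemma sum_shift K (f g : nat -> R[i]) (b : nat -> P) : f K = 0 ->
  \sum_(k < K.+1) f k *: b k.+1 + \sum_(k < K.+1) g k *: b k =
  \sum_(k < K.+1) ((if nat_of_ord k is k'.+1 then f k' else 0) + g k) *: b k.
Proof.
move=> fK; under [RHS]eq_bigr do rewrite scalerDl.
rewrite big_split /=; congr (_ + _).
by rewrite big_ord_recr [in RHS]big_ord_recl /= fK !scale0r addr0 add0r.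
Qed.
End monomials.

Section spectators.
Variable R : realType.
Local Notation P := (Pol R).
(** Operators that are linear over C[x1, y1, z1] agree as soon as they agree on
    the monomials in x, y, z. *)
Definition spec_linear (f : P -> P) := islin f /\
  forall (i : 'I_6) p, (i < 3)%N -> f (V R i * p) = V R i * f p.

Lemma mono_emon (a b c p q r : nat) :
  mono R a b c p q r = V R ix1 ^+ a * (V R iy1 ^+ b * (V R iz1 ^+ c * emon R p q r)).
Proof. by rewrite emonE /mono !mulrA. Qed.

Lemma spec_linearX f : spec_linear f -> forall (i : 'I_6) k p, (i < 3)%N ->
  f (V R i ^+ k * p) = V R i ^+ k * f p.
Proof.
case=> _ h i k p i3; elim: k => [|k IH]; first by rewrite !expr0 !mul1r.
by rewrite !exprS -!mulrA h// IH.
Qed.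

Lemma spec_linear_ext f g : spec_linear f -> spec_linear g ->
  (forall p q r, f (emon R p q r) = g (emon R p q r)) -> f =1 g.
Proof.
move=> hf hg fg; apply: islin_ext hf.1 hg.1 _ => m.
by rewrite monoE mono_emon !(spec_linearX hf)// !(spec_linearX hg)// fg.
Qed.

Lemma spec_linear_comp f g : spec_linear f -> spec_linear g -> spec_linear (f \o g).
Proof.
move=> [lf hf] [lg hg]; split; first by move=> a p q /=; rewrite lg lf.
by move=> i p i3 /=; rewrite hg// hf.
Qed.

Lemma spec_linearD f g : spec_linear f -> spec_linear g ->
  spec_linear (fun p => f p + g p).
Proof.
move=> [lf hf] [lg hg]; split; first by move=> a p q /=; rewrite lg lf scalerDr addrACA.
by move=> i p i3 /=; rewrite hg// hf// mulrDr.
Qed.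

Lemma spec_linearN f : spec_linear f -> spec_linear (fun p => - f p).
Proof.
move=> [lf hf]; split; first by move=> a p q /=; rewrite lf opprD scalerN.
by move=> i p i3 /=; rewrite hf// mulrN.
Qed.

Lemma spec_linear_id : spec_linear id.
Proof. by []. Qed.

Lemma spec_linearM u f : spec_linear f -> spec_linear (fun p => u * f p).
Proof.
move=> [lf hf]; split; first by move=> a p q /=; rewrite lf mulrDr scalerAr.
by move=> i p i3 /=; rewrite hf// mulrCA.
Qed.

Lemma spec_linearZ a f : spec_linear f -> spec_linear (fun p => a *: f p).
Proof.
move=> hf; have := spec_linearM (Cst a) hf.
by congr spec_linear; apply/funext => p; rewrite scale_Cst.
Qed.

Lemma spec_linear_Der (j : 'I_6) f : (3 <= j)%N -> spec_linear f ->
  spec_linear (fun p => D j (f p)).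
Proof.
move=> j3 [lf hf]; split; first by move=> a p q; rewrite lf DD DZ.
move=> i p i3; rewrite hf// DM DV (_ : (_ == _) = false) ?mul0r ?add0r//.
by apply/negbTE; rewrite neq_ltn (leq_trans i3).
Qed.

Lemma spec_linear_ops u1 v1 v2 v3 :
  [/\ spec_linear (@D R iz2), spec_linear (o21 v1 v2), spec_linear (o22 v2),
     spec_linear (o32 v2 v3) & spec_linear (o33 v3)] /\
  (spec_linear (q11 u1 v1 v2 v3) /\ spec_linear (q13 v1 v3)).
Proof.
have ext (f g : P -> P) : f =1 g -> spec_linear g -> spec_linear f.
  by move=> /funext ->.
split; [split|split]; [|apply: ext (o21E _ _) _|apply: ext (o22E _) _|apply: ext (o32E _ _) _
   |apply: ext (o33E _) _|apply: ext (q11E _ _ _ _) _|apply: ext (q13E _ _) _];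
do ?[ exact: spec_linear_id | apply: spec_linearD | apply: spec_linearN
  | apply: spec_linearZ | (apply: spec_linear_Der; first by []) | apply: spec_linearM ].
Qed.

(** Both sides of an intertwining relation, applied to a monomial, have this
    form: the images of the k-th term lie on the k-th and the (k+1)-st of a chain
    of monomials. *)
Lemma shift_eq K (f g f' g' : nat -> R[i]) (b : nat -> P) :
  f K = 0 -> f' K = 0 -> g 0%N = g' 0%N ->
  (forall k, f k + g k.+1 = f' k + g' k.+1) ->
  \sum_(k < K.+1) (f k *: b k.+1 + g k *: b k) =
  \sum_(k < K.+1) (f' k *: b k.+1 + g' k *: b k).
Proof.
move=> fK f'K g0 fg; rewrite !big_split /= !sum_shift//.
by apply: eq_bigr => -[[|k] hk] _ /=; rewrite ?fg ?g0.
Qed.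

End spectators.

Section closed_form.
Variable R : realType.
Local Notation P := (Pol R).
Local Notation C := (R[i]).
Variables (u1 v1 v2 v3 : C) (A B G H : nat -> C).
Hypothesis hA : forall q, A q.+1 = (q%:R + (u1 - v3 + 1)) * A q.
Hypothesis hB : forall q, B q = (q%:R + (v1 - v3 + 1)) * B q.+1.
Hypothesis hG : forall p, G p.+1 = (p%:R + (u1 - v2 + 1)) * G p.
Hypothesis hH : forall p, H p = (p%:R + (v1 - v2 + 1)) * H p.+1.

(** The binomial coefficient of u1 - v1 over k. *)
Definition gbinom (k : nat) : C := (\prod_(i < k) (u1 - v1 - i%:R)) / k`!%:R.

Lemma gbinomS k : gbinom k.+1 = gbinom k * (u1 - v1 - k%:R) / k.+1%:R.
Proof.
have f0 : k`!%:R != 0 :> C by rewrite pnatr_eq0 -lt0n fact_gt0.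
have k0 : k.+1%:R != 0 :> C by rewrite pnatr_eq0.
rewrite /gbinom big_ord_recr /= factS natrM; move: f0 k0.
move: (\prod_(i < k) _) (k`!%:R) (k.+1%:R) (k%:R) => a b c d b0 c0.
by field; rewrite b0 c0.
Qed.

(** A, B, G and H stand for the Gamma factors; the relations only use their
    recurrences. *)
Definition coef p q r k : C :=
  gbinom k * (p ^_ k)%:R * (r ^_ k)%:R * A q * B (q + k) * G (p - k) * H p.

Local Notation Dz := (@D R iz2).
Variable F : P -> P.
Hypothesis hF : spec_linear F.
Hypothesis F_emon : forall p q r, F (emon R p q r) =
  \sum_(k < r.+1) coef p q r k *: emon R (p - k) (q + k) (r - k).

Lemma coef_eq0 p q r k : (p < k)%N || (r < k)%N -> coef p q r k = 0.
Proof. by case/orP => h; rewrite /coef (ffact_small h) !(mulr0, mul0r). Qed.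

(** The terms beyond r vanish; a common range makes sums comparable. *)
Lemma F_emonK K p q r : (r < K)%N -> F (emon R p q r) =
  \sum_(k < K) coef p q r k *: emon R (p - k) (q + k) (r - k).
Proof.
move=> rK; rewrite F_emon (big_ord_widen _ (fun k => coef p q r k *: emon R (p - k) (q + k) (r - k)) rK).
rewrite big_mkcond; apply: eq_bigr => k _; case: ltnP => // rk.
by rewrite coef_eq0 ?scale0r// rk orbT.
Qed.

Lemma coef_scale p q r k (e e' : P) :
  ((k <= p)%N -> (k <= r)%N -> e = e') -> coef p q r k *: e = coef p q r k *: e'.
Proof.
move=> h; have [kp|pk] := leqP k p; have [kr|rk] := leqP k r; first by rewrite h.
all: by rewrite coef_eq0 ?scale0r// ?pk ?rk ?orbT.
Qed.

Lemma scale_distr (a x y : C) (e e' : P) :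
  (a * x) *: e + (a * y) *: e' = a *: (x *: e + y *: e').
Proof. by rewrite -!scalerA scalerDr. Qed.

Lemma ffact_recr n k : (n ^_ k.+1)%:R = (n ^_ k)%:R * (n%:R - k%:R) :> C.
Proof.
rewrite ffactnSr natrM; have [kn|nk] := leqP k n; first by rewrite natrB.
by rewrite ffact_small// !mul0r.
Qed.

Lemma subn_pred p k : (p.-1 - k = p - k.+1)%N.
Proof. by rewrite -subn1 -subnDA add1n. Qed.

Lemma ffact_G p k : (p ^_ k.+1)%:R * G (p - k) =
  (p ^_ k.+1)%:R * (p%:R - k%:R - 1 + (u1 - v2 + 1)) * G (p - k.+1).
Proof.
have [kp|pk] := ltnP k p; last by rewrite ffact_small// !mul0r.
have -> : (p - k)%N = (p - k.+1).+1 by rewrite -subSn.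
rewrite hG mulrA; congr (_ * _ * _); rewrite natrB// -[k.+1%:R]natr1; ring.
Qed.

Lemma ffact_H p k : p%:R * (p.-1 ^_ k)%:R * H p.-1 =
  (p ^_ k.+1)%:R * (p%:R - 1 + (v1 - v2 + 1)) * H p.
Proof.
case: p => [|p]; first by rewrite !mul0r.
by rewrite ffactSS natrM [p.+1.-1]/= hH -!mulrA; do 2 congr (_ * _); rewrite -natr1; ring.
Qed.

Lemma ffact_pred n k : n%:R * (n.-1 ^_ k)%:R = (n ^_ k.+1)%:R :> C.
Proof. by rewrite ffactnS natrM. Qed.

Lemma coefS p q r k : coef p q r k.+1 =
  gbinom k * ((u1 - v1 - k%:R) / k.+1%:R) * (p ^_ k.+1)%:R * (r ^_ k.+1)%:R
   * A q * B (q + k.+1) * G (p - k.+1) * H p.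
Proof. by rewrite /coef gbinomS -[gbinom k * _ / _]mulrA. Qed.

(** In this identity and the next three, the recurrences express all terms as
    multiples of one product [kap]; a rational identity is left. *)
Lemma coef21 p q r k :
  r%:R * coef p q.+1 r.-1 k - (p%:R + (v1 - v2 + 1)) * coef p.+1 q r k.+1 =
  coef p q r k * (r%:R - k%:R) - coef p q r k.+1 * (p%:R - k.+1%:R + (u1 - v2 + 1)).
Proof.
have k0 := natSC_neq0 R k.
pose kap := gbinom k * (p ^_ k)%:R * (r ^_ k.+1)%:R * A q * B (q + k.+1) * G (p - k) * H p.
have t1 : r%:R * coef p q.+1 r.-1 k = kap * (q%:R + (u1 - v3 + 1)).
  by rewrite /kap -ffact_pred /coef hA addSnnS; ring.
have t2 : (p%:R + (v1 - v2 + 1)) * coef p.+1 q r k.+1 =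
   kap * ((u1 - v1 - k%:R) / k.+1%:R) * (p%:R + 1).
  by rewrite coefS /kap ffactSS natrM subSS (hH p) -[p.+1%:R]natr1; ring.
have t3 : coef p q r k * (r%:R - k%:R) = kap * (q%:R + k%:R + (v1 - v3 + 1)).
  by rewrite /coef hB /kap ffact_recr addnS natrD; ring.
have t4 : coef p q r k.+1 * (p%:R - k.+1%:R + (u1 - v2 + 1)) =
    kap * ((u1 - v1 - k%:R) / k.+1%:R) * (p%:R - k%:R).
  transitivity (gbinom k * ((u1 - v1 - k%:R) / k.+1%:R) * (r ^_ k.+1)%:R * A q *
     B (q + k.+1) * H p * ((p ^_ k.+1)%:R * (p%:R - k%:R - 1 + (u1 - v2 + 1)) * G (p - k.+1))).
    by rewrite coefS; ring.
  by rewrite -ffact_G [(p ^_ k.+1)%:R]ffact_recr /kap; ring.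
rewrite t1 t2 t3 t4; clearbody kap; rewrite -[k.+1%:R]natr1 in k0 *; by field.
Qed.

Lemma coef32 p q r k :
  (v3 - v2 - 1 + p%:R - q%:R - r%:R) * coef p q r.+1 k.+1 - p%:R * coef p.-1 q.+1 r k =
  coef p q r k.+1 * (v3 - v2 - 1 + p%:R - q%:R - r%:R - k.+1%:R)
   - coef p q r k * (p%:R - k%:R).
Proof.
have k0 := natSC_neq0 R k.
pose kap := gbinom k * (p ^_ k.+1)%:R * (r ^_ k)%:R * A q * B (q + k.+1) * G (p - k.+1) * H p.
have t1 : coef p q r.+1 k.+1 = kap * ((u1 - v1 - k%:R) / k.+1%:R) * (r%:R + 1).
  by rewrite coefS /kap ffactSS natrM -[r.+1%:R]natr1; ring.
have t2 : p%:R * coef p.-1 q.+1 r k =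
    kap * ((q%:R + (u1 - v3 + 1)) * (p%:R - 1 + (v1 - v2 + 1))).
  transitivity (gbinom k * (r ^_ k)%:R * A q.+1 * B (q.+1 + k) * G (p.-1 - k) *
    (p%:R * (p.-1 ^_ k)%:R * H p.-1)); first by rewrite /coef; ring.
  by rewrite ffact_H subn_pred hA addSnnS /kap; ring.
have t3 : coef p q r k.+1 = kap * ((u1 - v1 - k%:R) / k.+1%:R) * (r%:R - k%:R).
  by rewrite coefS /kap [(r ^_ k.+1)%:R]ffact_recr; ring.
have t4 : coef p q r k * (p%:R - k%:R) =
    kap * ((q%:R + k%:R + (v1 - v3 + 1)) * (p%:R - k%:R - 1 + (u1 - v2 + 1))).
  transitivity (gbinom k * (r ^_ k)%:R * A q * B (q + k) * H p *
    ((p ^_ k.+1)%:R * G (p - k))); first by rewrite /coef ffact_recr; ring.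
  by rewrite ffact_G (hB (q + k)) /kap addnS natrD; ring.
rewrite t1 t2 t3 t4; clearbody kap; rewrite -[k.+1%:R]natr1 in k0 *; by field.
Qed.

Lemma coef13 p q r k :
  q%:R * (u1 - v3 + q%:R) * coef p q.-1 r k.+1 - p%:R * r%:R * coef p.-1 q r.-1 k =
  coef p q r k.+1 * ((q%:R + k.+1%:R) * (v1 - v3 + q%:R + k.+1%:R))
   - coef p q r k * ((p%:R - k%:R) * (r%:R - k%:R)).
Proof.
have k0 := natSC_neq0 R k.
pose kap := gbinom k * (p ^_ k.+1)%:R * (r ^_ k.+1)%:R * A q * B (q + k) * G (p - k.+1) * H p.
have t1 : q%:R * (u1 - v3 + q%:R) * coef p q.-1 r k.+1 =
    kap * ((u1 - v1 - k%:R) / k.+1%:R) * q%:R.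
  case: q @kap => [|q] kap; first by rewrite !mul0r mulr0.
  by rewrite coefS /kap [q.+1.-1]/= addSnnS hA -[q.+1%:R]natr1; ring.
have t2 : p%:R * r%:R * coef p.-1 q r.-1 k = kap * (p%:R - 1 + (v1 - v2 + 1)).
  transitivity (gbinom k * (r%:R * (r.-1 ^_ k)%:R) * A q * B (q + k) * G (p.-1 - k) *
    (p%:R * (p.-1 ^_ k)%:R * H p.-1)); first by rewrite /coef; ring.
  by rewrite ffact_H ffact_pred subn_pred /kap; ring.
have t3 : coef p q r k.+1 * ((q%:R + k.+1%:R) * (v1 - v3 + q%:R + k.+1%:R)) =
    kap * ((u1 - v1 - k%:R) / k.+1%:R) * (q%:R + k%:R + 1).
  by rewrite coefS /kap (hB (q + k)) -addnS natrD; ring.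
have t4 : coef p q r k * ((p%:R - k%:R) * (r%:R - k%:R)) =
    kap * (p%:R - k%:R - 1 + (u1 - v2 + 1)).
  transitivity (gbinom k * (r ^_ k.+1)%:R * A q * B (q + k) * H p *
    ((p ^_ k.+1)%:R * G (p - k))); first by rewrite /coef !ffact_recr; ring.
  by rewrite ffact_G /kap; ring.
rewrite t1 t2 t3 t4; clearbody kap; rewrite -[k.+1%:R]natr1 in k0 *; by field.
Qed.

Lemma coef11 p q r k :
  qdiag u1 v1 v2 v3 p%:R q%:R * coef p q r k.+1 - p%:R * r%:R * coef p.-1 q.+1 r.-1 k =
  coef p q r k.+1 * qdiag v1 u1 v2 v3 (p%:R - k.+1%:R) (q%:R + k.+1%:R)
   - coef p q r k * ((p%:R - k%:R) * (r%:R - k%:R)).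
Proof.
have k0 := natSC_neq0 R k.
pose kap := gbinom k * (p ^_ k.+1)%:R * (r ^_ k.+1)%:R * A q * B (q + k.+1) * G (p - k.+1) * H p.
have t1 : coef p q r k.+1 = kap * ((u1 - v1 - k%:R) / k.+1%:R).
  by rewrite coefS /kap; ring.
have t2 : p%:R * r%:R * coef p.-1 q.+1 r.-1 k =
    kap * ((q%:R + (u1 - v3 + 1)) * (p%:R - 1 + (v1 - v2 + 1))).
  transitivity (gbinom k * (r%:R * (r.-1 ^_ k)%:R) * A q.+1 * B (q.+1 + k) * G (p.-1 - k) *
    (p%:R * (p.-1 ^_ k)%:R * H p.-1)); first by rewrite /coef; ring.
  by rewrite ffact_H ffact_pred subn_pred hA addSnnS /kap; ring.
have t4 : coef p q r k * ((p%:R - k%:R) * (r%:R - k%:R)) =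
    kap * ((q%:R + k%:R + (v1 - v3 + 1)) * (p%:R - k%:R - 1 + (u1 - v2 + 1))).
  transitivity (gbinom k * (r ^_ k.+1)%:R * A q * B (q + k) * H p *
    ((p ^_ k.+1)%:R * G (p - k))); first by rewrite /coef !ffact_recr; ring.
  by rewrite ffact_G (hB (q + k)) /kap addnS natrD; ring.
rewrite t1 t2 t4 /qdiag; clearbody kap; rewrite -[k.+1%:R]natr1 in k0 *; by field.
Qed.
Lemma rel23 p q r : F (Dz (emon R p q r)) = Dz (F (emon R p q r)).
Proof.
have hl := hF.1; have [[[hlz _] _ _ _ _] _] := spec_linear_ops u1 v1 v2 v3.
rewrite Dz_emon (linZ hl) !(@F_emonK r.+1) ?leq_pred//; last by case: (r).
rewrite (lin_sum hlz) scaler_sumr; apply: eq_bigr => k _.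
rewrite Dz_emon subn_pred subnS !scalerA; congr (_ *: _).
rewrite /coef; have := ffact_pred r k; rewrite ffactnSr natrM => E.
transitivity (gbinom k * (p ^_ k)%:R * (r%:R * (r.-1 ^_ k)%:R) * A q * B (q + k) * G (p - k) * H p).
  by ring.
by rewrite E; ring.
Qed.

(** F maps a monomial to a sum along the chain (p - k, q + k, r - k); an operator
    that is diagonal and constant along it commutes with F. *)
Lemma rel_diag (d : nat -> nat -> nat -> C) (o : P -> P) p q r : islin o ->
  (forall p q r, o (emon R p q r) = d p q r *: emon R p q r) ->
  (forall k, (k <= p)%N -> (k <= r)%N -> d (p - k)%N (q + k)%N (r - k)%N = d p q r) ->
  F (o (emon R p q r)) = o (F (emon R p q r)).
Proof.
move=> ho od dk; rewrite od (linZ hF.1) F_emon (lin_sum ho) scaler_sumr.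
apply: eq_bigr => k _; rewrite od [LHS]scalerA mulrC -[LHS]scalerA.
by apply: coef_scale => kp kr; rewrite dk.
Qed.

Lemma rel22 p q r : F (o22 v2 (emon R p q r)) = o22 v2 (F (emon R p q r)).
Proof.
have [[_ _ [ho _] _ _] _] := spec_linear_ops u1 v1 v2 v3.
apply: (rel_diag ho (o22_emon v2)) => k kp kr.
by rewrite !natrB//; ring.
Qed.

Lemma rel33 p q r : F (o33 v3 (emon R p q r)) = o33 v3 (F (emon R p q r)).
Proof.
have [[_ _ _ _ [ho _]] _] := spec_linear_ops u1 v1 v2 v3.
apply: (rel_diag ho (o33_emon v3)) => k kp kr.
by rewrite natrB// natrD; ring.
Qed.

Lemma rel21 p q r : F (o21 v1 v2 (emon R p q r)) = o21 u1 v2 (F (emon R p q r)).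
Proof.
have hl := hF.1; have [[_ [ho _] _ _ _] _] := spec_linear_ops u1 u1 v2 v3.
pose b k := emon R (p.+1 - k) (q + k) (r - k).
pose f (k : nat) : C := r%:R * coef p q.+1 r.-1 k.
pose g (k : nat) : C := - ((p%:R + (v1 - v2 + 1)) * coef p.+1 q r k).
have -> : F (o21 v1 v2 (emon R p q r)) = \sum_(k < r.+2) (f k *: b k.+1 + g k *: b k).
  rewrite o21_emon (linD hl) (linN hl) !(linZ hl) !(@F_emonK r.+2) ?ltnS ?leqW ?leq_pred//.
  rewrite !scaler_sumr -sumrN -big_split; apply: eq_bigr => k _ /=.
  by rewrite !scalerA -scaleNr /b /f /g subSS addSnnS subn_pred.
pose f' (k : nat) : C := coef p q r k * (r%:R - k%:R).
pose g' (k : nat) : C := - (coef p q r k * (p%:R - k%:R + (u1 - v2 + 1))).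
have -> : o21 u1 v2 (F (emon R p q r)) = \sum_(k < r.+2) (f' k *: b k.+1 + g' k *: b k).
  rewrite (@F_emonK r.+2)// (lin_sum ho); apply: eq_bigr => k _.
  rewrite /f' /g' -mulrN scale_distr o21_emon; apply: coef_scale => kp kr.
  by rewrite /b !natrB// scaleNr subSS subSn// addnS subnS.
apply: (shift_eq (f := f) (g := g) (f' := f') (g' := g') b) => [||| k]; rewrite /f /g /f' /g'.
- by rewrite coef_eq0 ?mulr0// [X in _ || X](leq_ltn_trans (leq_pred r)) ?orbT.
- by rewrite coef_eq0 ?mul0r// ltnSn orbT.
- rewrite /coef !ffactn0 !subn0 hG (hH p); ring.
- by rewrite -coef21.
Qed.

Lemma rel32 p q r : F (o32 v2 v3 (emon R p q r)) = o32 v2 v3 (F (emon R p q r)).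
Proof.
have hl := hF.1; have [[_ _ _ [ho _] _] _] := spec_linear_ops u1 v1 v2 v3.
pose b k := emon R (p - k) (q + k) (r.+1 - k).
pose f (k : nat) : C := - (p%:R * coef p.-1 q.+1 r k).
pose g (k : nat) : C := (v3 - v2 - 1 + p%:R - q%:R - r%:R) * coef p q r.+1 k.
have -> : F (o32 v2 v3 (emon R p q r)) = \sum_(k < r.+2) (f k *: b k.+1 + g k *: b k).
  rewrite o32_emon (linD hl) (linN hl) !(linZ hl) !(@F_emonK r.+2)//.
  rewrite !scaler_sumr -sumrN -big_split; apply: eq_bigr => k _ /=.
  by rewrite !scalerA -scaleNr /b /f /g subSS addSnnS subn_pred addrC.
pose f' (k : nat) : C := - (coef p q r k * (p%:R - k%:R)).
pose g' (k : nat) : C := coef p q r k * (v3 - v2 - 1 + p%:R - q%:R - r%:R - k%:R).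
have -> : o32 v2 v3 (F (emon R p q r)) = \sum_(k < r.+2) (f' k *: b k.+1 + g' k *: b k).
  rewrite (@F_emonK r.+2)// (lin_sum ho); apply: eq_bigr => k _.
  rewrite /f' /g' -mulrN scale_distr o32_emon; apply: coef_scale => kp kr.
  rewrite /b !natrB// scaleNr subSS subSn// addnS subnS addrC; congr (_ + _ *: _).
  by rewrite natrD; ring.
apply: (shift_eq (f := f) (g := g) (f' := f') (g' := g') b) => [||| k]; rewrite /f /g /f' /g'.
- by rewrite coef_eq0 ?mulr0 ?oppr0// ltnSn orbT.
- by rewrite coef_eq0 ?mul0r ?oppr0// ltnSn orbT.
- by rewrite /coef !ffactn0; ring.
- by rewrite addrC coef32 addrC.
Qed.

Lemma rel13 p q r : F (q13 u1 v3 (emon R p q r)) = q13 v1 v3 (F (emon R p q r)).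
Proof.
have hl := hF.1; have [_ [_ [ho _]]] := spec_linear_ops u1 v1 v2 v3.
pose b k := emon R (p - k) (q + k).-1 (r - k).
pose f (k : nat) : C := - (p%:R * r%:R * coef p.-1 q r.-1 k).
pose g (k : nat) : C := q%:R * (u1 - v3 + q%:R) * coef p q.-1 r k.
have -> : F (q13 u1 v3 (emon R p q r)) = \sum_(k < r.+2) (f k *: b k.+1 + g k *: b k).
  rewrite q13_emon (linD hl) (linN hl) !(linZ hl) !(@F_emonK r.+2) ?ltnS ?leqW ?leq_pred//.
  rewrite !scaler_sumr -sumrN -big_split; apply: eq_bigr => k _ /=.
  rewrite !scalerA -scaleNr /b /f /g addnS !subn_pred addrC; congr (_ + _).
  by case: (q) => [|q']; rewrite ?mul0r ?scale0r.
pose f' (k : nat) : C := - (coef p q r k * ((p%:R - k%:R) * (r%:R - k%:R))).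
pose g' (k : nat) : C := coef p q r k * ((q%:R + k%:R) * (v1 - v3 + q%:R + k%:R)).
have -> : q13 v1 v3 (F (emon R p q r)) = \sum_(k < r.+2) (f' k *: b k.+1 + g' k *: b k).
  rewrite (@F_emonK r.+2)// (lin_sum ho); apply: eq_bigr => k _.
  rewrite /f' /g' -mulrN scale_distr q13_emon; apply: coef_scale => kp kr.
  by rewrite /b !natrB// scaleNr addnS !subnS addrC natrD addrA.
apply: (shift_eq (f := f) (g := g) (f' := f') (g' := g') b) => [||| k]; rewrite /f /g /f' /g'.
- by rewrite coef_eq0 ?mulr0 ?oppr0// [X in _ || X](leq_ltn_trans (leq_pred r)) ?orbT.
- by rewrite coef_eq0 ?mul0r ?oppr0// ltnSn orbT.
- rewrite /coef !ffactn0 !subn0 !addn0 !addr0; clear b f g f' g'; case: q => [|q]; first by rewrite !mul0r mulr0.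
  by rewrite hA [q.+1.-1]/= (hB q) -natr1; ring.
- by rewrite addrC coef13 addrC.
Qed.

Lemma rel11 p q r : F (q11 u1 v1 v2 v3 (emon R p q r)) = q11 v1 u1 v2 v3 (F (emon R p q r)).
Proof.
have hl := hF.1; have [_ [[ho _] _]] := spec_linear_ops v1 u1 v2 v3.
pose b k := emon R (p - k) (q + k) (r - k).
pose f (k : nat) : C := - (p%:R * r%:R * coef p.-1 q.+1 r.-1 k).
pose g (k : nat) : C := qdiag u1 v1 v2 v3 p%:R q%:R * coef p q r k.
have -> : F (q11 u1 v1 v2 v3 (emon R p q r)) = \sum_(k < r.+2) (f k *: b k.+1 + g k *: b k).
  rewrite q11_emon (linD hl) (linN hl) !(linZ hl) !(@F_emonK r.+2) ?ltnS ?leqW ?leq_pred//.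
  rewrite !scaler_sumr -sumrN -big_split; apply: eq_bigr => k _ /=.
  by rewrite !scalerA -scaleNr /b /f /g addSnnS !subn_pred addrC.
pose f' (k : nat) : C := - (coef p q r k * ((p%:R - k%:R) * (r%:R - k%:R))).
pose g' (k : nat) : C := coef p q r k * qdiag v1 u1 v2 v3 (p%:R - k%:R) (q%:R + k%:R).
have -> : q11 v1 u1 v2 v3 (F (emon R p q r)) = \sum_(k < r.+2) (f' k *: b k.+1 + g' k *: b k).
  rewrite (@F_emonK r.+2)// (lin_sum ho); apply: eq_bigr => k _.
  rewrite /f' /g' -mulrN scale_distr q11_emon; apply: coef_scale => kp kr.
  by rewrite /b !natrB// scaleNr addnS !subnS addrC natrD.
apply: (shift_eq (f := f) (g := g) (f' := f') (g' := g') b) => [||| k]; rewrite /f /g /f' /g'.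
- by rewrite coef_eq0 ?mulr0 ?oppr0// [X in _ || X](leq_ltn_trans (leq_pred r)) ?orbT.
- by rewrite coef_eq0 ?mul0r ?oppr0// ltnSn orbT.
- by rewrite subr0 addr0 mulrC; congr (_ * _); rewrite /qdiag; ring.
- by rewrite addrC coef11 addrC.
Qed.

(** By linearity over C[x1, y1, z1], the derivatives of point 1 commute with F once
    they do so on monomials in x, y, z, where they vanish. *)
Lemma relD (i : 'I_6) p : (i < 3)%N -> F (D i p) = D i (F p).
Proof.
move=> i3; have hl := hF.1.
have lD : islin (@D R i) by move=> a s t; rewrite DD DZ.
have De p' q r : D i (emon R p' q r) = 0.
  have ne (j : 'I_6) k : (2 < j)%N -> D i (V R j ^+ k) = 0.
    move=> j3; apply: DVX_neq; apply/negbTE.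
    by rewrite neq_ltn (leq_trans i3) ?orbT.
  by rewrite emonE !DM !ne// !(mulr0, mul0r, addr0).
have step (j : 'I_6) w : (j < 3)%N -> F (D i w) = D i (F w) ->
    F (D i (V R j * w)) = D i (F (V R j * w)).
  move=> j3 Fw; rewrite DM (hF.2 _ _ j3) DM DV (linD hl) (lin_nat _ _ hl).
  by rewrite (hF.2 _ _ j3) Fw.
have stepX (j : 'I_6) k w : (j < 3)%N -> F (D i w) = D i (F w) ->
    F (D i (V R j ^+ k * w)) = D i (F (V R j ^+ k * w)).
  move=> j3 Fw; elim: k => [|k IH]; first by rewrite expr0 mul1r.
  by rewrite exprS -mulrA; apply: (step).
apply: (@islin_ext _ _ _ (F \o D i) (D i \o F)) => [a s t|a s t|m] /=.
- by rewrite lD hl.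
- by rewrite hl lD.
rewrite monoE mono_emon; do 3 apply: (stepX) => //.
rewrite De (lin0 hl) F_emon (lin_sum lD) big1// => k _.
by rewrite De scaler0.
Qed.

(** The relations hold on monomials by comparison of coefficients, and extend by
    linearity over C[x1, y1, z1]; [o31] is a commutator. *)
Theorem closed_form_intertwiner :
  [/\ intertwiner u1 v1 v2 v3 F,
      forall p, F (q11 u1 v1 v2 v3 p) = q11 v1 u1 v2 v3 (F p) &
      forall p, F (q13 u1 v3 p) = q13 v1 v3 (F p)].
Proof.
have hl := hF.1.
have [[s23 s21 s22 s32 s33] [s11 s13]] := spec_linear_ops u1 v1 v2 v3.
have [[_ t21 _ _ _] [_ t13]] := spec_linear_ops u1 u1 v2 v3.
have [_ [t11 _]] := spec_linear_ops v1 u1 v2 v3.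
have ext (o o' : P -> P) : spec_linear o -> spec_linear o' ->
    (forall p q r, F (o (emon R p q r)) = o' (F (emon R p q r))) ->
    forall p, F (o p) = o' (F p).
  move=> so so' h; apply: (@spec_linear_ext _ (F \o o) (o' \o F)) => //;
  exact: spec_linear_comp.
have h21 := ext _ _ s21 t21 rel21; have h32 := ext _ _ s32 s32 rel32.
split; [split => //|exact: ext _ _ s11 t11 rel11|exact: ext _ _ t13 s13 rel13].
- exact: hF.2.
- by move=> i p; exact: relD.
- exact: (ext _ _ s23 s23 rel23).
- exact: (ext _ _ s22 s22 rel22).
- exact: (ext _ _ s33 s33 rel33).
- move=> p; rewrite !o31_commutator (linD hl) (linN hl).
  by rewrite h21 !h32 h21.
Qed.
End closed_form.

(** * Exponentials of derivations and Laurent polynomials *)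

Section exponentials.
Variables (R : realType) (W : lmodType R[i]).
Implicit Types (A : W -> W) (v w : W).

Lemma expop_trunc A v N : (forall n, (N <= n)%N -> iter n A v = 0) ->
  expop A v = \sum_(n < N) (n`!%:R : R[i])^-1 *: iter n A v.
Proof.
move=> h; rewrite /expop (fsbig_ord _ _ (fun n : nat => (n`!%:R : R[i])^-1 *: iter n A v)).
apply/esym/fsbig_widen => // n [_ /= /negP]; rewrite -leqNgt => Nn.
by rewrite h// scaler0.
Qed.

Definition nilpotent_at A v := exists N, forall n, (N <= n)%N -> iter n A v = 0.

Lemma iter_lin A : islin A -> forall n, islin (iter n A).
Proof. by move=> hA; elim=> [|n IH] a p q //=; rewrite IH hA. Qed.

Lemma nilpotent_at_lin A : islin A -> forall a v w,
  nilpotent_at A v -> nilpotent_at A w -> nilpotent_at A (a *: v + w).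
Proof.
move=> hA a v w [N hN] [M hM]; exists (maxn N M) => n.
rewrite geq_max => /andP[Nn Mn]; rewrite iter_lin// hN// hM//.
by rewrite scaler0 addr0.
Qed.

Lemma expop_lin_at A : islin A -> forall a v w,
  nilpotent_at A v -> nilpotent_at A w ->
  expop A (a *: v + w) = a *: expop A v + expop A w.
Proof.
move=> hA a v w [N hN] [M hM]; pose K := maxn N M.
have KN n : (K <= n)%N -> iter n A v = 0.
  by rewrite geq_max => /andP[Nn _]; exact: hN.
have KM n : (K <= n)%N -> iter n A w = 0.
  by rewrite geq_max => /andP[_ Mn]; exact: hM.
rewrite (@expop_trunc _ v K)// (@expop_trunc _ w K)// (@expop_trunc _ _ K); last first.
  by move=> n Kn; rewrite iter_lin// KN// KM// scaler0 addr0.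
rewrite scaler_sumr -big_split; apply: eq_bigr => n _ /=.
by rewrite iter_lin// scalerDr !scalerA mulrC.
Qed.

Lemma expop_lin A : islin A -> (forall v, nilpotent_at A v) -> islin (expop A).
Proof. by move=> hA nA a v w; apply: expop_lin_at. Qed.
End exponentials.

Section substitutions.
Variable R : realType.
Local Notation P := (Pol R).

Definition subst_tuple (i : 'I_6) (t : P) : 6.-tuple P :=
  [tuple (if j == i then t else V R j) | j < 6].

Lemma comp_mpoly_V (t : 6.-tuple P) i : V R i \mPo t = tnth t i.
Proof. by rewrite VE comp_mpolyXU -tnth_nth. Qed.

Lemma subst_V i t j : V R j \mPo subst_tuple i t = if j == i then t else V R j.
Proof. by rewrite comp_mpoly_V tnth_mktuple. Qed.

Lemma iter_derivation (i : 'I_6) (q w : P) (a n : nat) : D i q = 0 -> D i w = 0 ->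
  iter n (fun p => q * D i p) (V R i ^+ a * w) =
  (a ^_ n)%:R * (q ^+ n * (V R i ^+ (a - n) * w)).
Proof.
move=> hq hw.
have hqn m : D i (q ^+ m) = 0.
  elim: m => [|m IH]; first by rewrite expr0 -[1]/(1%:R) Dnat.
  by rewrite exprS DM hq IH mul0r mulr0 addr0.
elim: n => [|n IH]; first by rewrite subn0 expr0 !mul1r.
rewrite iterS IH !DM Dnat hqn hw DVX ffactnSr subnS natrM exprS.
move: (_ ^+ _) (_ ^+ _) (_ ^+ _) => x y z; ring.
Qed.

(** On powers of x_i this is the binomial theorem, and both sides are linear over
    the polynomials without x_i. *)
Lemma expop_derivation (i : 'I_6) (q : P) : D i q = 0 ->
  expop (fun p : P => q * p^`M(i)) =1 comp_mpoly (subst_tuple i (V R i + q)).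
Proof.
move=> hq; have -> : (fun p : P => q * p^`M(i)) = (fun p => q * D i p).
  by apply/funext => p; rewrite DerE.
set A := fun p => q * D i p.
have lA : islin A by move=> a p r; rewrite /A DD DZ mulrDr scalerAr.
have step a w : D i w = 0 ->
    nilpotent_at A (V R i ^+ a * w) /\
    expop A (V R i ^+ a * w) = (V R i + q) ^+ a * w.
  move=> hw; have z n : (a.+1 <= n)%N -> iter n A (V R i ^+ a * w) = 0.
    by move=> an; rewrite iter_derivation// ffact_small// mul0r.
  split; first by exists a.+1.
  rewrite (@expop_trunc _ _ _ _ a.+1)// exprDn mulr_suml; apply: eq_bigr => n _.
  have nf0 : n`!%:R != 0 :> R[i] by rewrite pnatr_eq0 -lt0n fact_gt0.
  have E : Cst (n`!%:R^-1) * n`!%:R = 1 :> P.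
    by rewrite -[X in _ * X]Cst_nat -CstM mulVf// Cst1.
  rewrite iter_derivation// -bin_ffact natrM scale_Cst -[in RHS]mulr_natl.
  transitivity ((Cst (n`!%:R^-1) * n`!%:R) * ('C(a, n)%:R * (V R i ^+ (a - n) * q ^+ n) * w)).
    by move: (Cst _) (_ ^+ _) (_ ^+ _) => x y t; ring.
  by rewrite E mul1r -!mulrA.
have mon m : nilpotent_at A ('X_[m] : P) /\
    expop A ('X_[m] : P) = 'X_[m] \mPo subst_tuple i (V R i + q).
  have -> : 'X_[m] = V R i ^+ m i * \prod_(j < 6 | j != i) V R j ^+ m j :> P.
    rewrite mpolyXE_id (bigD1 i)//= -VE; congr (_ * _).
    by apply: eq_bigr => j _; rewrite -VE.
  set w := \prod_(j < 6 | _) _.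
  have dw : D i w = 0.
    apply: (big_ind (fun x => D i x = 0)) => [|x y hx hy|j ji].
    - by rewrite -[1]/(1%:R) Dnat.
    - by rewrite DM hx hy mul0r mulr0 addr0.
    - by apply: DVX_neq; apply/negbTE; move: ji; rewrite -(inj_eq val_inj).
  have sw : w \mPo subst_tuple i (V R i + q) = w.
    apply: (big_ind (fun x => x \mPo subst_tuple i (V R i + q) = x)) => [|x y hx hy|j ji].
    - exact: comp_mpoly1.
    - by rewrite rmorphM /= hx hy.
    - by rewrite rmorphXn /= subst_V (negbTE ji).
  have [n1 n2] := step (m i) w dw; split => //.
  by rewrite n2 rmorphM rmorphXn /= subst_V eqxx sw.
suff H p : nilpotent_at A p /\ expop A p = p \mPo subst_tuple i (V R i + q).
  by move=> p; exact: (H p).2.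
elim/mpolyind : p => [|c m p _ _ [IH1 IH2]].
  have n0 : nilpotent_at A (0 : P).
    by exists 0%N => n _; rewrite (lin0 (iter_lin lA n)).
  split => //; have := expop_lin_at lA (-1) n0 n0.
  by rewrite scaler0 addr0 scaleN1r addNr comp_mpoly0.
have [m1 m2] := mon m; split; first exact: nilpotent_at_lin.
rewrite (expop_lin_at lA c m1 IH1) m2 IH2.
by rewrite comp_mpolyD comp_mpolyZ.
Qed.
End substitutions.

Section frame.
Variable R : realType.
Local Notation P := (Pol R).
Local Notation X1 := (V R ix1).
Local Notation Y1 := (V R iy1).
Local Notation Z1 := (V R iz1).
Local Notation X := (V R ix2).
Local Notation Y := (V R iy2).
Local Notation Z := (V R iz2).

Lemma S1E (p : P) : S1 p = ((p \mPo subst_tuple ix2 (X + X1)) \mPo subst_tuple iz2 (Z + Z1))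
   \mPo subst_tuple iy2 (Y + (Y1 - Z1 * X)).
Proof.
rewrite /S1 /=.
have e (i : 'I_6) q : D i q = 0 -> forall p : P,
    expop (fun p : P => q * p^`M(i)) p = p \mPo subst_tuple i (V R i + q).
  by move=> *; exact: expop_derivation.
rewrite -!VE !e ?DN ?DD ?DN ?DM ?DV //= ?mulr0 ?mul0r ?addr0 ?subr0 //.
Qed.

Definition xyz_tuple : 6.-tuple P :=
  [tuple 'X_ix1; 'X_iy1; 'X_iz1; 'X_ix2; 'X_iy2 - 'X_ix2 * 'X_iz2; 'X_iz2].
(** Passage to the coordinates x, y, z, which keep the names x2, y2, z2. *)
Definition to_xyz : P -> P := locked_with frame_key (comp_mpoly xyz_tuple).
Lemma to_xyzE p : to_xyz p = p \mPo xyz_tuple.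
Proof. by rewrite /to_xyz unlock. Qed.
Lemma to_xyzM p q : to_xyz (p * q) = to_xyz p * to_xyz q.
Proof. by rewrite !to_xyzE; exact: rmorphM. Qed.
Lemma to_xyzD p q : to_xyz (p + q) = to_xyz p + to_xyz q.
Proof. by rewrite !to_xyzE; exact: comp_mpolyD. Qed.
Lemma to_xyzN p : to_xyz (- p) = - to_xyz p.
Proof. by rewrite !to_xyzE; exact: comp_mpolyN. Qed.
Lemma to_xyzZ a p : to_xyz (a *: p) = a *: to_xyz p.
Proof. by rewrite !to_xyzE; exact: comp_mpolyZ. Qed.
Lemma to_xyzX p n : to_xyz (p ^+ n) = to_xyz p ^+ n.
Proof. by rewrite !to_xyzE rmorphXn. Qed.
Lemma to_xyzC c : to_xyz c%:MP = c%:MP.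
Proof. by rewrite to_xyzE comp_mpolyC. Qed.
Lemma to_xyz_lin : islin to_xyz.
Proof. by move=> a p q; rewrite to_xyzD to_xyzZ. Qed.
Lemma to_xyz_var : ((to_xyz X1 = X1) * (to_xyz Y1 = Y1) * (to_xyz Z1 = Z1) *
  (to_xyz X = X) * (to_xyz Y = (Y - X * Z)%R) * (to_xyz Z = Z))%type.
Proof. by do ![split]; rewrite to_xyzE comp_mpoly_V !VE. Qed.

Lemma S1C c : S1 (c%:MP : P) = c%:MP.
Proof. by rewrite S1E !comp_mpolyC. Qed.
Lemma S1D (p q : P) : S1 (p + q) = S1 p + S1 q.
Proof. by rewrite !S1E !comp_mpolyD. Qed.
Lemma S1M (p q : P) : S1 (p * q) = S1 p * S1 q.
Proof. by rewrite !S1E !rmorphM. Qed.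
Lemma S1_V : ((S1 X1 = X1) * (S1 Y1 = Y1) * (S1 Z1 = Z1) *
  (S1 X = (X + X1)%R) * (S1 Y = (Y + (Y1 - Z1 * X))%R) * (S1 Z = (Z + Z1)%R))%type.
Proof.
by do ![split]; rewrite S1E ?(subst_V, comp_mpolyD) /= ?(subst_V, comp_mpolyD) /= ?subst_V /=.
Qed.

(** Both sides are ring morphisms, so it suffices to compare them on variables. *)
Lemma to_xyz_S1 p : to_xyz (S1 p) = theta p.
Proof.
elim/pol_ind : p => [c||p q hp hq|p q hp hq].
- by rewrite S1C to_xyzC thetaU comp_mpolyC.
- apply: ord6_ind; rewrite !S1_V ?(to_xyzD, to_xyzN, to_xyzM) !to_xyz_var !theta_var //.
  by pring.
- by rewrite S1D to_xyzD thetaD -hp -hq.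
- by rewrite S1M to_xyzM thetaM -hp -hq.
Qed.

Lemma to_xyz_inj : injective to_xyz.
Proof.
pose t : 6.-tuple P := [tuple X1; Y1; Z1; X; Y + X * Z; Z].
have tV i : V R i \mPo t = tnth t i by exact: comp_mpoly_V.
apply: (@can_inj _ _ _ (comp_mpoly t)) => p.
elim/pol_ind : p => [c||p q hp hq|p q hp hq].
- by rewrite to_xyzC comp_mpolyC.
- apply: ord6_ind; rewrite !to_xyz_var ?comp_mpolyB ?rmorphM /= !tV //.
  by rewrite /tnth /=; pring.
- by rewrite to_xyzD comp_mpolyD hp hq.
- by rewrite to_xyzM rmorphM /= hp hq.
Qed.

Lemma S1invE g : S1inv g = thetai (to_xyz g).
Proof.
have inj : injective (@S1 R).
  by apply: (@can_inj _ _ _ (thetai (R := R) \o to_xyz)) => p /=; rewrite to_xyz_S1 thetaK.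
have E : S1 (thetai (to_xyz g)) = g by apply: to_xyz_inj; rewrite to_xyz_S1 thetaiK.
have inj' : {in [set: P]%classic &, injective (@S1 R)} by move=> p q _ _; exact: inj.
rewrite -[in LHS]E; move: (thetai _) => p.
have h : p \in [set: P]%classic by rewrite inE.
exact: (pinvKV (fun=> 0) inj' h).
Qed.
End frame.

Section linear_extensions.
Variables (R : realType) (W : lmodType R[i]).
Local Notation P := (Pol R).

(** Sums over supports become sums over a common index sequence, which gives
    linearity of extensions from a basis. *)
Lemma sum_support (T : eqType) (s s' : seq T) (F : T -> W) :
  uniq s -> uniq s' -> {subset s <= s'} ->
  (forall x, x \notin s -> F x = 0) ->
  \sum_(x <- s) F x = \sum_(x <- s') F x.
Proof.
move=> us us' ss' F0; rewrite [RHS](bigID (mem s)) /= [X in _ + X]big1 ?addr0.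
  rewrite -[RHS]big_filter; apply: perm_big; apply: uniq_perm => //.
    exact: filter_uniq.
  by move=> x; rewrite mem_filter; apply/idP/andP => [xs|[]//]; split => //; exact: ss'.
by move=> x; exact: F0.
Qed.

Lemma msum_lin (f : 'X_{1..6} -> W) :
  islin (fun p : P => \sum_(m <- msupp p) p@_m *: f m).
Proof.
move=> a p q /=.
pose s := undup (msupp p ++ msupp q ++ msupp (a *: p + q)).
have us : uniq s by exact: undup_uniq.
have E (r : P) : {subset msupp r <= s} ->
    \sum_(m <- msupp r) r@_m *: f m = \sum_(m <- s) r@_m *: f m.
  move=> rs; apply: sum_support (mpoly.msupp_uniq _) us rs _ => m.
  by move=> mr; rewrite memN_msupp_eq0// scale0r.
rewrite !E; first last.
- by move=> m; rewrite mem_undup !mem_cat => ->; rewrite !orbT.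
- by move=> m; rewrite mem_undup !mem_cat => ->.
- by move=> m; rewrite mem_undup !mem_cat => ->; rewrite !orbT.
rewrite scaler_sumr -big_split; apply: eq_bigr => m _ /=.
by rewrite mcoeffD mcoeffZ scalerDl scalerA.
Qed.

Lemma msum_X (f : 'X_{1..6} -> W) m :
  \sum_(m' <- msupp ('X_[m] : P)) ('X_[m] : P)@_m' *: f m' = f m.
Proof. by rewrite msuppX big_seq1 mcoeffX eqxx scale1r. Qed.

Lemma lin_ext_lin (f : lexp -> W) : islin (lin_ext f).
Proof.
move=> a p q; rewrite /lin_ext.
pose s := undup (enum_fset (monalg.msupp p) ++ enum_fset (monalg.msupp q) ++ enum_fset (monalg.msupp (a *: p + q))).
have us : uniq s by exact: undup_uniq.
have E (r : laurent R) : {subset enum_fset (monalg.msupp r) <= s} ->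
    \sum_(e <- monalg.msupp r) monalg.mcoeff e r *: f e =
    \sum_(e <- s) monalg.mcoeff e r *: f e.
  move=> rs; apply: sum_support (fset_uniq _) us rs _ => m.
  by move=> mr; rewrite monalg.mcoeff_outdom// scale0r.
rewrite !E; first last.
- by move=> m; rewrite mem_undup !mem_cat => ->; rewrite !orbT.
- by move=> m; rewrite mem_undup !mem_cat => ->.
- by move=> m; rewrite mem_undup !mem_cat => ->; rewrite !orbT.
rewrite scaler_sumr -big_split; apply: eq_bigr => m _ /=.
by rewrite monalg.mcoeffD monalg.mcoeffZ scalerDl scalerA.
Qed.

Lemma lin_ext_mon (f : lexp -> W) e : lin_ext f (lmon R e) = f e.
Proof.
rewrite /lin_ext /lmon monalg.msuppU oner_eq0.
by rewrite big_seq_fset1 monalg.mcoeffUU scale1r.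
Qed.
End linear_extensions.

Section laurent_operators.
Variable R : realType.
Local Notation P := (Pol R).
Local Notation C := (R[i]).
Local Notation L := (laurent R).

Lemma laurentE (g : L) :
  g = \sum_(e <- monalg.msupp g) monalg.mcoeff e g *: lmon R e.
Proof.
rewrite {1}[g]monalg.monalgE; apply: eq_bigr => e _; apply/monalg.malgP => e'.
by rewrite monalg.mcoeffZ /lmon !monalg.mcoeffU mulrnAr mulr1.
Qed.

Lemma laurent_ind (Q : L -> Prop) : Q 0 ->
  (forall c e g, Q g -> Q (c *: lmon R e + g)) -> forall g, Q g.
Proof.
move=> Q0 QD g; rewrite (laurentE g); elim: (enum_fset _) => [|e s IH].
  by rewrite big_nil.
by rewrite big_cons; exact: QD.
Qed.

Lemma yx_dz_lin : islin (@yx_dz R).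
Proof. exact: lin_ext_lin. Qed.

Lemma yx_dz_mon a b c (p : int) q r : yx_dz (lmon R (a, b, c, p, q, r)) =
  r%:R *: lmon R (a, b, c, p - 1, q.+1, r.-1).
Proof. exact: lin_ext_mon. Qed.

Lemma iter_yx_dz n a b c (p : int) q r : iter n (@yx_dz R) (lmon R (a, b, c, p, q, r)) =
  (r ^_ n)%:R *: lmon R (a, b, c, p - n%:Z, (q + n)%N, (r - n)%N).
Proof.
elim: n => [|n IH]; first by rewrite ffactn0 scale1r subr0 addn0 subn0.
rewrite iterS IH (linZ yx_dz_lin) yx_dz_mon scalerA.
have -> : p - n.+1%:Z = p - n%:Z - 1 by rewrite -addn1 PoszD opprD addrA.
rewrite ffactnSr natrM subnS addnS.
reflexivity.
Qed.

Lemma yx_dz_nilpotent (g : L) : nilpotent_at (@yx_dz R) g.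
Proof.
elim/laurent_ind: g => [|x [[[[[a b] c] p] q] r] g ng].
  by exists 0%N => n _; rewrite (lin0 (iter_lin yx_dz_lin n)).
apply: (nilpotent_at_lin yx_dz_lin) => //; exists r.+1 => n rn.
by rewrite iter_yx_dz ffact_small// scale0r.
Qed.

Lemma iter_oppr (A : L -> L) n g : islin A ->
  iter n (fun h => - A h) g = (-1) ^+ n *: iter n A g.
Proof.
move=> hA; elim: n => [|n IH]; first by rewrite expr0 scale1r.
rewrite !iterS IH (linZ hA) -scaleN1r scalerA exprS.
reflexivity.
Qed.

Lemma opp_yx_dz_lin : islin (fun g => - @yx_dz R g).
Proof. by move=> a u v; rewrite yx_dz_lin opprD scalerN. Qed.

Lemma opp_yx_dz_nilpotent (g : L) : nilpotent_at (fun g => - @yx_dz R g) g.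
Proof.
have [N hN] := yx_dz_nilpotent g; exists N => n Nn.
by rewrite iter_oppr ?hN ?scaler0//; exact: yx_dz_lin.
Qed.

Lemma fun_xdx_lin f : islin (@fun_xdx R f). Proof. exact: lin_ext_lin. Qed.
Lemma fun_ydy_lin f : islin (@fun_ydy R f). Proof. exact: lin_ext_lin. Qed.
Lemma of_laurent_lin : islin (@of_laurent R). Proof. exact: lin_ext_lin. Qed.

(** The second half of [to_laurent], after the change of coordinates. *)
Definition to_lmon (p : P) : L :=
  \sum_(m <- msupp p) p@_m *: lmon R (m ix1, m iy1, m iz1, Posz (m ix2), m iy2, m iz2).

Lemma to_lmon_lin : islin to_lmon.
Proof. exact: (msum_lin (fun m => lmon R (m ix1, m iy1, m iz1, Posz (m ix2), m iy2, m iz2))). Qed.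

Lemma to_lmonX m : to_lmon 'X_[m] =
  lmon R (m ix1, m iy1, m iz1, Posz (m ix2), m iy2, m iz2).
Proof. exact: (msum_X (fun m => lmon R (m ix1, m iy1, m iz1, Posz (m ix2), m iy2, m iz2))). Qed.

Lemma to_xyz_of_laurent a b c (z : int) q r :
  to_xyz (of_laurent (lmon R (a, b, c, z, q, r))) =
  if z is Posz n then V R ix1 ^+ a * (V R iy1 ^+ b * (V R iz1 ^+ c * emon R n q r)) else 0.
Proof.
rewrite /of_laurent lin_ext_mon; case: z => n; last first.
  by rewrite (lin0 (@to_xyz_lin R)).
rewrite -!VE !(to_xyzM, to_xyzX, to_xyzD) !to_xyz_var emonE subrK.
by rewrite -!mulrA.
Qed.

End laurent_operators.

(** * Finite differences and the explicit formula in the frame *)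

Section antidiagonals.
Lemma sum_antidiagonal (W : nmodType) K (f : nat -> nat -> W) :
  (forall j i, (K <= i + j)%N -> f j i = 0) ->
  \sum_(j < K) \sum_(i < K) f j i = \sum_(n < K) \sum_(j < n.+1) f j (n - j)%N.
Proof.
move=> f0.
have E (j : 'I_K) : \sum_(i < K) f j i = \sum_(n < K | (j <= n)%N) f j (n - j)%N.
  rewrite -(big_mkord xpredT (fun i => f j i)) (big_cat_nat (n := (K - j)%N)) ?leq_subr//=.
  rewrite [X in _ + X]big_nat_cond [X in _ + X]big1 ?addr0; last first.
    by move=> i /andP[/andP[h _] _]; apply: f0; rewrite addnC -leq_subLR.
  rewrite -(big_mkord (fun n => j <= n)%N (fun n => f j (n - j)%N)).
  rewrite [RHS](big_cat_nat (n := j)) ?(ltnW (ltn_ord j))//=.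
  rewrite [X in _ = X + _]big_nat_cond [X in _ = X + _]big1 ?add0r; last first.
    by move=> i /andP[/andP[_ h] h']; rewrite leqNgt h in h'.
  rewrite -{3}[nat_of_ord j]add0n big_addn big_nat [RHS]big_nat_cond.
  by apply: eq_big => [i|i _]; rewrite ?leq_addl ?andbT ?addnK.
under eq_bigr do rewrite E.
rewrite (exchange_big_dep xpredT)//=; apply: eq_bigr => n _.
rewrite (big_ord_widen_cond K xpredT (fun j => f j (n - j)%N))//.
Qed.
End antidiagonals.

Section newton.
Variable R : realType.
Local Notation C := (R[i]).
Variables (s al be : C) (A B : nat -> C).
Hypothesis hs : s = al - be.
Hypothesis hA : forall q, A q.+1 = (q%:R + al) * A q.
Hypothesis hB : forall q, B q = (q%:R + be) * B q.+1.

(** The n-th finite difference of phi at 0. *)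
Definition fdiff (phi : nat -> C) n : C :=
  \sum_(j < n.+1) ('C(n, j)%:R * (-1) ^+ (n - j)) * phi j.

Lemma fdiffS phi n : fdiff phi n.+1 = fdiff (phi \o S) n - fdiff phi n.
Proof.
have -> : fdiff phi n = \sum_(j < n.+2) ('C(n, j)%:R * (-1) ^+ (n - j)) * phi j.
  by rewrite [RHS]big_ord_recr /= bin_small// !mul0r addr0.
rewrite {1}/fdiff /fdiff big_ord_recl [X in _ - X]big_ord_recl /=.
rewrite !bin0 !subn0 !mul1r exprS mulN1r mulNr opprD [RHS]addrCA; congr (_ + _).
rewrite -sumrB; apply: eq_bigr => j _; rewrite /bump /= add1n binS subSS natrD.
have [jn|nj] := ltnP j n; last by rewrite bin_small// add0r !mul0r subr0.
have -> : (n - j)%N = (n - j.+1).+1 by rewrite -subSn.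
by rewrite exprS; ring.
Qed.

(** A quotient Gamma(q + al) / Gamma(q + be) behaves like a power of q with
    exponent s = al - be: each difference multiplies it by s - n and lowers the
    exponent by 1. *)
Lemma fdiff_ratio n : forall q, fdiff (fun j => A (q + j) * B (q + j)) n =
  (\prod_(i < n) (s - i%:R)) * A q * B (q + n).
Proof.
elim: n => [|n IH] q.
  by rewrite /fdiff big_ord_recl !big_ord0 bin0 expr0 addn0 addr0 !mul1r.
rewrite fdiffS; have -> : (fun j => A (q + j) * B (q + j)) \o S =
    (fun j => A (q.+1 + j) * B (q.+1 + j)).
  by apply/funext => j /=; rewrite addSnnS.
rewrite !IH hA big_ord_recr /= addSnnS (hB (q + n)) addnS natrD hs.
ring.
Qed.
End newton.

Section exp_conjugation.
Variables (R : realType) (W : lmodType R[i]).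
Local Notation C := (R[i]).
Variables (u1 v1 v3 : C) (A B : nat -> C).
Hypothesis hA : forall q, A q.+1 = (q%:R + (u1 - v3 + 1)) * A q.
Hypothesis hB : forall q, B q = (q%:R + (v1 - v3 + 1)) * B q.+1.

(** With [En n] = E^n v, T1 = exp E, T2 = exp (- E) and Phi diagonal on the En, the
    coefficient of E^n v in T2 Phi T1 v is the n-th finite difference of the
    eigenvalues of Phi, divided by the factorial of n. *)
Lemma exp_conjugation (T1 T2 Phi : W -> W) (En : nat -> W) q r :
  islin Phi -> islin T2 -> (forall n, (r < n)%N -> En n = 0) ->
  T1 (En 0%N) = \sum_(j < r.+1) (j`!%:R)^-1 *: En j ->
  (forall j, Phi (En j) = (A (q + j) * B (q + j)) *: En j) ->
  (forall j, T2 (En j) = \sum_(i < r.+1) ((i`!%:R)^-1 * (-1) ^+ i) *: En (i + j)%N) ->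
  T2 (Phi (T1 (En 0%N))) = \sum_(n < r.+1) (gbinom u1 v1 n * A q * B (q + n)) *: En n.
Proof.
move=> lPhi lT2 En0 s1 s2 s3.
rewrite s1 (lin_sum lPhi).
under eq_bigr => j _ do rewrite s2 scalerA.
rewrite (lin_sum lT2).
pose g j i := ((j`!%:R)^-1 * (A (q + j) * B (q + j)) * ((i`!%:R)^-1 * (-1) ^+ i)) *: En (i + j)%N.
transitivity (\sum_(j < r.+1) \sum_(i < r.+1) g j i).
  by apply: eq_bigr => j _; rewrite s3 scaler_sumr; apply: eq_bigr => i _; rewrite scalerA.
rewrite sum_antidiagonal; last by move=> j i h; rewrite /g En0 ?scaler0.
apply: eq_bigr => n _.
have fn k : k`!%:R != 0 :> C by rewrite pnatr_eq0 -lt0n fact_gt0.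
transitivity ((\sum_(j < n.+1) (n`!%:R)^-1 * ('C(n, j)%:R * (-1) ^+ (n - j) * (A (q + j) * B (q + j)))) *: En n).
  rewrite scaler_suml; apply: eq_bigr => -[j /= jn] _; rewrite /g subnK//.
  have {}jn : (j <= n)%N by [].
  congr (_ *: _); have := bin_fact jn; move/(congr1 (fun k : nat => k%:R : C)).
  rewrite !natrM => E; have -> : (n`!%:R)^-1 * ('C(n, j)%:R * (-1) ^+ (n - j) * (A (q + j) * B (q + j))) =
    (n`!%:R)^-1 * 'C(n, j)%:R * ((-1) ^+ (n - j) * (A (q + j) * B (q + j))) by ring.
  rewrite -E !invfM.
  have := fn j; have := fn (n - j)%N; have : 'C(n, j)%:R != 0 :> C.
    by rewrite pnatr_eq0 -lt0n bin_gt0.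
  move: ('C(n, j)%:R) (j`!%:R) ((n - j)`!%:R) ((-1) ^+ _) (A _) (B _) => x y z t aa bb x0 y0 z0.
  by field; rewrite x0 y0 z0.
rewrite -mulr_sumr; congr (_ *: _).
(* the sum is the n-th difference of A B at q *)
have := fdiff_ratio (s := u1 - v1) (al := u1 - v3 + 1) (be := v1 - v3 + 1) _ hA hB n q.
rewrite /fdiff => ->; last by ring.
by rewrite /gbinom; ring.
Qed.
End exp_conjugation.

Section formula_on_monomials.
Variable R : realType.
Local Notation P := (Pol R).
Local Notation C := (R[i]).
Local Notation L := (laurent R).
Variables (u1 v1 v2 v3 : C).

(** The factors of the explicit formula between the two S_1. *)
Definition laurent_op (g : L) : L :=
  fun_xdx (fun t => Gamma (t + u1 - v2 + 1) * rGamma (t + 1))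
   (expop (fun g => - yx_dz g)
     (fun_ydy (fun t => Gamma (t + u1 - v3 + 1) * rGamma (t + v1 - v3 + 1))
       (expop (@yx_dz R)
         (fun_xdx (fun t => Gamma (t + 1) * rGamma (t + v1 - v2 + 1)) g)))).

(** The conjugate of the explicit formula by [theta] (see [R1_formulaE]). *)
Definition frame_formula (q : P) : P := to_xyz (of_laurent (laurent_op (to_lmon q))).

Lemma R1_formulaE p : R1_formula u1 v1 v2 v3 p = thetai (frame_formula (theta p)).
Proof.
have -> : R1_formula u1 v1 v2 v3 p = S1inv (of_laurent (laurent_op (to_lmon (S1 p \mPo xyz_tuple R)))) by [].
by rewrite S1invE -to_xyzE to_xyz_S1.
Qed.

Lemma laurent_op_lin : islin laurent_op.
Proof.
apply: (lin_comp (@fun_xdx_lin _ _)).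
apply: (lin_comp (expop_lin (@opp_yx_dz_lin R) (@opp_yx_dz_nilpotent R))).
apply: (lin_comp (@fun_ydy_lin _ _)).
apply: (lin_comp (expop_lin (@yx_dz_lin R) (@yx_dz_nilpotent R))).
exact: fun_xdx_lin.
Qed.

Lemma frame_formula_lin : islin frame_formula.
Proof.
apply: (lin_comp (@to_xyz_lin R)); apply: (lin_comp (@of_laurent_lin R)).
exact: (lin_comp laurent_op_lin (@to_lmon_lin R)).
Qed.

Lemma fun_xdx_mon f a b c (p : int) q r :
  fun_xdx f (lmon R (a, b, c, p, q, r)) = f p%:~R *: lmon R (a, b, c, p, q, r).
Proof. exact: lin_ext_mon. Qed.

Lemma fun_ydy_mon f a b c (p : int) q r :
  fun_ydy f (lmon R (a, b, c, p, q, r)) = f q%:R *: lmon R (a, b, c, p, q, r).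
Proof. exact: lin_ext_mon. Qed.

Let A (q : nat) : C := Gamma (q%:R + u1 - v3 + 1).
Let B (q : nat) : C := rGamma (q%:R + v1 - v3 + 1).
Let G (p : nat) : C := Gamma (p%:R + u1 - v2 + 1).
Let H (p : nat) : C := rGamma (p%:R + v1 - v2 + 1).
Hypothesis hA : forall q, A q.+1 = (q%:R + (u1 - v3 + 1)) * A q.
Hypothesis hB : forall q, B q = (q%:R + (v1 - v3 + 1)) * B q.+1.

Lemma conj_yx_dz a b c (p : int) q r (phi := fun t => Gamma (t + u1 - v3 + 1) * rGamma (t + v1 - v3 + 1)) :
  expop (fun g => - yx_dz g) (fun_ydy phi (expop (@yx_dz R) (lmon R (a, b, c, p, q, r)))) =
  \sum_(n < r.+1) (gbinom u1 v1 n * A q * B (q + n)) *: iter n (@yx_dz R) (lmon R (a, b, c, p, q, r)).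
Proof.
have En0 n : (r < n)%N -> iter n (@yx_dz R) (lmon R (a, b, c, p, q, r)) = 0.
  by move=> rn; rewrite iter_yx_dz ffact_small// scale0r.
apply: (exp_conjugation hA hB (En := fun n => iter n (@yx_dz R) (lmon R (a, b, c, p, q, r)))).
- exact: fun_ydy_lin.
- exact: (expop_lin (@opp_yx_dz_lin R) (@opp_yx_dz_nilpotent R)).
- exact: En0.
- exact: expop_trunc.
- move=> j; rewrite iter_yx_dz (linZ (fun_ydy_lin phi)) fun_ydy_mon.
  rewrite !scalerA [in LHS]mulrC; reflexivity.
- move=> j.
  have it i : iter i (fun g => - yx_dz g) (iter j (@yx_dz R) (lmon R (a, b, c, p, q, r))) =
      (-1) ^+ i *: iter (i + j) (@yx_dz R) (lmon R (a, b, c, p, q, r)).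
    rewrite (iter_oppr _ _ (@yx_dz_lin R)) iterD; reflexivity.
  rewrite (@expop_trunc _ _ _ _ r.+1); last first.
    by move=> n rn; rewrite it En0 ?scaler0// ltn_addr.
  apply: eq_bigr => i _; rewrite it scalerA; reflexivity.
Qed.

Hypothesis hfact : forall p n, (n <= p)%N ->
  Gamma (p%:R + 1) * rGamma ((p - n)%:R + 1) = (p ^_ n)%:R :> C.

(** The powers of x with negative exponent p - n, which are dropped, carry the
    coefficient p^_n = 0 in the closed form. *)
Lemma frame_formula_X m : frame_formula 'X_[m] = V R ix1 ^+ m ix1 * (V R iy1 ^+ m iy1 * (V R iz1 ^+ m iz1 *
  \sum_(n < (m iz2).+1) coef u1 v1 A B G H (m ix2) (m iy2) (m iz2) n *:
    emon R (m ix2 - n) (m iy2 + n) (m iz2 - n))).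
Proof.
rewrite /frame_formula to_lmonX /laurent_op fun_xdx_mon.
move: (m ix1) (m iy1) (m iz1) (m ix2) (m iy2) (m iz2) => a b c p q r.
have hl1 := expop_lin (@yx_dz_lin R) (@yx_dz_nilpotent R).
have hl2 := expop_lin (@opp_yx_dz_lin R) (@opp_yx_dz_nilpotent R).
rewrite (linZ hl1) (linZ (fun_ydy_lin _)) (linZ hl2) conj_yx_dz.
rewrite (linZ (fun_xdx_lin _)) (linZ (@of_laurent_lin R)).
rewrite (linZ (@to_xyz_lin R)).
rewrite (lin_sum (fun_xdx_lin _)) (lin_sum (@of_laurent_lin R)).
rewrite (lin_sum (@to_xyz_lin R)) scaler_sumr !mulr_sumr; apply: eq_bigr => n _.
rewrite iter_yx_dz (linZ (fun_xdx_lin _)) fun_xdx_mon.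
rewrite !(linZ (@of_laurent_lin R)) !(linZ (@to_xyz_lin R)) to_xyz_of_laurent.
rewrite !scalerA -!scalerAr.
have [np|pn] := leqP n p; last first.
  rewrite (_ : (p : int) - n%:Z = Negz (n - p).-1); last first.
    by rewrite NegzE prednK ?subn_gt0// -subzn ?(ltnW pn)// opprB.
  by rewrite /coef (ffact_small pn) !(mulr0, mul0r) scaler0 scale0r.
rewrite (_ : (p : int) - n%:Z = Posz (p - n)%N); last by rewrite subzn.
congr (_ *: _); rewrite /coef -hfact// /A /B /G /H -!pmulrn; ring.
Qed.

Lemma frame_formula_emon p q r : frame_formula (emon R p q r) = \sum_(n < r.+1)
  coef u1 v1 A B G H p q r n *: emon R (p - n) (q + n) (r - n).
Proof.
(* the exponents of x1, y1, z1 are 0 *)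
pose m : 'X_{1..6} := [multinom nth 0%N [:: 0; 0; 0; p; q; r]%N i | i < 6].
have -> : emon R p q r = 'X_[m].
  by rewrite monoE mono_emon !mnmE /= !expr0 !mul1r.
by rewrite frame_formula_X !mnmE /= !expr0 !mul1r.
Qed.

Lemma frame_formula_spec_linear : spec_linear frame_formula.
Proof.
split; first exact: frame_formula_lin.
move=> i p i3; apply: (@islin_ext _ _ _ (fun p => frame_formula (V R i * p)) (fun p => V R i * frame_formula p)).
- by move=> a x y; rewrite mulrDr -scalerAr frame_formula_lin.
- by move=> a x y; rewrite frame_formula_lin mulrDr -scalerAr.
move=> m; rewrite VE -mpolyXD !frame_formula_X !mnmDE !mnm1E -VE.
have tail (j : 'I_6) : (3 <= j)%N -> ((i == j :> nat) + m j)%N = m j.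
  by move=> j3; rewrite (_ : (_ == _) = false) ?add0n//; apply/negbTE; rewrite neq_ltn (leq_trans i3).
rewrite -!(inj_eq val_inj) /= (tail ix2 isT) (tail iy2 isT) (tail iz2 isT).
move: (\sum_(_ < _) _) (m ix1) (m iy1) (m iz1) => t a b c.
move: i i3 {tail}; apply: ord6_ind => h; try discriminate h.
all: by rewrite /= ?add0n ?add1n exprS; move: (_ ^+ _) (_ ^+ _) (_ ^+ _) => x y z; ring.
Qed.
End formula_on_monomials.

(** * Generic parameters and the theorem *)

Section gamma_quotients.
Variable R : realType.
Local Notation C := (R[i]).

Definition nonint (z : C) := forall m : int, z <> m%:~R.

Lemma nonint_shift (z : C) (n : nat) : nonint z -> forall k : nat, z + n%:R + k%:R != 0.
Proof.
move=> hz k; apply/eqP => h; apply: (hz (- (n + k)%N%:Z)).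
apply/eqP; rewrite -subr_eq0; apply/eqP; rewrite -[RHS]h mulrNz -pmulrn natrD; ring.
Qed.

Lemma rGamma_rec z q : nonint z ->
  rGamma (q%:R + z + 1) = (q%:R + (z + 1)) * rGamma (q.+1%:R + z + 1) :> C.
Proof.
move=> hz; rewrite rGammaD1.
  by congr (_ * rGamma _); rewrite -?natr1; ring.
move=> k; rewrite (_ : q%:R + z + 1 + k%:R = z + q.+1%:R + k%:R); last by rewrite -natr1; ring.
exact: nonint_shift.
Qed.

Lemma Gamma_rec z q : nonint z ->
  Gamma (q.+1%:R + z + 1) = (q%:R + (z + 1)) * Gamma (q%:R + z + 1) :> C.
Proof.
move=> hz; rewrite /Gamma (rGamma_rec q hz) invfM mulrA mulfV ?mul1r//.
have := nonint_shift q.+1 hz 0; rewrite addr0; congr (_ != 0); rewrite -natr1; ring.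
Qed.

Lemma rGamma_nonint_neq0 z : nonint z -> rGamma (z + 1) != 0 :> C.
Proof. by move=> hz; apply: rGamma_neq0 => k; have := nonint_shift 1 hz k. Qed.

(** The factors Gamma(x d/dx + 1) of the formula, on the right and on the left,
    see the exponents p and p - n of x. *)
Lemma Gamma_falling p n : (n <= p)%N ->
  Gamma (p%:R + 1) * rGamma ((p - n)%:R + 1) = (p ^_ n)%:R :> C.
Proof.
have pos (m k : nat) : m%:R + 1 + k%:R != 0 :> C.
  by rewrite natr1 -natrD pnatr_eq0 addSn.
elim: n => [|n IH] np.
  by rewrite subn0 ffactn0 /Gamma mulVf//; apply: rGamma_neq0; exact: pos.
have E : (p - n)%N = (p - n.+1).+1 by rewrite -subSn.
rewrite ffactnSr natrM -IH ?(ltnW np)// E.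
move: (p - n.+1)%N => k; rewrite -[k.+1%:R]natr1.
rewrite (@rGammaD1 _ (k%:R + 1)); last exact: pos.
by rewrite mulrA mulrAC.
Qed.
End gamma_quotients.

Section generic_parameters.
Variable R : realType.
Local Notation P := (Pol R).
Local Notation C := (R[i]).

Lemma generic_pair (s : seq C) i j : generic s -> (i < j < size s)%N -> nonint (s`_i - s`_j).
Proof. by move=> h ij m; exact: h. Qed.

Lemma nonintN (a b : C) : nonint (a - b) -> nonint (b - a).
Proof. by move=> h m E; apply: (h (- m)); rewrite mulrNz -E opprB. Qed.

Section solution.
Variables (u1 v1 v2 v3 : C).
Hypothesis gen : generic [:: u1; v1; v2; v3].

Let F := frame_formula u1 v1 v2 v3.

Let g13 := generic_pair (i := 0) (j := 3) gen isT.
Let g12 := generic_pair (i := 0) (j := 2) gen isT.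
Let h13 := generic_pair (i := 1) (j := 3) gen isT.
Let h12 := generic_pair (i := 1) (j := 2) gen isT.

Let hA q : Gamma (q.+1%:R + u1 - v3 + 1) = (q%:R + (u1 - v3 + 1)) * Gamma (q%:R + u1 - v3 + 1).
Proof. by rewrite -!(addrA _ u1) Gamma_rec. Qed.
Let hB q : rGamma (q%:R + v1 - v3 + 1) = (q%:R + (v1 - v3 + 1)) * rGamma (q.+1%:R + v1 - v3 + 1).
Proof. by rewrite -!(addrA _ v1) -rGamma_rec. Qed.
Let hG q : Gamma (q.+1%:R + u1 - v2 + 1) = (q%:R + (u1 - v2 + 1)) * Gamma (q%:R + u1 - v2 + 1).
Proof. by rewrite -!(addrA _ u1) Gamma_rec. Qed.
Let hH q : rGamma (q%:R + v1 - v2 + 1) = (q%:R + (v1 - v2 + 1)) * rGamma (q.+1%:R + v1 - v2 + 1).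
Proof. by rewrite -!(addrA _ v1) -rGamma_rec. Qed.

Lemma frame_formula_closed_form :
  [/\ intertwiner u1 v1 v2 v3 F,
      forall p, F (q11 u1 v1 v2 v3 p) = q11 v1 u1 v2 v3 (F p) &
      forall p, F (q13 u1 v3 p) = q13 v1 v3 (F p)].
Proof.
have hf := @Gamma_falling R.
exact: (closed_form_intertwiner (A := fun q => Gamma (q%:R + u1 - v3 + 1))
  (B := fun q => rGamma (q%:R + v1 - v3 + 1)) (G := fun p => Gamma (p%:R + u1 - v2 + 1))
  (H := fun p => rGamma (p%:R + v1 - v2 + 1)) hA hB hG hH
  (frame_formula_spec_linear v2 hA hB hf) (frame_formula_emon v2 hA hB hf)).
Qed.

Lemma frame_formula_1_neq0 : F 1 != 0.
Proof.
have one : emon R 0 0 0 = 1 by rewrite emonE !expr0 !mulr1.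
rewrite -one /F (frame_formula_emon v2 hA hB (@Gamma_falling R)) big_ord_recl big_ord0 addr0.
rewrite subn0 addn0 one scaler_eq0 oner_eq0 orbF /coef /gbinom big_ord0 !ffactn0 !mulr1 divr1 mul1r.
rewrite !add0r /Gamma !mulf_neq0 ?invr_neq0//; exact: rGamma_nonint_neq0.
Qed.
End solution.

Definition solution (u1 v1 v2 v3 : C) : P -> P := R1_formula u1 v1 v2 v3.

Lemma theta_lin : islin (@theta R). Proof. by move=> a p q; rewrite thetaD thetaZ. Qed.
Lemma thetai_lin : islin (@thetai R). Proof. by move=> a p q; rewrite thetaiD thetaiZ. Qed.

Lemma solution_linear u1 v1 v2 v3 : linear (solution u1 v1 v2 v3).
Proof.
move=> a p q; rewrite /solution !R1_formulaE theta_lin (frame_formula_lin _ _ _ _) thetai_lin.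
by [].
Qed.

HB.instance Definition _ u1 v1 v2 v3 :=
  GRing.isLinear.Build C P P *:%R (solution u1 v1 v2 v3) (solution_linear u1 v1 v2 v3).

Definition solution_family : opfamily R := fun u1 v1 v2 v3 => solution u1 v1 v2 v3.

Lemma islin_D i : islin (@D R i). Proof. by move=> a p q; rewrite DD DZ. Qed.

Lemma intertwiner_combination u1 v1 v2 v3 (F F' : P -> P) c :
  intertwiner u1 v1 v2 v3 F -> intertwiner u1 v1 v2 v3 F' ->
  intertwiner u1 v1 v2 v3 (fun p => F p - c *: F' p).
Proof.
move=> [l hV hD h23 h22 h33 h32 h21 h31] [l' hV' hD' h23' h22' h33' h32' h21' h31'].
have [[_ [s21 _] [s22 _] [s32 _] [s33 _]] _] := spec_linear_ops u1 u1 v2 v3.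
have s31 : islin (@o31 R u1 v2 v3).
  move=> a p q; rewrite !o31_commutator s32 !s21 s32 scalerBr opprD.
  by rewrite addrACA.
have lin (o : P -> P) p q : islin o -> o (p - c *: q) = o p - c *: o q.
  by move=> ho; rewrite (linD ho) (linN ho) (linZ ho).
split.
- move=> a p q; rewrite l l' scalerDr opprD scalerBr addrACA; congr (_ - _ + _).
  by rewrite !scalerA mulrC.
- by move=> i p i3; rewrite hV// hV'// mulrBr scalerAr.
- by move=> i p i3; rewrite hD// hD'// (lin _ _ _ (@islin_D i)).
- by move=> p; rewrite h23 h23' (lin _ _ _ (@islin_D iz2)).
- by move=> p; rewrite h22 h22' (lin _ _ _ s22).
- by move=> p; rewrite h33 h33' (lin _ _ _ s33).
- by move=> p; rewrite h32 h32' (lin _ _ _ s32).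
- by move=> p; rewrite h21 h21' (lin _ _ _ s21).
- by move=> p; rewrite h31 h31' (lin _ _ _ s31).
Qed.

(** A combination of F and F' that kills 1 is an intertwiner, hence vanishes. *)
Lemma intertwiner_proportional u1 v1 v2 v3 (F F' : P -> P) :
  generic [:: u1; v1; v2; v3] ->
  intertwiner u1 v1 v2 v3 F -> intertwiner u1 v1 v2 v3 F' -> F' 1 != 0 ->
  exists c, forall p, F p = c *: F' p.
Proof.
move=> gen hF hF' F'0.
have [k Fk] := intertwiner_const hF; have [k' Fk'] := intertwiner_const hF'.
have k'0 : k' != 0 by apply: contraNneq F'0 => k0; rewrite Fk' k0 Cst0.
exists (k / k') => p; apply/eqP; rewrite -subr_eq0; apply/eqP.
apply: (intertwiner_eq0 (intertwiner_combination (k / k') hF hF')).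
- exact: (generic_pair (i := 1) (j := 2) gen isT).
- exact: (generic_pair (i := 1) (j := 3) gen isT).
- exact: (generic_pair (i := 2) (j := 3) gen isT).
- by rewrite Fk Fk' scale_Cst -CstM mulfVK// subrr.
Qed.

(** The equations with all parameters shifted by 1 hold for the same operator by
    shift invariance. *)
Lemma solution_intertwiner (G : P -> P) u1 u2 u3 v1 v2 v3 : islin G ->
  (forall m n : nat, opmx_compl G (opmul (L1 u1 (u2 + m%:R) (u3 + n%:R)) (L2 v1 v2 v3)) =
    opmx_compr (opmul (L1 v1 (u2 + m%:R) (u3 + n%:R)) (L2 u1 v2 v3)) G) ->
  (forall m n : nat,
    opmx_compl G (opmul (L1 (u1 + 1) (u2 + m%:R + 1) (u3 + n%:R + 1)) (L2 (v1 + 1) (v2 + 1) (v3 + 1))) =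
    opmx_compr (opmul (L1 (v1 + 1) (u2 + m%:R + 1) (u3 + n%:R + 1)) (L2 (u1 + 1) (v2 + 1) (v3 + 1))) G) ->
  intertwiner u1 v1 v2 v3 (fun p => theta (G (thetai p))).
Proof.
move=> hG E0 E1.
have hF : islin (fun p => theta (G (thetai p))).
  by move=> a p q; rewrite thetai_lin hG theta_lin.
have FG p : theta (G (thetai (theta p))) = theta (G p) by rewrite thetaK.
have aG : additive_op G by move=> p q; rewrite (linD hG).
apply: (intertwiner_of_equations (u2 := u2) (u3 := u3)) => // m n.
  by apply/(LL_equationE _ _ _ _ _ _ aG FG).
by apply/(LL_equationE _ _ _ _ _ _ aG FG).
Qed.

(** A number whose imaginary part exceeds those of s. *)
Lemma exists_nonint (s : seq C) : exists u, forall x, x \in s -> nonint (u - x).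
Proof.
pose T : R := 1 + \sum_(x <- s) `|complex.Im x|.
exists (0 +i* T)%C => x xs m /(congr1 (@complex.Im R)).
have -> : complex.Im (m%:~R : C) = 0.
  have -> : (m%:~R : C) = (m%:~R : R)%:C%C by rewrite rmorph_int.
  by [].
have le : `|complex.Im x| <= \sum_(x <- s) `|complex.Im x|.
  elim: s xs {T} => // y s IH; rewrite inE big_cons => /orP[/eqP->|/IH h].
    by rewrite lerDl sumr_ge0.
  by rewrite (le_trans h)// lerDr.
have := ler_norm (complex.Im x).
case: x le {xs} => a b /= le le'; rewrite /T => E.
by move: le le'; lra.
Qed.

Lemma genericP (s : seq C) :
  (forall i j : nat, (i < j < size s)%N -> nonint (s`_i - s`_j)) <-> generic s.
Proof. by split => h i j ij m; exact: h. Qed.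

Lemma nonint_shift_int (a : C) (m : int) : nonint a -> nonint (a + m%:~R).
Proof.
move=> h k E; apply: (h (k - m)); rewrite rmorphB /= -E; ring.
Qed.

Lemma generic6 (u1 u2 u3 v1 v2 v3 : C) : generic [:: u1; v1; v2; v3] ->
  (forall x, x \in [:: u1; v1; v2; v3] -> nonint (u2 - x)) ->
  (forall x, x \in [:: u2; u1; v1; v2; v3] -> nonint (u3 - x)) ->
  generic [:: u1; u2; u3; v1; v2; v3].
Proof.
move=> gen h2 h3.
have g i j : (i < j < 4)%N -> nonint ([:: u1; v1; v2; v3]`_i - [:: u1; v1; v2; v3]`_j).
  by move=> ij m; exact: gen.
have := (g 0%N 1%N isT, g 0%N 2%N isT, g 0%N 3%N isT, g 1%N 2%N isT, g 1%N 3%N isT, g 2%N 3%N isT).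
rewrite /= => -[[[[[g01 g02] g03] g12] g13] g23].
have a0 : nonint (u1 - u2) by apply/nonintN/h2; rewrite !inE eqxx.
have a1 : nonint (u1 - u3) by apply/nonintN/h3; rewrite !inE eqxx ?orbT.
have a2 : nonint (u2 - u3) by apply/nonintN/h3; rewrite !inE eqxx ?orbT.
have b1 : nonint (u2 - v1) by apply/h2; rewrite !inE eqxx ?orbT.
have b2 : nonint (u2 - v2) by apply/h2; rewrite !inE eqxx ?orbT.
have b3 : nonint (u2 - v3) by apply/h2; rewrite !inE eqxx ?orbT.
have c1 : nonint (u3 - v1) by apply/h3; rewrite !inE eqxx ?orbT.
have c2 : nonint (u3 - v2) by apply/h3; rewrite !inE eqxx ?orbT.
have c3 : nonint (u3 - v3) by apply/h3; rewrite !inE eqxx ?orbT.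
apply/genericP => i j /andP[+ +]; move: i j.
by case=> [|[|[|[|[|[|i]]]]]]; case=> [|[|[|[|[|[|j]]]]]].
Qed.

Lemma generic6_sub (u1 u2 u3 v1 v2 v3 : C) : generic [:: u1; u2; u3; v1; v2; v3] ->
  generic [:: u1; v1; v2; v3].
Proof.
move=> gen.
have g i j : (i < j < 6)%N -> nonint ([:: u1; u2; u3; v1; v2; v3]`_i - [:: u1; u2; u3; v1; v2; v3]`_j).
  by move=> ij m; exact: gen.
apply/genericP => i j; move: i j.
case=> [|[|[|[|i]]]]; case=> [|[|[|[|j]]]]; rewrite ?ltnn ?andbF //= => _.
- exact: (g 0%N 3%N isT). - exact: (g 0%N 4%N isT). - exact: (g 0%N 5%N isT).
- exact: (g 3%N 4%N isT). - exact: (g 3%N 5%N isT). - exact: (g 4%N 5%N isT).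
Qed.

Lemma generic_addl (s : seq C) (c : C) : generic s -> generic [seq x + c | x <- s].
Proof.
move=> gen i j; rewrite size_map => /[dup] ij /andP[lij jn] m E.
have [i_ j_] : (i < size s)%N /\ (j < size s)%N by split=> //; exact: ltn_trans jn.
apply: (gen i j ij m); rewrite -E !(nth_map 0)//; ring.
Qed.
End generic_parameters.

Theorem proposition4 (R : realType) :
  (exists R1 : opfamily R,
     [/\ shift_invariant R1,
         defining_equations R1 &
         forall u1 v1 v2 v3 : R[i], generic [:: u1; v1; v2; v3] ->
           exists p : Pol R, R1 u1 v1 v2 v3 p <> 0])
  /\
  (forall R1 : opfamily R, shift_invariant R1 -> defining_equations R1 ->
     forall u1 v1 v2 v3 : R[i], generic [:: u1; v1; v2; v3] ->
       exists c : R[i],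
         (forall p : Pol R,
            R1 u1 v1 v2 v3 p = c *: R1_formula u1 v1 v2 v3 p)
         /\ ((exists p : Pol R, R1 u1 v1 v2 v3 p <> 0) -> c <> 0)).
Proof.
split.
  exists (@solution_family R); split.
  - move=> u1 v1 v2 v3 _ l p.
    rewrite /solution_family /= /solution /R1_formula.
    have e a b t : t + (a + l) - (b + l) + 1 = t + a - b + 1 :> R[i] by ring.
    have e1 : (fun t => Gamma (t + (u1 + l) - (v2 + l) + 1) * rGamma (t + 1)) =
      (fun t => Gamma (t + u1 - v2 + 1) * rGamma (t + 1)).
      by apply/funext => t; rewrite e.
    have e2 : (fun t => Gamma (t + (u1 + l) - (v3 + l) + 1) * rGamma (t + (v1 + l) - (v3 + l) + 1)) =
      (fun t => Gamma (t + u1 - v3 + 1) * rGamma (t + v1 - v3 + 1)).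
      by apply/funext => t; rewrite !e.
    have e3 : (fun t => Gamma (t + 1) * rGamma (t + (v1 + l) - (v2 + l) + 1)) =
      (fun t => Gamma (t + 1) * rGamma (t + v1 - v2 + 1)).
      by apply/funext => t; rewrite !e.
    by rewrite e1 e2 e3.
  - move=> u1 u2 u3 v1 v2 v3 gen.
    have [hF h11 h13] := frame_formula_closed_form (generic6_sub gen).
    have additive : additive_op (solution u1 v1 v2 v3).
      by move=> p q; exact: (linD (@solution_linear R u1 v1 v2 v3)).
    have conj p : frame_formula u1 v1 v2 v3 (theta p) = theta (solution u1 v1 v2 v3 p).
      by rewrite /solution R1_formulaE thetaiK.
    apply/(LL_equationE _ _ _ _ _ _ additive conj).
    exact: intertwiner_equation.
  - move=> u1 v1 v2 v3 gen; exists 1; rewrite /= /solution R1_formulaE => /(congr1 (@theta R)).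
    have [t1 t0] : theta 1 = 1 :> Pol R /\ theta 0 = 0 :> Pol R.
      by split; rewrite thetaU ?comp_mpoly1 ?comp_mpoly0.
    by rewrite thetaiK t1 t0; apply/eqP/frame_formula_1_neq0.
move=> R1 sh eqs u1 v1 v2 v3 gen.
have lR1 : islin (R1 u1 v1 v2 v3) by move=> a p q; rewrite linearP.
(* R_1 does not depend on u2 and u3, which can be chosen at will *)
have [u2 h2] := exists_nonint [:: u1; v1; v2; v3].
have [u3 h3] := exists_nonint [:: u2; u1; v1; v2; v3].
have gen6 m n : generic [:: u1; u2 + m%:R; u3 + n%:R; v1; v2; v3].
  apply: generic6 => // x.
    by move=> /h2 h; rewrite addrAC; exact: (nonint_shift_int (m := m)).
  rewrite inE => /orP[/eqP-> | xs]; last first.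
    by rewrite addrAC; apply: (nonint_shift_int (m := n)); apply: h3; rewrite inE xs orbT.
  rewrite (_ : u3 + n%:R - (u2 + m%:R) = u3 - u2 + (n%:Z - m%:Z)%:~R).
    by apply: nonint_shift_int; apply: h3; rewrite inE eqxx.
  by rewrite rmorphB /= -!pmulrn; ring.
have hF : intertwiner u1 v1 v2 v3 (fun p => theta (R1 u1 v1 v2 v3 (thetai p))).
  apply: (solution_intertwiner (u2 := u2) (u3 := u3) lR1) => m n.
    exact: eqs.
  have := eqs _ _ _ _ _ _ (generic_addl (c := 1) (gen6 m n)).
  have -> // : R1 (u1 + 1) (v1 + 1) (v2 + 1) (v3 + 1) = R1 u1 v1 v2 v3 :> (Pol R -> Pol R).
  by apply/funext => p; rewrite -sh.
have [hF0 _ _] := frame_formula_closed_form gen.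
have [c hc] := intertwiner_proportional gen hF hF0 (frame_formula_1_neq0 gen).
have E p : R1 u1 v1 v2 v3 p = c *: R1_formula u1 v1 v2 v3 p.
  by have := congr1 (@thetai R) (hc (theta p)); rewrite /= !thetaK thetaiZ -R1_formulaE.
exists c; split => // -[p Rp] c0; apply: Rp.
by rewrite E c0 scale0r.
Qed.
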